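(* Let $\mu$ be a positive atomless Radon measure on $[0,T]$ with support $[0,T]$, let $k_0,k_T$ be closed proper convex functions on $\mathbb{R}^d$, and let $h$ be a convex normal integrand on $[0,T]\times\mathbb{R}^d$ such that: $t\mapsto\operatorname{dom}h_t$ is left-inner semicontinuous; for every $x\in X$, $x\in\operatorname{int}L^\infty(\operatorname{dom}h)\Rightarrow x\in\operatorname{dom}I_h\Rightarrow x_t\in\operatorname{cl}\operatorname{dom}h_t$ for all $t\in[0,T]$; $I_h$ is proper on $X$; and $X\cap\operatorname{int}L^\infty(\operatorname{dom}h)\ne\emptyset$. Define $f(x)=I_h(x)+k_0(x_0)+k_T(x_{T+})$ on $X$. Then $f$ is closed (lower semicontinuous for $\sigma(X,V)$) and its conjugate with respect to the pairing of $X$ and $V$ is $$f^*(v)=\begin{cases}J_{h^*}(-Dv)+k_0^*(v_{-\infty}-v_0)+k_T^*(v_T)&\text{if } v\in V_{BV},\\ +\infty&\text{otherwise.}\end{cases}$$ Moreover, $v\in\partial f(x)$ if and only if $v\in V_{BV}$ and $-dv/d\mu\in\partial h_t(x_t)$ for $\mu$-a.e. $t$; $-dv/d|Dv^s|\in\partial^s h_t(x_t)$ for $|(Dv)^s|$-a.e. $t$; $v_{-\infty}-v_0\in\partial k_0(x_0)$; and $v_T\in\partial k_T(x_{T+})$.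
   Context: Fix $T>0$, $d\ge1$. $X$ is the space of left-continuous functions $x:\mathbb{R}\to\mathbb{R}^d$ of bounded variation constant on $(-\infty,0]$ and on $(T,\infty)$; $x_{T+}$ denotes the value on $(T,\infty)$ and $Dx$ the unique $\mathbb{R}^d$-valued Radon measure on $[0,T]$ with $x_t=x_0+Dx([0,t])$ for $t\in[0,T]$. $C$ is the space of continuous $v:[0,T]\to\mathbb{R}^d$ and $V:=\mathbb{R}^d\times C$, with elements written $v=(v_{-\infty},(v_t)_{t\in[0,T]})$; $X$ and $V$ are paired by $\langle v,x\rangle=v_{-\infty}\cdot x_0+\int_{[0,T]}v\,dDx$. Conjugate: $f^*(v)=\sup_{x\in X}\{\langle v,x\rangle-f(x)\}$; $v\in\partial f(x)$ iff $f(x')\ge f(x)+\langle v,x'-x\rangle$ for all $x'\in X$. $V_{BV}$ is the set of $v\in V$ whose component on $[0,T]$ has bounded variation; for such $v$, $Dv$ is the measure with $v_t=v_0+Dv([0,t])$, $(Dv)^a,(Dv)^s$ its absolutely continuous and singular parts w.r.t. $\mu$, $dv/d\mu:=d(Dv)^a/d\mu$, $dv/d|Dv^s|:=d(Dv)^s/d|(Dv)^s|$. A convex normal integrand $h$: $h_t:\mathbb{R}^d\to\mathbb{R}\cup\{+\infty\}$ convex with $t\mapsto\operatorname{epi}h_t$ closed-valued and Borel measurable; $h^*_t(y)=\sup_x\{x\cdot y-h_t(x)\}$ (pointwise conjugate). For a closed proper convex $g$, its recession function is $g^\infty(u)=\sup_{\alpha>0}(g(\bar u+\alpha u)-g(\bar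 u))/\alpha$ for any $\bar u\in\operatorname{dom}g$; $f^\infty$ for a normal integrand is defined pointwise in $t$. For an $\mathbb{R}^d$-valued Radon measure $\theta$ on $[0,T]$ and normal integrand $g$, $J_g(\theta):=\int g_t(d\theta^a/d\mu)\,d\mu+\int g_t^\infty(d\theta^s/d|\theta^s|)\,d|\theta^s|$. $\partial^s h_t:=\partial\delta_{\operatorname{cl}\operatorname{dom}h_t}$ (normal cone to $\operatorname{cl}\operatorname{dom}h_t$). $I_h(x)=\int h_t(x_t)d\mu_t$ (with $+\infty$ unless positive part integrable). Left-inner semicontinuity: with $\tau$ the topology on $[0,T]$ generated by intervals $(s,t]$, $t\mapsto S_t$ is left-isc if $\{t:S_t\cap A\ne\emptyset\}$ is $\tau$-open for all open $A\subseteq\mathbb{R}^d$. $L^\infty(S):=\{x\in L^\infty([0,T],\mu;\mathbb{R}^d):x_t\in S_t\ \mu\text{-a.e.}\}$ with interior taken in the $L^\infty$ norm topology.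
   Formalization: The measure Dx of a left-continuous x is taken to satisfy x_t = x_0 + Dx([0,t)) for t > 0, so that x_{T+} = x_0 + Dx([0,T]); the version with the closed interval [0,t] has no solution when x has a jump in [0,T]. *)

(* Defs.v *)
From HB Require Import structures.
From mathcomp Require Import all_boot all_order all_algebra.
From mathcomp Require Import all_classical all_reals all_analysis.
Import Order.TTheory GRing.Theory Num.Theory.
Import numFieldNormedType.Exports.

Set Implicit Arguments.
Unset Strict Implicit.
Unset Printing Implicit Defensive.

Local Open Scope ring_scope.
Local Open Scope classical_set_scope.

Definition dotv (R : realType) (d : nat) (u w : 'rV[R]_d) : R :=
  \sum_(i < d) u ord0 i * w ord0 i.

Definition enorm (R : realType) (d : nat) (u : 'rV[R]_d) : R :=
  Num.sqrt (\sum_(i < d) u ord0 i ^+ 2).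

Definition edom (R : realType) (d : nat) (g : 'rV[R]_d -> \bar R) : set 'rV[R]_d :=
  [set u | (g u < +oo)%E].

Definition epi (R : realType) (d : nat) (g : 'rV[R]_d -> \bar R) : set ('rV[R]_d * R) :=
  [set p | (g p.1 <= p.2%:E)%E].

Definition convex_fun (R : realType) (d : nat) (g : 'rV[R]_d -> \bar R) : Prop :=
  (forall u, g u != -oo%E) /\
  (forall (u w : 'rV[R]_d) (l : R), 0 < l < 1 ->
     (g (l *: u + (1 - l) *: w)%R <= l%:E * g u + (1 - l)%R%:E * g w)%E).

Definition closed_proper_convex (R : realType) (d : nat) (g : 'rV[R]_d -> \bar R) : Prop :=
  convex_fun g /\ closed (epi g) /\ (exists u, (g u < +oo)%E).

Definition conjv (R : realType) (d : nat) (g : 'rV[R]_d -> \bar R) (y : 'rV[R]_d) : \bar R :=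
  ereal_sup [set ((dotv u y)%:E - g u)%E | u in [set: 'rV[R]_d]].

Definition recession (R : realType) (d : nat) (g : 'rV[R]_d -> \bar R) (u : 'rV[R]_d) : \bar R :=
  let ub := xget 0 (edom g) in
  ereal_sup [set ((g (ub + a *: u)%R - g ub) * (a^-1)%:E)%E | a in [set a : R | 0 < a]].

Definition subdiff (R : realType) (d : nat) (g : 'rV[R]_d -> \bar R) (u y : 'rV[R]_d) : Prop :=
  forall u', (g u + (dotv y (u' - u)%R)%:E <= g u')%E.

Definition indic (R : realType) (d : nat) (C : set 'rV[R]_d) (u : 'rV[R]_d) : \bar R :=
  if `[< C u >] then 0%E else +oo%E.

Definition subdiff_s (R : realType) (d : nat) (g : 'rV[R]_d -> \bar R) (u y : 'rV[R]_d) : Prop :=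
  subdiff (indic (closure (edom g))) u y.

Definition eint (R : realType) (m : {measure set R -> \bar R}) (D : set R) (f : R -> \bar R) : \bar R :=
  if (\int[m]_(t in D) maxe (f t) 0%E < +oo)%E then (\int[m]_(t in D) f t)%E else +oo%E.

Definition I0T (R : realType) (T : R) : set R := `[0, T].

Definition Ico0 (R : realType) (t : R) : set R := `[0, t[.
Definition Icc0 (R : realType) (t : R) : set R := `[0, t].

(* positive atomless Radon measure on [0,T] with support [0,T]
   (a finite Borel measure on R concentrated on [0,T]) *)
Definition good_measure (R : realType) (T : R) (mu : {measure set R -> \bar R}) : Prop :=
  mu (~` (I0T T)) = 0%E /\
  (mu ((I0T T)) < +oo)%E /\
  (forall t : R, mu [set t] = 0%E) /\
  (forall O : set R, open O -> O `&` (I0T T) !=set0 -> (0 < mu O)%E).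

Definition normal_integrand (R : realType) (d : nat) (T : R)
    (h : R -> 'rV[R]_d -> \bar R) : Prop :=
  (forall t, (I0T T) t -> convex_fun (h t)) /\
  (forall t, (I0T T) t -> closed (epi (h t))) /\
  (forall O : set ('rV[R]_d * R), open O ->
     measurable ([set t | epi (h t) `&` O !=set0] `&` (I0T T))).

(* tau: topology on [0,T] generated by the intervals (s,t]; a set S is
   tau-open iff every point p of S has a tau-neighbourhood (s,p] /\ [0,T]
   inside S *)
Definition tau_open (R : realType) (T : R) (S : set R) : Prop :=
  S `<=` (I0T T) /\
  (forall p, S p -> exists2 s, s < p & forall r, (I0T T) r -> s < r <= p -> S r).

Definition left_isc (R : realType) (d : nat) (T : R) (S : R -> set 'rV[R]_d) : Prop :=
  forall A : set 'rV[R]_d, open A ->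
    tau_open T [set t | (I0T T) t /\ S t `&` A !=set0].

Definition BV_on (R : realType) (d : nat) (D : set R) (x : R -> 'rV[R]_d) : Prop :=
  exists M : R, forall (n : nat) (s : nat -> R),
    (forall k, s k <= s k.+1) -> (forall k, D (s k)) ->
    \sum_(k < n) enorm (x (s k.+1) - x (s k)) <= M.

Definition inX (R : realType) (d : nat) (T : R) (x : R -> 'rV[R]_d) : Prop :=
  (forall t, x s @[s --> t^'-] --> x t) /\
  BV_on [set: R] x /\
  (forall t, t <= 0 -> x t = x 0) /\
  (forall t s, T < t -> T < s -> x t = x s).

Definition xTplus (R : realType) (d : nat) (T : R) (x : R -> 'rV[R]_d) : 'rV[R]_d :=
  x (T + 1).

(* (lam, g) represents the R^d-valued Radon measure Dx := g lam on [0,T]: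
   x_t = x_0 + Dx([0,t)) for t > 0 (so that x_{T+} = x_0 + Dx([0,T])) *)
Definition DxRep (R : realType) (d : nat) (T : R) (x : R -> 'rV[R]_d)
    (lam : {measure set R -> \bar R}) (g : R -> 'rV[R]_d) : Prop :=
  lam (~` (I0T T)) = 0%E /\ (lam ((I0T T)) < +oo)%E /\
  (forall i : 'I_d, lam.-integrable (I0T T) (fun t => (g t ord0 i)%:E)) /\
  (forall (t : R) (i : 'I_d), 0 < t ->
     ((x t ord0 i - x 0 ord0 i)%R%:E = \int[lam]_(r in (Ico0 t)) (g r ord0 i)%:E)%E).

Definition Vtype (R : realType) (d : nat) := ('rV[R]_d * (R -> 'rV[R]_d))%type.

Definition inV (R : realType) (d : nat) (T : R) (v : Vtype R d) : Prop :=
  {within (I0T T), continuous v.2}.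

Definition inVBV (R : realType) (d : nat) (T : R) (v : Vtype R d) : Prop :=
  inV T v /\ BV_on (I0T T) v.2.

(* bilinear pairing <v,x> = v_{-oo}.x_0 + \int v dDx *)
Definition pairing (R : realType) (d : nat) (T : R) (v : Vtype R d) (x : R -> 'rV[R]_d) : R :=
  xget 0 [set r : R | exists (lam : {measure set R -> \bar R}) (g : R -> 'rV[R]_d),
    DxRep T x lam g /\
    (r%:E = (dotv v.1 (x 0))%:E +
            \sum_(i < d) \int[lam]_(t in (I0T T)) (v.2 t ord0 i * g t ord0 i)%R%:E)%E].

(* Lebesgue decomposition of Dv (v in V_BV) w.r.t. mu:
     Dv = a mu + s sig,  sig singular w.r.t. mu, |s| = 1 sig-a.e.,
   so that a = dv/dmu, sig = |(Dv)^s| and s = dv/d|Dv^s|;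
   Dv is characterized by v_t = v_0 + Dv([0,t]) for t in [0,T]. *)
Definition DvDec (R : realType) (d : nat) (T : R) (mu : {measure set R -> \bar R})
    (v : Vtype R d) (a : R -> 'rV[R]_d) (s : R -> 'rV[R]_d)
    (sig : {measure set R -> \bar R}) : Prop :=
  sig (~` (I0T T)) = 0%E /\ (sig ((I0T T)) < +oo)%E /\
  (exists N : set R, measurable N /\ mu N = 0%E /\ sig (~` N) = 0%E) /\
  (forall i : 'I_d, mu.-integrable (I0T T) (fun t => (a t ord0 i)%:E)) /\
  (forall i : 'I_d, sig.-integrable (I0T T) (fun t => (s t ord0 i)%:E)) /\
  (\forall t \ae sig, (I0T T) t -> enorm (s t) = 1) /\
  (forall (t : R) (i : 'I_d), (I0T T) t ->
     ((v.2 t ord0 i - v.2 0 ord0 i)%R%:E =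
        \int[mu]_(r in (Icc0 t)) (a r ord0 i)%:E +
        \int[sig]_(r in (Icc0 t)) (s r ord0 i)%:E)%E).

Definition Jfun (R : realType) (d : nat) (T : R) (mu : {measure set R -> \bar R})
    (g : R -> 'rV[R]_d -> \bar R) (a s : R -> 'rV[R]_d)
    (sig : {measure set R -> \bar R}) : \bar R :=
  (eint mu (I0T T) (fun t => g t (a t)) +
   eint sig (I0T T) (fun t => recession (g t) (s t)))%E.

Definition Ih (R : realType) (d : nat) (T : R) (mu : {measure set R -> \bar R})
    (h : R -> 'rV[R]_d -> \bar R) (x : R -> 'rV[R]_d) : \bar R :=
  eint mu (I0T T) (fun t => h t (x t)).

Definition ffun (R : realType) (d : nat) (T : R) (mu : {measure set R -> \bar R})
    (h : R -> 'rV[R]_d -> \bar R) (k0 kT : 'rV[R]_d -> \bar R)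
    (x : R -> 'rV[R]_d) : \bar R :=
  (Ih T mu h x + k0 (x 0%R) + kT (xTplus T x))%E.

Definition fconj (R : realType) (d : nat) (T : R) (F : (R -> 'rV[R]_d) -> \bar R)
    (v : Vtype R d) : \bar R :=
  ereal_sup [set ((pairing T v x)%:E - F x)%E | x in [set x | inX T x]].

Definition fsubdiff (R : realType) (d : nat) (T : R) (F : (R -> 'rV[R]_d) -> \bar R)
    (x : R -> 'rV[R]_d) (v : Vtype R d) : Prop :=
  forall x', inX T x' ->
    (F x + (pairing T v (fun t => x' t - x t))%:E <= F x')%E.

Definition weak_lsc (R : realType) (d : nat) (T : R) (F : (R -> 'rV[R]_d) -> \bar R) : Prop :=
  forall x, inX T x -> forall alpha : R, (alpha%:E < F x)%E ->
    exists (n : nat) (vs : 'I_n -> Vtype R d) (eps : R),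
      (forall k, inV T (vs k)) /\ 0 < eps /\
      forall x', inX T x' ->
        (forall k, `|pairing T (vs k) (fun t => x' t - x t)| < eps) ->
        (alpha%:E < F x')%E.

Definition in_int_Linf_dom (R : realType) (d : nat) (T : R) (mu : {measure set R -> \bar R})
    (h : R -> 'rV[R]_d -> \bar R) (x : R -> 'rV[R]_d) : Prop :=
  exists2 eps : R, 0 < eps &
    forall y : R -> 'rV[R]_d,
      (forall i : 'I_d, measurable_fun (I0T T) (fun t => y t ord0 i)) ->
      (exists2 delta : R, delta < eps &
         \forall t \ae mu, (I0T T) t -> enorm (y t - x t) <= delta) ->
      \forall t \ae mu, (I0T T) t -> edom (h t) (y t).

(* Main.v *)
(** A function [x] of [X] is a step limit, and the pairing is a limit of Riemann-Stieltjes sums, so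
    for [v] in [V_BV] integration by parts turns [<v,x>] into
    [(v_-oo - v_0).x_0 + v_T.x_{T+} - \int x.dDv], and the ends [x_0], [x_{T+}] can be changed freely
    without affecting the integral terms because [mu] and [Dv] have no atoms.  Fenchel's inequality
    then gives one half of the formula for [f^*].  For the other half one has to interchange the
    supremum over [x] with the integrals with respect to [mu] and [|Dv^s|], using only left-continuous
    functions of bounded variation: those staying uniformly inside [dom h] are stable under gluing
    along finite unions of intervals [(s,p]], which approximate all Borel sets, and by left-inner
    semicontinuity countably many of them pass, at every [t > 0], through all rational interior points
    of [dom h_t].  If [v] is not of bounded variation, small step perturbations of a function
    uniformly inside [dom h] make [<v,x>] unbounded while [f] stays bounded.  Lower semicontinuity
    follows from integrable affine minorants of [h_t], obtained by projecting measurably onto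
    [epi h_t]; each gives a [v] whose derivative is absolutely continuous.  The subdifferential is
    the equality case of Fenchel's inequality, term by term. *)
Require Import Defs.
From HB Require Import structures.
From mathcomp Require Import all_boot all_order all_algebra.
From mathcomp Require Import all_classical all_reals all_analysis.
From mathcomp Require Import measurable_realfun zify ring lra.
Import Order.TTheory GRing.Theory Num.Theory.
Import numFieldNormedType.Exports.
Local Open Scope ring_scope.
Local Open Scope classical_set_scope.

Set Implicit Arguments.
Unset Strict Implicit.
Unset Printing Implicit Defensive.

(** * Convex analysis in finite dimension *)

(** The singular term becomes tractable because the recession function of [conjv (h t)] is the
    support function of [edom (h t)] ([recession_conjv]). Both integrands of [Jfun] are then suprema
    over points of [edom (h t)], and since these domains contain cubes, both suprema may be
    restricted to rational interior points; this yields measurability in [t] and a countable family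
    for monotone convergence. The measure [sig] lives on a [mu]-null set, so statements valid
    [mu]-almost everywhere say nothing about it: the functions used for approximation have a cube of
    fixed radius inside [edom (h t)] at every [t], and Fenchel's inequality for the singular part
    rests on [hdom_cl], which also speaks of every [t]. Cubes replace Euclidean balls because
    membership in a convex set then reduces to finitely many points, one in each orthant. Euclidean
    geometry enters with the projections onto epigraphs, whose explicit form makes affine minorants
    measurable in [t]. *)

Definition cvx_set (R : realType) (d : nat) (D : set 'rV[R]_d) : Prop :=
  forall u w l, D u -> D w -> 0 < l < 1 -> D (l *: u + (1 - l) *: w).

Definition cube (R : realType) (d : nat) (y : 'rV[R]_d) (e : R) : set 'rV[R]_d :=
  [set w | forall i, `|w ord0 i - y ord0 i| < e].

Section ConvexGeometry.
Context {R : realType} {d : nat}.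
Implicit Types (D : set 'rV[R]_d) (g : 'rV[R]_d -> \bar R) (u w y x : 'rV[R]_d).

(* Coordinates are equalized with those of [y] one at a time: two points lying on opposite sides
   in coordinate [k] have a convex combination that agrees with [y] there. *)
Lemma cvx_orthants D y : cvx_set D ->
  (forall s : 'I_d -> bool, exists2 u, D u &
     forall i, 0 < (-1) ^+ s i * (u ord0 i - y ord0 i)) ->
  D y.
Proof.
move=> cD H.
have K k : forall s : 'I_d -> bool, exists2 u, D u &
    forall i : 'I_d, if (i < k)%N then u ord0 i = y ord0 i
      else 0 < (-1) ^+ s i * (u ord0 i - y ord0 i).
  elim: k => [|k IH] s; first by have [u Du Hu] := H s; exists u.
  have [kd|dk] := ltnP k d; last first.
    have [u Du Hu] := IH s; exists u => // i.
    by have := Hu i; rewrite !(leq_trans (ltn_ord i)) // ltnW.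
  pose i0 := Ordinal kd.
  have [u1 D1 H1] := IH (fun i => if i == i0 then false else s i).
  have [u2 D2 H2] := IH (fun i => if i == i0 then true else s i).
  have := H1 i0; have := H2 i0; rewrite ltnn eqxx expr0 expr1 => n0 p0.
  pose p := u1 ord0 i0 - y ord0 i0; pose n := y ord0 i0 - u2 ord0 i0.
  have {}p0 : 0 < p by rewrite /p; lra.
  have {}n0 : 0 < n by rewrite /n; lra.
  have pn0 : 0 < p + n by lra.
  have l01 : 0 < n / (p + n) < 1 by rewrite divr_gt0//= ltr_pdivrMr//; lra.
  exists (n / (p + n) *: u1 + (1 - n / (p + n)) *: u2); first exact: cD.
  move=> i; rewrite !mxE; have := H1 i; have := H2 i; rewrite ltnS.
  set l := n / (p + n) in l01 *; move: l01 => /andP[l0 l1].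
  have [->|ii0] := eqVneq i i0.
    rewrite /= leqnn ltnn => _ _.
    have : l * (p + n) = n by rewrite divfK// gt_eqF.
    by rewrite /p /n; lra.
  have ne : (i : nat) <> k by move=> ik; move/eqP: ii0; apply; exact: val_inj.
  case: ltnP => ik; first by rewrite (ltnW ik) => -> ->; lra.
  have -> : (i <= k)%N = false by apply/negbTE; rewrite -ltnNge ltn_neqAle ik andbT; apply/eqP => e; apply: ne.
  set s1 := (-1) ^+ s i; move=> A B.
  have -> : s1 * (l * u1 ord0 i + (1 - l) * u2 ord0 i - y ord0 i) =
    l * (s1 * (u1 ord0 i - y ord0 i)) + (1 - l) * (s1 * (u2 ord0 i - y ord0 i)) by ring.
  by rewrite addr_gt0// mulr_gt0// subr_gt0.
have [u Du Hu] := K d (fun=> true).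
suff -> : y = u by [].
by apply/rowP => i; have := Hu i; rewrite ltn_ord => ->.
Qed.

Lemma nbhs_cube x e : 0 < e -> nbhs x (cube x e).
Proof.
move=> e0; apply/nbhs_ballP; exists e => //= w [_ H] i.
by have := H ord0 i; rewrite /ball/= distrC.
Qed.

Lemma nbhs_cubeP x (A : set 'rV[R]_d) : nbhs x A -> exists2 e, 0 < e & cube x e `<=` A.
Proof.
move=> /nbhs_ballP[e e0 H]; exists e => // w wx; apply: H; split => // i j.
by rewrite ord1 /ball/= distrC.
Qed.

Lemma cube_vertex y (e : R) (s : 'I_d -> bool) : 0 < e ->
  cube y e (y + \row_i ((-1) ^+ s i * (e / 2))).
Proof.
move=> e0 i; rewrite !mxE addrAC subrr add0r normrM normrX normrN1 expr1n mul1r ger0_norm; lra.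
Qed.

(** Around a point [w] of the half cube, each vertex at distance [e / 4] lies in the closure; a
    point of [D] within [e / 4] of that vertex is still in the same open orthant seen from [w], so
    [cvx_orthants] gives [w]. *)
Lemma cube_closure D y e : 0 < e -> cvx_set D -> cube y e `<=` closure D ->
  cube y (e / 2) `<=` D.
Proof.
move=> e0 cD H w wy; apply: cvx_orthants => // s.
pose p := w + \row_i ((-1) ^+ s i * (e / 2 / 2)).
have e2 : 0 < e / 2 by lra.
have pw : cube w (e / 2) p by exact: cube_vertex.
have py : cube y e p.
  move=> i; have := pw i; have := wy i; rewrite !ltr_norml; lra.
have e4 : 0 < e / 2 / 2 by lra.
have [u [Du up]] := H _ py _ (nbhs_cube p e4).
exists u => // i; have := up i; rewrite /p !mxE.
case: (s i); rewrite ?expr0 ?expr1 ?mul1r ?mulN1r ltr_norml; lra.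
Qed.

Lemma convex_fun_le g u w (a b l : R) : convex_fun g -> (g u <= a%:E)%E ->
  (g w <= b%:E)%E -> 0 < l < 1 ->
  (g (l *: u + (1 - l) *: w)%R <= (l * a + (1 - l) * b)%:E)%E.
Proof.
move=> [gN cg] ga gb /andP[l0 l1]; apply: (le_trans (cg u w l _)); first by rewrite l0.
rewrite [leRHS]EFinD [X in (_ <= X + _)%E]EFinM [X in (_ <= _ + X)%E]EFinM.
by apply: leeD; apply: lee_wpmul2l => //; rewrite lee_fin; lra.
Qed.

Lemma cvx_sublevel g (a : R) : convex_fun g -> cvx_set [set u | (g u <= a%:E)%E].
Proof.
move=> cg u w l /= ga gb l01; have := convex_fun_le cg ga gb l01.
by rewrite (_ : l * a + (1 - l) * a = a)//; ring.
Qed.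

Lemma edom_fin g u : convex_fun g -> edom g u -> (fine (g u))%:E = g u.
Proof.
by move=> [gN _] gu; rewrite fineK// fin_numE gN/= lt_eqF.
Qed.

Lemma cvx_edom g : convex_fun g -> cvx_set (edom g).
Proof.
move=> cg u w l Du Dw l01.
have := convex_fun_le cg _ _ l01 (a := fine (g u)) (b := fine (g w)).
rewrite !edom_fin// => /(_ u w (lexx _) (lexx _)) /le_lt_trans; apply; exact: ltry.
Qed.

(** The sublevel set of [g] at level [M] is convex and contains all vertices at distance [e / 2],
    which surround the half cube. The sum of absolute values over the vertices is a convenient bound
    for their maximum. *)
Lemma cube_bound g y e : 0 < e -> convex_fun g -> cube y e `<=` edom g ->
  exists M : R, forall w, cube y (e / 2) w -> (g w <= M%:E)%E.
Proof.
move=> e0 cg H.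
pose v (s : {ffun 'I_d -> bool}) := y + \row_i ((-1) ^+ s i * (e / 2)).
pose M := \sum_(s : {ffun 'I_d -> bool}) `|fine (g (v s))|.
exists M => w wy; apply: (cvx_orthants (D := [set u | (g u <= M%:E)%E])).
  exact: cvx_sublevel.
move=> s; have vs := cube_vertex y s e0.
have E : y + \row_i ((-1) ^+ s i * (e / 2)) = v (finfun s).
  by congr (_ + _); apply/rowP => i; rewrite !mxE ffunE.
exists (v (finfun s)).
  rewrite /= -E -(edom_fin cg (H _ vs)) lee_fin E /M (bigD1 (finfun s))//=.
  by rewrite (le_trans (ler_norm _))// lerDl sumr_ge0.
move=> i; have := wy i; rewrite !mxE ffunE.
case: (s i); rewrite ?expr0 ?expr1 ?mul1r ?mulN1r ltr_norml; lra.
Qed.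

Definition qvec (q : 'rV[rat]_d) : 'rV[R]_d := map_mx ratr q.

Lemma qvec_dense y e : 0 < e -> exists q, cube y e (qvec q).
Proof.
move=> e0.
have H i : exists q : rat, `|ratr q - y ord0 i| < e.
  have : y ord0 i - e < y ord0 i + e by lra.
  move=> /rat_in_itvoo[q]; rewrite in_itv/= => /andP[? ?]; exists q; rewrite ltr_norml; lra.
have [f Hf] := choice H.
by exists (\row_i f i) => i; rewrite !mxE.
Qed.

(* Moving slightly from [u] towards the centre of the cube raises [g] only slightly. *)
Lemma dom_dense g u y e eta : 0 < e -> 0 < eta -> convex_fun g -> cube y e `<=` edom g ->
  edom g u -> exists q, [/\ cube u eta (qvec q), (g (qvec q) <= g u + eta%:E)%E &
    exists2 r, 0 < r & cube (qvec q) r `<=` edom g].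
Proof.
move=> e0 eta0 cg H gu.
have [M HM] := cube_bound e0 cg H.
pose a := fine (g u); pose S := \sum_i `|y ord0 i - u ord0 i|.
have S0 : 0 <= S by exact: sumr_ge0.
have Si i : `|y ord0 i - u ord0 i| <= S by rewrite /S (bigD1 i)//= lerDl sumr_ge0.
(* [K] dominates both the length of the move from [u] towards [y] and the possible rise of [g]; a
   single weight [l] with [l * K < eta] then controls both errors. *)
pose K := S + e + `|M - a| + 1.
have n0 := normr_ge0 (M - a).
have K0 : 0 < K by rewrite /K; lra.
pose l := eta / (eta + K).
have l0 : 0 < l by rewrite divr_gt0//; lra.
have l1 : l < 1 by rewrite /l ltr_pdivrMr; lra.
have lK : l * K < eta.
  rewrite /l mulrAC ltr_pdivrMr; last by lra.
  by rewrite ltr_pM2l// ltrDr.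
have le0 : 0 < l * (e / 2 / 2) by rewrite mulr_gt0//; lra.
have [q Hq] := qvec_dense ((1 - l) *: u + l *: y) le0.
(* Any [w] close to the shifted centre is a convex combination of [u] and a point of the cube on
   which [g <= M]; this gives a full cube in the domain around [q], and not only the value at
   [q]. *)
have dec (w : 'rV[R]_d) : w = l *: (y + l^-1 *: (w - ((1 - l) *: u + l *: y))) + (1 - l) *: u.
  rewrite scalerDr scalerA divff ?gt_eqF// scale1r.
  by apply/rowP => i; rewrite !mxE; ring.
have cw (w : 'rV[R]_d) : cube ((1 - l) *: u + l *: y) (l * (e / 2)) w ->
    (g w <= (l * M + (1 - l) * a)%:E)%E.
  move=> Hw; rewrite [w in g w]dec; apply: convex_fun_le => //; last by rewrite l0.
    apply: HM => i; have := Hw i; rewrite !mxE addrAC subrr add0r normrM gtr0_norm ?invr_gt0//.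
    by rewrite ltr_pdivrMl.
  by rewrite /a edom_fin.
exists q; split.
- move=> i; have := Hq i; rewrite !mxE => Hi.
  have -> : ratr (q ord0 i) - u ord0 i = (ratr (q ord0 i) - ((1 - l) * u ord0 i + l * y ord0 i)) + l * (y ord0 i - u ord0 i) by ring.
  apply: le_lt_trans (ler_normD _ _) _; rewrite normrM (gtr0_norm l0).
  have := ler_wpM2l (ltW l0) (Si i).
  suff : l * (e / 2 / 2) + l * S <= l * K by move=> ? ?; lra.
  by rewrite -mulrDr ler_pM2l// /K; lra.
- apply: (le_trans (cw _ _)).
    by move=> i; apply: lt_trans (Hq i) _; rewrite ltr_pM2l//; lra.
  rewrite -(edom_fin cg gu) -EFinD lee_fin -/a.
  suff : l * (M - a) <= l * K by move=> ?; lra.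
  by rewrite ler_pM2l// (le_trans (ler_norm _))// /K; lra.
- exists (l * (e / 2 / 2)) => // w Hw; apply: le_lt_trans (ltry (l * M + (1 - l) * a)).
  apply: cw => i; have := Hw i; have := Hq i.
  have -> : l * (e / 2) = l * (e / 2 / 2) + l * (e / 2 / 2) by field.
  rewrite !ltr_norml; lra.
Qed.

End ConvexGeometry.

Lemma cvg_sumr (R : realType) (I : Type) (r : seq I) (f : I -> nat -> R) (l : I -> R) :
  (forall i, f i n @[n --> \oo] --> l i) ->
  \sum_(i <- r) f i n @[n --> \oo] --> \sum_(i <- r) l i.
Proof.
move=> H; elim: r => [|i r IH].
  by rewrite big_nil; under eq_fun do rewrite big_nil; exact: cvg_cst.
by rewrite big_cons; under eq_fun do rewrite big_cons; exact: cvgD.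
Qed.

(** * Projection onto closed convex sets of pairs *)

Section Projection.
Context {R : realType} {d : nat}.
Implicit Types (p c P : 'rV[R]_d * R).

(** Indexing by [option 'I_d] treats a point of $R^d \times R$ as a vector with $d+1$ coordinates,
    the index [None] being the last one. *)
Definition crd p (o : option 'I_d) : R := if o is Some i then p.1 ord0 i else p.2.

Definition sqd p c : R := \sum_o (crd p o - crd c o) ^+ 2.

Definition cvx_pairs (C : set ('rV[R]_d * R)) : Prop :=
  forall p c l, C p -> C c -> 0 < l < 1 ->
  C (l *: p.1 + (1 - l) *: c.1, l * p.2 + (1 - l) * c.2).

Lemma crd_comb p c (l : R) o :
  crd (l *: p.1 + (1 - l) *: c.1, l * p.2 + (1 - l) * c.2) o = l * crd p o + (1 - l) * crd c o.
Proof. by case: o => [i|] //=; rewrite !mxE. Qed.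

Lemma sqd_ge p c o : (crd p o - crd c o) ^+ 2 <= sqd p c.
Proof. by rewrite /sqd (bigD1 o)//= lerDl sumr_ge0// => i _; rewrite sqr_ge0. Qed.

(** The variational inequality characterizing the nearest point of a convex set. It is preferred to
    minimality of the distance because it is linear in [c] and reads directly as a supporting
    hyperplane. *)
Definition is_proj (C : set ('rV[R]_d * R)) p P : Prop :=
  C P /\ forall c, C c -> \sum_o (crd p o - crd P o) * (crd c o - crd P o) <= 0.

(* Near-minimizers of the distance to a convex set form a Cauchy sequence (parallelogram
   identity), so any such sequence converges to the projection. *)
Lemma proj_near_min (C : set ('rV[R]_d * R)) p (m : R) (c_ : nat -> 'rV[R]_d * R) :
  closed C -> cvx_pairs C -> (forall c, C c -> m <= sqd p c) ->
  (forall n, C (c_ n)) -> (forall n, sqd p (c_ n) <= m + n.+1%:R^-1) ->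
  exists2 P, is_proj C p P & forall o, crd (c_ n) o @[n --> \oo] --> crd P o.
Proof.
move=> clC cC mC Cc near.
have par n k : sqd (c_ n) (c_ k) <= 2 * (n.+1%:R^-1 + k.+1%:R^-1).
  have h2 : 0 < (2^-1 : R) < 1 by lra.
  have := mC _ (cC _ _ _ (Cc n) (Cc k) h2).
  set q := (X in sqd p X).
  have E : sqd (c_ n) (c_ k) = 2 * sqd p (c_ n) + 2 * sqd p (c_ k) - 4 * sqd p q.
    rewrite /sqd !mulr_sumr -sumrN -!big_split/=; apply: eq_bigr => o _.
    by rewrite crd_comb; field.
  move: (near n) (near k) E.
  set a := sqd p (c_ n); set b := sqd p (c_ k); set e := sqd p q; set z := n.+1%:R^-1; set y := k.+1%:R^-1.
  by move=> an bk -> me; lra.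
have cau o : cvgn (fun n => crd (c_ n) o).
  apply: cauchy_cvg; apply/cauchy_exP => e e0.
  have e2 : 0 < e ^+ 2 / 4 by rewrite divr_gt0// exprn_gt0.
  have /cvgrPdist_lt/(_ _ e2)[N _ HN] := @cvg_harmonic R.
  exists (crd (c_ N) o); exists N => // n /= Nn.
  rewrite /ball/= -(ltr_pXn2r (n := 2)) ?nnegrE ?normr_ge0 ?(ltW e0)// real_normK ?num_real//.
  apply: le_lt_trans (sqd_ge _ _ o) _; apply: le_lt_trans (par _ _) _.
  have := HN N (leqnn N); have := HN n Nn.
  rewrite /harmonic /= !sub0r !normrN !ger0_norm ?invr_ge0//.
  by move: (N.+1%:R^-1) (n.+1%:R^-1) => a b ? ?; lra.
have HL0 o : exists l : R, crd (c_ n) o @[n --> \oo] --> l by apply/cvg_ex; exact: cau.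
have [L HL] := choice HL0.
pose P : 'rV[R]_d * R := (\row_i L (Some i), L None).
have cP o : crd (c_ n) o @[n --> \oo] --> crd P o.
  suff -> : crd P o = L o by exact: HL.
  by case: o => [i|] //; rewrite /crd mxE.
have CP : C P.
  apply: clC; move=> B [[B1 B2] [/= /nbhs_cubeP[e e0 B1e] B2n]] BB.
  have [e' e'0 B2e] : exists2 e' : R, 0 < e' & forall r, `|r - P.2| < e' -> B2 r.
    move/nbhs_ballP : B2n => [e' e'0 H]; exists e' => // r Hr; apply: H.
    by rewrite /ball/= distrC.
  have ee : 0 < Num.min e e' by rewrite lt_min e0.
  have H o : \forall n \near \oo, `|crd P o - crd (c_ n) o| < Num.min e e'.
    by move/cvgrPdist_lt : (cP o); apply.
  have [n Hn] := filter_ex (filter_forall _ H).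
  exists (c_ n); split; first exact: Cc.
  apply: BB; split => /=.
    by apply: B1e => i; have := Hn (Some i); rewrite /= distrC lt_min => /andP[].
  by apply: B2e; have := Hn None; rewrite /= distrC lt_min => /andP[].
exists P => //; split => // c Cc'.
have mP : sqd p P <= m.
  have : sqd p (c_ n) @[n --> \oo] --> sqd p P.
    apply: cvg_sumr => o; apply: (cvg_comp (fun n => crd p o - crd (c_ n) o) (fun x => x ^+ 2)); last exact: exprn_continuous.
    by apply: cvgB; [exact: cvg_cst|exact: cP].
  move=> H; have h0 : m + @harmonic R n @[n --> \oo] --> m.
    by rewrite -[X in _ --> X]addr0; apply: cvgD; [exact: cvg_cst|exact: cvg_harmonic].
  rewrite -(cvg_lim _ H)// -[leRHS](cvg_lim _ h0)//; apply: ler_lim.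
  - by apply/cvg_ex; eexists; exact: H.
  - by apply/cvg_ex; eexists; exact: h0.
  - exact: nearW.
(* If the inner product [I] were positive, a step of length [l] from [P] towards [c] would change
   the squared distance by [- 2 * l * I + l ^+ 2 * sqd c P], which is negative for this [l] as
   [l * sqd c P < 2 * I], contradicting minimality. *)
set I := (X in X <= 0); rewrite leNgt; apply/negP => I0.
have S0 : 0 <= sqd c P by apply: sumr_ge0 => o _; rewrite sqr_ge0.
pose l := I / (I + sqd c P + 1).
have l0 : 0 < l by rewrite divr_gt0//; lra.
have l1 : l < 1 by rewrite /l ltr_pdivrMr; lra.
have l01 : 0 < l < 1 by rewrite l0.
have := mC _ (cC _ _ _ Cc' CP l01).
set q := (X in sqd p X).
have -> : sqd p q = sqd p P - 2 * l * I + l ^+ 2 * sqd c P.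
  rewrite /sqd /I !mulr_sumr -sumrN -!big_split/=; apply: eq_bigr => o _.
  by rewrite crd_comb; ring.
have : l * (I + sqd c P + 1) = I by rewrite divfK//; lra.
move=> E H.
have : l * (l * sqd c P) < l * (2 * I).
  rewrite ltr_pM2l//.
  have : l * sqd c P <= 1 * sqd c P by rewrite ler_wpM2r// ltW.
  have : 0 < l * I by rewrite mulr_gt0.
  lra.
rewrite expr2 in H; lra.
Qed.

Lemma proj_ex (C : set ('rV[R]_d * R)) p : closed C -> cvx_pairs C -> C !=set0 ->
  exists P, is_proj C p P.
Proof.
move=> clC cC [c0 Cc0].
pose E := [set sqd p c | c in C].
have hE : has_inf E.
  split; first by exists (sqd p c0); exists c0.
  by exists 0 => _ [c _ <-]; apply: sumr_ge0 => o _; rewrite sqr_ge0.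
have H n : exists c, C c /\ sqd p c <= inf E + n.+1%:R^-1.
  have n0 : 0 < n.+1%:R^-1 :> R by rewrite invr_gt0 ltr0n.
  have [_ [c Cc <-] lt] := inf_adherent n0 hE.
  by exists c; split => //; exact: ltW.
have [c_ Hc] := choice H.
have [|n|n|P PP _] := @proj_near_min C p (inf E) c_ clC cC.
- by move=> c Cc; apply: inf_lbound; [exact: hE.2|exists c].
- by case: (Hc n).
- by case: (Hc n).
- by exists P.
Qed.

End Projection.

Lemma big_option (R : realType) (I : finType) (F : option I -> R) :
  \sum_o F o = F None + \sum_i F (Some i).
Proof. by rewrite ![index_enum _]unlock [Finite.enum in LHS]unlock /= big_cons big_map. Qed.

(** * Affine minorants, conjugates and support functions *)

Section Conjugacy.
Context {R : realType} {d : nat}.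
Implicit Types (D : set 'rV[R]_d) (g : 'rV[R]_d -> \bar R) (u w x y z : 'rV[R]_d) (P : 'rV[R]_d * R).

Lemma dotvC u w : dotv u w = dotv w u.
Proof. by apply: eq_bigr => i _; rewrite mulrC. Qed.

Lemma dotvDr u w z : dotv u (w + z) = dotv u w + dotv u z.
Proof. by rewrite /dotv -big_split; apply: eq_bigr => i _; rewrite mxE mulrDr. Qed.

Lemma dotvZr u (a : R) w : dotv u (a *: w) = a * dotv u w.
Proof. by rewrite /dotv mulr_sumr; apply: eq_bigr => i _; rewrite mxE mulrCA. Qed.

Lemma dotvDl u w z : dotv (w + z) u = dotv w u + dotv z u.
Proof. by rewrite ![dotv _ u]dotvC dotvDr. Qed.

Lemma dotvZl u (a : R) w : dotv (a *: w) u = a * dotv w u.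
Proof. by rewrite ![dotv _ u]dotvC dotvZr. Qed.

Lemma dotvNr u w : dotv u (- w) = - dotv u w.
Proof. by rewrite -scaleN1r dotvZr mulN1r. Qed.

Lemma dotvNl u w : dotv (- w) u = - dotv w u.
Proof. by rewrite -scaleN1r dotvZl mulN1r. Qed.

Lemma dotvBr u w z : dotv u (w - z) = dotv u w - dotv u z.
Proof. by rewrite dotvDr dotvNr. Qed.

Lemma dotv_ge0 u : 0 <= dotv u u.
Proof. by apply: sumr_ge0 => i _; rewrite -expr2 sqr_ge0. Qed.

Lemma dotv_eq0 u : dotv u u = 0 -> u = 0.
Proof.
move=> /eqP; rewrite psumr_eq0 => [/allP H|i _]; last by rewrite -expr2 sqr_ge0.
apply/rowP => i; rewrite mxE; have := H i (mem_index_enum i).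
by rewrite mulf_eq0 orbb => /eqP.
Qed.

Lemma dotv_cube u w y eta : cube u eta w -> dotv u y <= dotv w y + eta * \sum_i `|y ord0 i|.
Proof.
move=> H; rewrite mulr_sumr -big_split/=; apply: ler_sum => i _.
rewrite -lerBlDl -mulrBl (le_trans (ler_norm _))// normrM ler_wpM2r// distrC ltW//; exact: H.
Qed.

Definition minorizes g y (b : R) : Prop := forall u, ((dotv y u - b)%:E <= g u)%E.

Lemma cvx_epi g : convex_fun g -> cvx_pairs (epi g).
Proof. by move=> cg p c l; rewrite /epi/= => gp gc l01; exact: convex_fun_le. Qed.

Lemma minorizes_dom g y b : convex_fun g ->
  (forall u, edom g u -> dotv y u - b <= fine (g u)) -> minorizes g y b.
Proof.
move=> cg H u; have [gu|] := boolP (g u < +oo)%E; last by rewrite -leNgt leye_eq => /eqP ->; exact: leey.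
by rewrite -(edom_fin cg gu) lee_fin; exact: H.
Qed.

Section ProjEpi.
Variables (g : 'rV[R]_d -> \bar R) (x : 'rV[R]_d) (r : R) (P : 'rV[R]_d * R).
Hypothesis cg : convex_fun g.
Hypothesis rg : (r%:E < g x)%E.
Hypothesis pP : is_proj (epi g) (x, r) P.
Let n := x - P.1.
Let c := P.2 - r.

(** The vector [(n, - c)] is normal to the epigraph at [P]; separating its horizontal and vertical
    parts prepares the division by [c]. *)
Lemma proj_ineq u (b : R) : (g u <= b%:E)%E -> dotv n (u - P.1) <= c * (b - P.2).
Proof.
move=> gb; have := pP.2 (u, b) gb.
rewrite big_option /= => H.
have : dotv n (u - P.1) = \sum_i (x ord0 i - P.1 ord0 i) * (u ord0 i - P.1 ord0 i).
  by apply: eq_bigr => i _; rewrite !mxE.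
by move=> ->; rewrite /c; lra.
Qed.

(** Epigraphs are unbounded upwards, so raising [P] by 1 gives a test point. *)
Lemma proj_epi_ge : 0 <= c.
Proof.
have : (g P.1 <= (P.2 + 1)%:E)%E by apply: le_trans pP.1 _; rewrite lee_fin lerDl.
by move/proj_ineq; rewrite subrr -(scale0r x) dotvZr mul0r addrAC subrr add0r mulr1.
Qed.

(** With [c = 0] and [n = 0] the projected point [(x, r)] itself would belong to the epigraph,
    against [r < g x]. *)
Lemma proj_epi_flat : c = 0 -> 0 < dotv n n.
Proof.
move=> c0; rewrite lt_def dotv_ge0 andbT; apply/eqP => /dotv_eq0 n0.
have := pP.1; rewrite /epi/= -[P.1](subrK x) -opprB -/n n0 oppr0 add0r.
have -> : P.2 = r by move: c0; rewrite /c; lra.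
by rewrite leNgt rg.
Qed.

(** No vertical hyperplane separates strictly at a point of the domain: testing with the point of
    the graph above [x] would give [dotv n n <= 0]. *)
Lemma proj_epi_gt0 : edom g x -> 0 < c.
Proof.
move=> gx; rewrite lt_def proj_epi_ge andbT; apply/eqP => c0.
have gx' : (g x <= (fine (g x))%:E)%E by rewrite edom_fin.
have := proj_ineq gx'; rewrite -/n c0 mul0r.
by rewrite leNgt proj_epi_flat.
Qed.

(** A non-vertical hyperplane is the graph of an affine function of slope [n / c] through [P]. Its
    value at [x] is [P.2 + dotv n n / c], and [P.2] exceeds [r] since [c > 0]. *)
Lemma proj_minor_pos : 0 < c ->
  minorizes g (c^-1 *: n) (dotv (c^-1 *: n) P.1 - P.2) /\
  r < dotv (c^-1 *: n) x - (dotv (c^-1 *: n) P.1 - P.2).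
Proof.
move=> c0; split.
  apply: minorizes_dom => // u gu.
  have gx' : (g u <= (fine (g u))%:E)%E by rewrite edom_fin.
  have := proj_ineq gx'; rewrite dotvBr !dotvZl => H.
  rewrite opprB addrCA -mulrBr -lerBrDl ler_pdivrMl//; lra.
rewrite opprB addrCA -dotvBr -/n dotvZl.
have : 0 <= c^-1 * dotv n n by rewrite mulr_ge0 ?dotv_ge0// invr_ge0 ltW.
move: c0; rewrite /c; lra.
Qed.

(** A vertical hyperplane gives an affine function which is nonpositive on the domain of [g] and
    equal to [dotv n n > 0] at [x]. Adding a large multiple [l] of it to a known minorant keeps a
    minorant and lifts the value at [x] to at least [r]; the bound on [l] suffices whatever the
    signs of [r] and [dotv y0 x - b0]. *)
Lemma proj_minor_flat y0 (b0 l : R) : c = 0 -> minorizes g y0 b0 ->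
  (`|r| + `|dotv y0 x - b0|) / dotv n n <= l ->
  minorizes g (y0 + l *: n) (b0 + l * dotv n P.1) /\
  r <= dotv (y0 + l *: n) x - (b0 + l * dotv n P.1).
Proof.
move=> c0 m0 lr; have n0 := proj_epi_flat c0.
have lr' : `|r| + `|dotv y0 x - b0| <= l * dotv n n by rewrite -ler_pdivrMr.
have l0 : 0 <= l by apply: le_trans lr; rewrite divr_ge0 ?dotv_ge0// addr_ge0.
split.
  apply: minorizes_dom => // u gu.
  have gx' : (g u <= (fine (g u))%:E)%E by rewrite edom_fin.
  have := proj_ineq gx'; rewrite c0 mul0r dotvBr => H.
  have := m0 u; rewrite -(edom_fin cg gu) lee_fin dotvDl dotvZl => H0.
  have : l * (dotv n u - dotv n P.1) <= 0 by rewrite mulr_ge0_le0.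
  rewrite mulrBr; lra.
have : dotv n n = dotv n x - dotv n P.1 by rewrite -dotvBr.
rewrite dotvDl dotvZl => E; move: lr'; rewrite E mulrBr => lr'.
have := ler_norm r; have := lerNnormlW (lexx `|dotv y0 x - b0|).
lra.
Qed.

End ProjEpi.

Lemma minor_at g x (r : R) : convex_fun g -> closed (epi g) -> edom g x -> (r%:E < g x)%E ->
  exists y b, minorizes g y b /\ r < dotv y x - b.
Proof.
move=> cg cl gx rg.
have [|P pP] := proj_ex (x, r) cl (cvx_epi cg).
  by exists (x, fine (g x)); rewrite /epi/= edom_fin.
have c0 := proj_epi_gt0 cg rg pP gx.
by have [? ?] := proj_minor_pos cg pP c0; eexists; eexists; split; eassumption.
Qed.

Lemma minor_ex g : convex_fun g -> closed (epi g) -> edom g !=set0 -> exists y b, minorizes g y b.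
Proof.
move=> cg cl [x gx].
have : ((fine (g x) - 1)%:E < g x)%E by rewrite -[ltRHS](edom_fin cg gx) lte_fin; lra.
by move/(minor_at cg cl gx) => [y [b [m _]]]; exists y, b.
Qed.

(** Unlike [minor_at], this covers points outside the domain, where the separating hyperplane may be
    vertical and a first minorant has to be tilted. *)
Lemma minor_sup g x (r : R) : convex_fun g -> closed (epi g) -> edom g !=set0 -> (r%:E < g x)%E ->
  exists y b, minorizes g y b /\ r <= dotv y x - b.
Proof.
move=> cg cl [x0 gx0] rg.
have [|P pP] := proj_ex (x, r) cl (cvx_epi cg).
  by exists (x0, fine (g x0)); rewrite /epi/= edom_fin.
have := proj_epi_ge pP; rewrite le_eqVlt => /predU1P[/esym c0|c0].
  have [y0 [b0 m0]] := minor_ex cg cl (ex_intro _ x0 gx0).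
  have [? ?] := proj_minor_flat cg rg pP c0 m0 (lexx _).
  by eexists; eexists; split; eassumption.
by have [? /ltW ?] := proj_minor_pos cg pP c0; eexists; eexists; split; eassumption.
Qed.

Lemma conjv_ge g u y : ((dotv u y)%:E - g u <= conjv g y)%E.
Proof. by apply: ereal_sup_ubound; exists u. Qed.

Lemma conjv_le g y (m : \bar R) : convex_fun g ->
  (forall u, edom g u -> (dotv u y - fine (g u))%:E <= m)%E -> (conjv g y <= m)%E.
Proof.
move=> cg H; apply: ge_ereal_sup => _ [u _ <-].
have [gu|] := boolP (g u < +oo)%E; last by rewrite -leNgt leye_eq => /eqP ->; rewrite /= leNye.
by rewrite -(edom_fin cg gu) -EFinB; exact: H.
Qed.

Lemma conjv_minor g y (b : R) : convex_fun g -> minorizes g y b -> (conjv g y <= b%:E)%E.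
Proof.
move=> cg m; apply: conjv_le => // u gu.
by have := m u; rewrite -(edom_fin cg gu) !lee_fin dotvC; lra.
Qed.

Lemma conjvNy g y : convex_fun g -> edom g !=set0 -> conjv g y != -oo%E.
Proof.
move=> cg [u gu]; rewrite -ltNye; apply: lt_le_trans (conjv_ge g u y).
by rewrite -(edom_fin cg gu) -EFinB ltNyr.
Qed.

Definition support (D : set 'rV[R]_d) w : \bar R := ereal_sup [set (dotv u w)%:E | u in D].

(** For [u] in the domain, [dotv u (ub + l *: w) - g u] is at most
    [conjv g ub + l * support (edom g) w], which bounds the difference quotients from above.
    Conversely, each fixed [u] bounds the quotient at [l] from below by [dotv u w] minus a constant
    over [l], and [l] may be arbitrarily large. *)
Lemma recession_conjv g w : convex_fun g -> closed (epi g) -> edom g !=set0 ->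
  recession (conjv g) w = support (edom g) w.
Proof.
move=> cg cl g0; rewrite /recession.
have [y0 [b0 m0]] := minor_ex cg cl g0.
have dy0 : edom (conjv g) y0.
  by rewrite /edom/= (le_lt_trans (conjv_minor cg m0))// ltry.
(* [ub] is whatever point [xget] selects; the slope [y0] of an affine minorant shows that there is
   one to select, and the argument does not depend on which. *)
have := @xgetI _ 0 (edom (conjv g)) y0 dy0; set ub := xget _ _ => dub.
pose a := fine (conjv g ub).
have aE : conjv g ub = a%:E by rewrite /a fineK// fin_numE conjvNy//= lt_eqF.
apply/eqP; rewrite eq_le; apply/andP; split.
  apply: ge_ereal_sup => _ [l /= l0 <-]; rewrite aE.
  have [sy|] := boolP (support (edom g) w < +oo)%E; last by rewrite -leNgt leye_eq => /eqP ->; exact: leey.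
  have sN : support (edom g) w != -oo%E.
    have [u gu] := g0; rewrite -ltNye; apply: lt_le_trans (_ : (dotv u w)%:E <= _)%E; first by rewrite ltNyr.
    by apply: ereal_sup_ubound; exists u.
  have sE : support (edom g) w = (fine (support (edom g) w))%:E by rewrite fineK// fin_numE sN/= lt_eqF.
  rewrite lee_pdivrMr// leeBlDr// sE -EFinM -EFinD.
  apply: conjv_le => // u gu; rewrite lee_fin dotvDr dotvZr.
  have h1 : dotv u w <= fine (support (edom g) w).
    by rewrite -lee_fin -sE; apply: ereal_sup_ubound; exists u.
  have h2 : dotv u ub - fine (g u) <= a.
    by rewrite -lee_fin -aE; have := conjv_ge g u ub; rewrite -{1}(edom_fin cg gu).
  have := ler_wpM2l (ltW l0) h1; lra.
apply: ge_ereal_sup => _ [u gu <-].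
set r := ereal_sup _.
have H (l : R) : 0 < l -> ((dotv u w - (a - dotv u ub + fine (g u)) / l)%:E <= r)%E.
  move=> l0; apply: le_trans (_ : (conjv g (ub + l *: w)%R - conjv g ub) * (l^-1)%:E <= _)%E; last first.
    by apply: ereal_sup_ubound; exists l.
  rewrite aE lee_pdivlMr// leeBrDr// -EFinM -EFinD.
  apply: le_trans (conjv_ge g u _); rewrite -(edom_fin cg gu) -EFinB lee_fin dotvDr dotvZr.
  by rewrite mulrBl divfK ?gt_eqF//; lra.
apply/lee_addgt0Pr => e e0.
set K := (a - dotv u ub + fine (g u)) in H.
have l0 : 0 < (`|K| + 1) / e by rewrite divr_gt0// ltr_wpDl.
have := H _ l0; rewrite -(leeD2rE (x := e%:E))//.
apply: le_trans; rewrite -EFinD lee_fin.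
rewrite invf_div mulrCA.
have : K / (`|K| + 1) <= 1.
  by rewrite ler_pdivrMr ?ltr_wpDl// mul1r (le_trans (ler_norm _))// lerDl.
rewrite -(ler_pM2l e0); lra.
Qed.

Lemma support_closure D y u (m : R) : closure D u -> (support D y <= m%:E)%E -> dotv u y <= m.
Proof.
move=> Du sm; apply/ler_addgt0Pr => e e0.
pose S := \sum_i `|y ord0 i|; have S0 : 0 <= S by exact: sumr_ge0.
have h : 0 < e / (S + 1) by rewrite divr_gt0// ltr_wpDl.
have [w [Dw uw]] := Du _ (nbhs_cube u h).
have : ((dotv w y)%:E <= m%:E)%E by apply: le_trans sm; apply: ereal_sup_ubound; exists w.
rewrite lee_fin => wm; apply: le_trans (dotv_cube y uw) _; rewrite lerD// -/S.
by rewrite mulrAC ler_pdivrMr ?ltr_wpDl// ler_pM2l// lerDl.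
Qed.

(** Rational points on the boundary of the domain are excluded: no function staying uniformly inside
    the domain can pass through them. *)
Definition qint g (q : 'rV[rat]_d) : Prop := exists2 r : R, 0 < r & cube (qvec q) r `<=` edom g.

(** [dom_dense] replaces a point of the domain by a rational interior one at an arbitrarily small
    cost, both in position and in the value of [g]. *)
Lemma conjv_qint g y x e (m : \bar R) : convex_fun g -> 0 < e -> cube x e `<=` edom g ->
  (forall q, qint g q -> (dotv (qvec q) y - fine (g (qvec q)))%:E <= m)%E -> (conjv g y <= m)%E.
Proof.
move=> cg e0 xe H; apply: conjv_le => // u gu; apply/lee_addgt0Pr => eta eta0.
pose S := \sum_i `|y ord0 i|; have S0 : 0 <= S by exact: sumr_ge0.
have h : 0 < eta / (S + 1) by rewrite divr_gt0// ltr_wpDl.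
have [q [uq gq [r r0 qr]]] := dom_dense e0 h cg xe gu.
have gq' : edom g (qvec q) by apply: qr => i; rewrite subrr normr0.
have := H q (ex_intro2 _ _ r r0 qr); rewrite -(leeD2rE (x := eta%:E))//; apply: le_trans.
rewrite -EFinD lee_fin.
move: gq; rewrite -(edom_fin cg gq') -(edom_fin cg gu) -EFinD lee_fin => gq.
have := dotv_cube y uq; rewrite -/S.
have E : eta / (S + 1) * S + eta / (S + 1) = eta by rewrite -[X in _ + X]mulr1 -mulrDr divfK// gt_eqF// ltr_wpDl.
lra.
Qed.

Lemma support_qint g y x e (m : \bar R) : convex_fun g -> 0 < e -> cube x e `<=` edom g ->
  (forall q, qint g q -> (dotv (qvec q) y)%:E <= m)%E -> (support (edom g) y <= m)%E.
Proof.
move=> cg e0 xe H; apply: ge_ereal_sup => _ [u gu <-]; apply/lee_addgt0Pr => eta eta0.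
pose S := \sum_i `|y ord0 i|; have S0 : 0 <= S by exact: sumr_ge0.
have h : 0 < eta / (S + 1) by rewrite divr_gt0// ltr_wpDl.
have [q [uq gq [r r0 qr]]] := dom_dense e0 h cg xe gu.
have := H q (ex_intro2 _ _ r r0 qr); rewrite -(leeD2rE (x := eta%:E))//; apply: le_trans.
rewrite -EFinD lee_fin; apply: le_trans (dotv_cube y uq) _; rewrite lerD// -/S.
by rewrite mulrAC ler_pdivrMr ?ltr_wpDl// ler_pM2l// lerDl.
Qed.

End Conjugacy.

(** * Functions of bounded variation and their measures *)

(** A measure convertible to [m] that carries the finite measure structure deduced from the proof
    [mfin], as the Radon-Nikodym theorem requires such a structure. *)
Definition finite_copy (R : realType) (m : {measure set R -> \bar R}) (mfin : fin_num_fun m) :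
  set R -> \bar R := m.

Section FiniteCopy.
Context (R : realType) (m : {measure set R -> \bar R}) (mfin : fin_num_fun m).
HB.instance Definition _ := Measure.on (finite_copy mfin).
HB.instance Definition _ := Measure_isFinite.Build _ _ _ (finite_copy mfin) mfin.
End FiniteCopy.

Section Measures.
Context {R : realType}.
Implicit Types (m mu nu : {measure set R -> \bar R}).

Lemma fin_measure m (A : set R) : (m setT < +oo)%E -> measurable A -> m A \is a fin_num.
Proof.
move=> mT mA; rewrite ge0_fin_numE//; apply: le_lt_trans mT.
by apply: le_measure; rewrite ?inE.
Qed.

Lemma measure_ex (f : set R -> \bar R) : f set0 = 0%E -> (forall A, (0 <= f A)%E) ->
  semi_sigma_additive f -> exists m, forall A, m A = f A.
Proof.
move=> f0 fge0 fs; pose H := isMeasure.Build _ _ _ f f0 fge0 fs.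
by pose m : {measure set R -> \bar R} := HB.pack f H; exists m.
Qed.

Lemma density_ex m (f : R -> \bar R) : measurable_fun [set: R] f -> (forall t, (0 <= f t)%E) ->
  exists nu, forall A, nu A = (\int[m]_(t in A) f t)%E.
Proof.
move=> mf f0; apply: measure_ex.
- by rewrite integral_set0.
- by move=> A; exact: integral_ge0.
- exact: semi_sigma_additive_nng_induced.
Qed.

Lemma restr_ex m (D : set R) : measurable D -> exists nu, forall A, nu A = m (A `&` D).
Proof. by move=> mD; exists (mrestr m mD). Qed.

Lemma RN_ex nu mu : (nu setT < +oo)%E -> (mu setT < +oo)%E ->
  (forall A, measurable A -> mu A = 0%E -> nu A = 0%E) ->
  exists f : R -> R, [/\ forall t, 0 <= f t, mu.-integrable setT (EFin \o f) &
    forall A, measurable A -> nu A = (\int[mu]_(t in A) (f t)%:E)%E].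
Proof.
move=> nuT muT dom.
have finnu : fin_num_fun nu by move=> A mA; exact: fin_measure.
have finmu : fin_num_fun mu by move=> A mA; exact: fin_measure.
pose nu' : {finite_measure set R -> \bar R} := finite_copy finnu.
pose mu' : {finite_measure set R -> \bar R} := finite_copy finmu.
have dom' : nu' `<< mu'.
  move=> A nA B mB BA; apply: dom => //; exact: nA.
have [f [f0 ffin fint fE]] := radon_nikodym_sigma_finite dom'.
exists (fine \o f); split.
- by move=> t; rewrite fine_ge0.
- by apply: eq_integrable fint => //= t _; rewrite fineK.
- by move=> A mA; rewrite [LHS]fE//; apply: eq_integral => t _; rewrite /= fineK.
Qed.

Lemma stieltjes_ex (p : R -> R) : {homo p : s t / s <= t} ->
  (forall t, p s @[s --> t^'+] --> p t) ->
  exists m, forall a b, a <= b -> m `]a, b]%classic = (p b - p a)%:E.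
Proof.
move=> nd rc; pose H := isCumulative.Build R _ R p nd rc.
pose p' : cumulative R R := HB.pack p H.
have [m Hm] : exists m, forall A, m A = lebesgue_stieltjes_measure p' A.
  apply: measure_ex.
  - exact: (@measure0 _ _ _ (lebesgue_stieltjes_measure p')).
  - exact: (@measure_ge0 _ _ _ (lebesgue_stieltjes_measure p')).
  - exact: (@measure_semi_sigma_additive _ _ _ (lebesgue_stieltjes_measure p')).
exists m => a b ab; rewrite Hm.
rewrite /lebesgue_stieltjes_measure /measure_extension.
rewrite measurable_mu_extE; last exact: is_ocitv.
exact: (wlength_itv_bnd p').
Qed.

End Measures.

Definition sBV (R : realType) (D : set R) (x : R -> R) : Prop :=
  exists M : R, forall (n : nat) (s : nat -> R),
    (forall k, s k <= s k.+1) -> (forall k, D (s k)) ->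
    \sum_(k < n) `|x (s k.+1) - x (s k)| <= M.

Definition sX (R : realType) (T : R) (x : R -> R) : Prop :=
  [/\ (forall t, x s @[s --> t^'-] --> x t), sBV setT x,
      (forall t, t <= 0 -> x t = x 0) &
      (forall t s, T < t -> T < s -> x t = x s)].

Section Coordinates.
Context {R : realType} {d : nat}.
Implicit Types (u : 'rV[R]_d) (x : R -> 'rV[R]_d).

Lemma coord_le_enorm u i : `|u ord0 i| <= enorm u.
Proof.
rewrite /enorm -sqrtr_sqr ler_wsqrtr// (bigD1 i)//= lerDl sumr_ge0// => j _; exact: sqr_ge0.
Qed.

Lemma enorm_le_sum u : enorm u <= \sum_i `|u ord0 i|.
Proof.
rewrite /enorm -[leRHS]ger0_norm ?sumr_ge0// -sqrtr_sqr ler_wsqrtr//.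
rewrite expr2 mulr_suml; apply: ler_sum => i _.
rewrite -[X in X <= _]real_normK ?num_real// expr2 ler_wpM2l//.
by rewrite (bigD1 i)//= lerDl sumr_ge0.
Qed.

Lemma BV_coord (D : set R) x : BV_on D x <-> forall i, sBV D (fun t => x t ord0 i).
Proof.
split=> [[M HM] i|H].
  exists M => n s s1 s2; apply: le_trans (HM n s s1 s2).
  by apply: ler_sum => k _; have := coord_le_enorm (x (s k.+1) - x (s k)) i; rewrite !mxE.
have [M HM] := choice H.
exists (\sum_i M i) => n s s1 s2.
have : \sum_(i < d) \sum_(k < n) `|x (s k.+1) ord0 i - x (s k) ord0 i| <= \sum_i M i.
  by apply: ler_sum => i _; exact: HM.
apply: le_trans; rewrite exchange_big/=; apply: ler_sum => k _.
apply: le_trans (enorm_le_sum _) _; apply: ler_sum => i _; by rewrite !mxE.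
Qed.

Lemma cvg_coordP (F : set_system R) (FF : Filter F) x u :
  x s @[s --> F] --> u <-> forall i, x s ord0 i @[s --> F] --> u ord0 i.
Proof.
split=> [H i|H].
  by apply: (cvg_comp x (fun w : 'rV[R]_d => w ord0 i) H); exact: coord_continuous.
move=> A /nbhs_cubeP[e e0 HA].
have K i : \forall s \near F, `|x s ord0 i - u ord0 i| < e.
  by move/cvgrPdist_lt : (H i) => /(_ _ e0); apply: filterS => s; rewrite distrC.
by apply: filterS (filter_forall _ K) => s Hs; apply: HA.
Qed.

Lemma inX_coord (T : R) x : inX T x <-> forall i, sX T (fun t => x t ord0 i).
Proof.
split=> [[l [/BV_coord b [x0 xT]]] i|H].
  split=> //.
  - by move=> t; have /cvg_coordP := l t; apply.
  - by move=> t t0; rewrite x0.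
  - by move=> t s Tt Ts; rewrite (xT t s).
split; first by move=> t; apply/cvg_coordP => i; case: (H i).
split; first by apply/BV_coord => i; case: (H i).
by split=> [t t0|t s Tt Ts]; apply/rowP => i; case: (H i) => _ _ h1 h2; [exact: h1|exact: h2].
Qed.

End Coordinates.

Section BoundedVariation.
Context {R : realType}.
Implicit Types (x y : R -> R).

Lemma sBVD (D : set R) x y : sBV D x -> sBV D y -> sBV D (fun t => x t + y t).
Proof.
move=> [M HM] [N HN]; exists (M + N) => n s s1 s2.
apply: le_trans (lerD (HM n s s1 s2) (HN n s s1 s2)); rewrite -big_split/=.
by apply: ler_sum => k _; rewrite opprD addrACA ler_normD.
Qed.

Lemma sBVN (D : set R) x : sBV D x -> sBV D (fun t => - x t).
Proof.
move=> [M HM]; exists M => n s s1 s2; apply: le_trans (HM n s s1 s2).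
by apply: ler_sum => k _; rewrite -opprD normrN.
Qed.

Lemma sBV_bounded_variation x a b : sBV setT x -> bounded_variation a b x.
Proof.
move=> [M HM]; exists M => _ [l [pl /eqP lb] <-].
rewrite /variation big_mkord; apply: (HM (size l) (fun k => nth b (a :: l) k)) => // k.
have [kl|lk] := ltnP k (size l).
  by have /(pathP b)/(_ k kl) := pl; move/ltW.
rewrite [leRHS]nth_default//.
move: lk; rewrite leq_eqVlt => /predU1P[<-|lk]; last by rewrite nth_default.
by rewrite nth_last /= lb.
Qed.

Lemma nondecreasing_sBV x a b : {homo x : s t / s <= t} -> (forall t, a <= x t <= b) ->
  sBV setT x.
Proof.
move=> nd xb; exists (b - a) => n s s1 _.
under eq_bigr do rewrite ger0_norm ?subr_ge0 ?nd//.
rewrite -(big_mkord xpredT (fun k => x (s k.+1) - x (s k))) telescope_sumr//.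
have /andP[_ h1] := xb (s n); have /andP[h2 _] := xb (s 0); lra.
Qed.

Lemma sBV_comp (D : set R) x (f : R -> R) : {homo f : s t / s <= t} -> sBV setT x ->
  sBV D (x \o f).
Proof.
by move=> nd [M HM]; exists M => n s s1 s2; apply: (HM n (f \o s)) => // k; apply: nd.
Qed.

Lemma sBV_bounded x : sBV setT x -> exists C, forall t, `|x t| <= C.
Proof.
move=> [M HM]; exists (M + `|x 0|) => t.
have : `|x t - x 0| <= M.
  have [t0|t0] := leP 0 t.
    have := HM 1 (fun k => if k is 0 then 0 else t); rewrite big_ord1; apply => // -[]//.
  have := HM 1 (fun k => if k is 0 then t else 0); rewrite big_ord1 distrC; apply => // -[|?]//.
  exact: ltW.
have := ler_normD (x t - x 0) (x 0); rewrite subrK; lra.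
Qed.

Definition clamp (a b t : R) : R := Num.max a (Num.min t b).

Lemma clamp_in a b t : a <= b -> clamp a b t \in `[a, b]%R.
Proof.
by move=> ab; rewrite in_itv/= /clamp le_max lexx/= ge_max ab ge_min lexx orbT.
Qed.

Lemma clamp_nd a b : {homo clamp a b : s t / s <= t}.
Proof. by move=> s t st; rewrite /clamp le_max2// le_min2. Qed.

Lemma clamp_id a b t : a <= t -> t <= b -> clamp a b t = t.
Proof. by move=> a_t tb; rewrite /clamp min_l// max_r. Qed.

Lemma clamp_right_continuous (f : R -> R) a b : a < b ->
  (forall t, a <= t -> t < b -> f s @[s --> t^'+] --> f t) ->
  forall t, (f \o clamp a b) s @[s --> t^'+] --> (f \o clamp a b) t.
Proof.
move=> ab rc t; have [ta|at_] := ltP t a.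
  apply: cvg_near_cst; near=> s => /=.
  have sa : s <= a by near: s; exact: nbhs_right_le.
  by rewrite /clamp max_l ?ge_min ?sa// max_l// ge_min (ltW ta).
have [tb|bt] := ltP t b.
  have E : {near t^'+, f =1 f \o clamp a b}.
    near=> s => /=; have sb : s <= b by near: s; exact: nbhs_right_le.
    have ts : t < s by near: s; exact: nbhs_right_gt.
    by rewrite clamp_id// (le_trans at_)// ltW.
  by apply: cvg_trans (near_eq_cvg E) _; rewrite /= clamp_id ?(ltW tb)//; exact: rc.
apply: cvg_near_cst; near=> s => /=.
have ts : t < s by near: s; exact: nbhs_right_gt.
by rewrite /clamp min_r ?(le_trans bt (ltW ts))// min_r.
Unshelve. all: by end_near. Qed.

(** Jordan decomposition of [y] on [[a, b]]. Composing with [clamp] makes both parts monotone and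
    right-continuous on the whole line, as needed to build Stieltjes measures. *)
Lemma jordan_right_continuous y a b : a < b -> sBV setT y ->
  (forall t, y s @[s --> t^'+] --> y t) ->
  exists p q : R -> R, [/\ {homo p : s t / s <= t}, {homo q : s t / s <= t},
    (forall t, p s @[s --> t^'+] --> p t), (forall t, q s @[s --> t^'+] --> q t) &
    (forall t, a <= t -> t <= b -> y t = p t - q t)].
Proof.
move=> ab bv rc; have ab' := ltW ab.
have bvN : bounded_variation a b (\- y) by apply: sBV_bounded_variation; exact: sBVN.
have bvP : bounded_variation a b y by exact: sBV_bounded_variation.
exists (fine \o pos_tv a y \o clamp a b), (fine \o neg_tv a y \o clamp a b); split.
- by move=> s t st; apply: (fine_neg_tv_nondecreasing bvN); [exact: clamp_in..|exact: clamp_nd].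
- by move=> s t st; apply: (fine_neg_tv_nondecreasing bvP); [exact: clamp_in..|exact: clamp_nd].
- apply: clamp_right_continuous => // t at_ tb.
  by apply: (neg_tv_right_continuous at_ tb bvN); apply: cvgN; exact: rc.
- by apply: clamp_right_continuous => // t at_ tb; apply: (neg_tv_right_continuous at_ tb bvP).
- move=> t at_ tb; have := bounded_variation_pos_neg_tvE bvP (clamp_in t ab').
  by rewrite /= clamp_id.
Unshelve. all: by end_near. Qed.

(** A subdivision is reversed by [k] becoming [n - k]; truncated subtraction freezes it beyond [n],
    so that it remains a monotone sequence. *)
Lemma sBV_opp x : sBV setT x -> sBV setT (x \o -%R).
Proof.
move=> [M HM]; exists M => n s s1 _.
have := HM n (fun k => - s (n - k)%N) _ _; rewrite (reindex_inj rev_ord_inj)/=.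
under eq_bigr => k _.
  rewrite (_ : (n - (n - k.+1).+1)%N = k); last by have := ltn_ord k; lia.
  rewrite (_ : (n - (n - k.+1))%N = k.+1); last by have := ltn_ord k; lia.
  rewrite distrC; over.
apply=> // k; rewrite lerN2.
have [kn|nk] := ltnP k n; first by rewrite (_ : (n - k = (n - k.+1).+1)%N)//; lia.
by rewrite (_ : (n - k.+1 = n - k)%N)//; lia.
Qed.

Lemma reflect_ex (m : {measure set R -> \bar R}) : exists nu : {measure set R -> \bar R},
  forall A, nu A = m (-%R @^-1` A).
Proof.
have mN : measurable_fun [set: R] (-%R : R -> R) by exact: oppr_measurable.
apply: (measure_ex (f := pushforward m (-%R : R -> R))).
- by rewrite /pushforward preimage_set0 measure0.
- by move=> A; exact: measure_ge0.
- exact: measure_semi_sigma_additive.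
Qed.

Lemma bigcap_itvNinv (a b : R) : \bigcap_k `]a - k.+1%:R^-1, b]%classic = `[a, b]%classic.
Proof.
apply/seteqP; split => t /=.
  move=> H; have /= := H 0%N I; rewrite !in_itv/= => /andP[_ ->]; rewrite andbT.
  apply/ler_addgt0Pr => e e0.
  have /cvgrPdist_lt/(_ _ e0)[N _ HN] := @cvg_harmonic R.
  have := HN N (leqnn N); rewrite /harmonic/= sub0r normrN ger0_norm ?invr_ge0// => he.
  by have := H N I; rewrite /= in_itv/= => /andP[+ _]; move: he; move: (N.+1%:R^-1) => z; lra.
rewrite in_itv/= => /andP[at_ tb] k _ /=; rewrite in_itv/= tb andbT (lt_le_trans _ at_)//.
by rewrite ltrBlDr ltrDl invr_gt0.
Qed.

Lemma stieltjes_cc (m : {measure set R -> \bar R}) (p : R -> R) (a b : R) : a <= b ->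
  (forall s t, s <= t -> m `]s, t]%classic = (p t - p s)%:E) ->
  (p b - p (a - k.+1%:R^-1))%:E @[k --> \oo] --> m `[a, b]%classic.
Proof.
move=> ab Hm.
have le k : a - k.+1%:R^-1 <= b by rewrite (le_trans _ ab)// gerBl invr_ge0.
rewrite -bigcap_itvNinv.
have -> : (fun k => (p b - p (a - k.+1%:R^-1))%:E) = m \o (fun k => `]a - k.+1%:R^-1, b]%classic).
  by apply/funext => k; rewrite /= Hm.
apply: nonincreasing_cvg_mu => //.
- by rewrite Hm// ltry.
- by rewrite bigcap_itvNinv; exact: measurable_itv.
- move=> n k nk; apply/subsetPset => t /=; rewrite !in_itv/= => /andP[+ ->]; rewrite andbT.
  by apply: le_lt_trans; rewrite lerB// lef_pV2 ?posrE// ler_nat.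
Qed.

(** Stieltjes measures come from right-continuous functions, whereas [x] is left-continuous.
    Reflecting both axes gives a right-continuous [y], whose two Jordan measures are reflected back
    and restricted to [[0, T]]. *)
Lemma sX_measures (T : R) x : 0 < T -> sX T x ->
  exists P N : {measure set R -> \bar R},
    [/\ P (~` I0T T) = 0%E, N (~` I0T T) = 0%E, (P setT < +oo)%E, (N setT < +oo)%E &
    forall t, 0 < t -> (x t - x 0)%:E = (P (Ico0 t) - N (Ico0 t))%E].
Proof.
move=> T0 [lc bv x0 xT].
pose y t := - x (- t).
have ybv : sBV setT y by apply: sBVN; exact: sBV_opp.
have yrc t : y s @[s --> t^'+] --> y t.
  by apply: cvgN; have := lc (- t); move/cvg_at_leftNP; rewrite opprK.
(* The margin on the left of [- T] leaves room to see the jump of [x] just after [T]. *)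
have ab : - T - 1 < 1 by lra.
have [p [q [pnd qnd prc qrc Hy]]] := jordan_right_continuous ab ybv yrc.
have [mp Hmp] := stieltjes_ex pnd prc.
have [mq Hmq] := stieltjes_ex qnd qrc.
have mI : measurable (I0T T) by exact: measurable_itv.
have [mp' Hp'] := reflect_ex mp; have [mq' Hq'] := reflect_ex mq.
have [P HP] := restr_ex mp' mI; have [N HN] := restr_ex mq' mI.
have Nitv (a b : R) : -%R @^-1` `[a, b]%classic = `[- b, - a]%classic :> set R.
  by apply/seteqP; split => t /=; rewrite !in_itv/= lerNr lerNl => /andP[-> ->].
have Nitvo (b : R) : -%R @^-1` `[0, b[%classic = `]- b, 0]%classic :> set R.
  by apply/seteqP; split => t /=; rewrite !in_itv/= ltrNl oppr_ge0 andbC.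
have fin (m : {measure set R -> \bar R}) (f : R -> R) (a : R) : a <= 0 ->
    (forall s t, s <= t -> m `]s, t]%classic = (f t - f s)%:E) -> (m `[a, 0%R]%classic < +oo)%E.
  move=> a0 Hm; apply: le_lt_trans (ltry (f 0 - f (a - 1))); rewrite -Hm; last by lra.
  by apply: le_measure; rewrite ?inE//; move=> t /=; rewrite !in_itv/= => /andP[h ->]; rewrite andbT; lra.
have T0' : - T <= 0 by lra.
exists P, N; split.
- by rewrite HP setICl measure0.
- by rewrite HN setICl measure0.
- by rewrite HP setTI Hp' Nitv oppr0; exact: fin Hmp.
- by rewrite HN setTI Hq' Nitv oppr0; exact: fin Hmq.
move=> t t0; have [tT|Tt] := leP t T.
  rewrite HP HN Hp' Hq'.
  have -> : Ico0 t `&` I0T T = `[0, t[%classic.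
    apply/seteqP; split => [s []//|s /=]; rewrite /Ico0 /I0T/= !in_itv/= => /andP[h1 h2].
    by rewrite h1 h2 (ltW (lt_le_trans h2 tT)).
  rewrite Nitvo Hmp ?Hmq; [|lra|lra].
  rewrite -EFinB; congr EFin.
  have := Hy 0 _ _; have := Hy (- t) _ _; rewrite /y oppr0 opprK.
  by move=> /(_ ltac:(lra) ltac:(lra)) ? /(_ ltac:(lra) ltac:(lra)) ?; lra.
have E (m : {measure set R -> \bar R}) : m (~` I0T T) = 0%E -> m (Ico0 t) = m (I0T T).
  move=> m0; have -> : Ico0 t = (I0T T) `|` `]T, t[%classic.
    apply/seteqP; split => s /=; rewrite /Ico0 /I0T/= !in_itv/=.
      by move=> /andP[-> ->]; rewrite andbT/=; case: leP => ?; [left|right].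
    by move=> [/andP[-> h]|/andP[h ->]]; [exact: le_lt_trans h Tt|rewrite andbT; lra].
  rewrite measureU//; last first.
    by apply/seteqP; split => s //=; rewrite /I0T/= !in_itv/= => -[/andP[_ h1] /andP[h2 _]]; lra.
  rewrite [X in (_ + X)%E](subset_measure0 _ _ _ m0) ?adde0//.
    exact: measurableC.
  by move=> s /=; rewrite /I0T/= !in_itv/= => /andP[h _]; lra.
(* Beyond [T] the mass is that of the closed interval, including the atom at [T] that carries the
   jump from [x T] to the final value; it is obtained as a limit of masses of half-open intervals
   starting at [- T - z]. *)
rewrite !E ?HP ?HN ?setICl ?measure0// setIid Hp' Hq' Nitv oppr0.
have cp := stieltjes_cc T0' Hmp; have cq := stieltjes_cc T0' Hmq.
have fp := fin _ _ _ T0' Hmp; have fq := fin _ _ _ T0' Hmq.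
have fp' : mp `[- T, 0]%classic \is a fin_num by rewrite ge0_fin_numE.
have cpq := cvgeB (fin_num_adde_defr _ fp') cp cq.
rewrite -(cvg_lim _ (cpq _))//; apply/esym/cvg_lim => //; apply: cvg_near_cst; apply: nearW => k.
rewrite -EFinB; congr EFin.
have k1 : 0 < (k.+1%:R^-1 : R) <= 1 by rewrite invr_gt0 ltr0n/= invf_le1// ler1n.
move: k1; move: (k.+1%:R^-1) => z z1.
have := Hy 0 _ _; have := Hy (- T - z) _ _; rewrite /y oppr0.
move=> /(_ ltac:(lra) ltac:(lra)) h1 /(_ ltac:(lra) ltac:(lra)) h2.
have : x (- (- T - z)) = x t by apply: xT; lra.
lra.
Qed.

End BoundedVariation.

Section Representation.
Context {R : realType}.

Lemma msum_ex (d : nat) (m : 'I_d -> {measure set R -> \bar R}) :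
  exists nu : {measure set R -> \bar R}, forall A, nu A = (\sum_i m i A)%E.
Proof.
pose ms (k : nat) : {measure set R -> \bar R} := if insub k is Some j then m j else mzero.
exists (msum ms d) => A; rewrite /msum; apply: eq_bigr => i _.
by rewrite /ms valK.
Qed.

Lemma measure_add_ex (m1 m2 : {measure set R -> \bar R}) :
  exists nu : {measure set R -> \bar R}, forall A, nu A = (m1 A + m2 A)%E.
Proof.
exists (measure_add m1 m2) => A; exact: measure_addE.
Qed.

(** A single measure has to serve all coordinates: the sum of all positive and negative parts
    dominates each of them, and Radon-Nikodym densities give [g]. *)
Lemma DxRep_ex (d : nat) (T : R) (x : R -> 'rV[R]_d) : 0 < T -> inX T x ->
  exists lam g, DxRep T x lam g.
Proof.
move=> T0 /inX_coord xX.
have [P HP] := choice (fun i => sX_measures T0 (xX i)).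
have [N HN] := choice HP.
have mI : measurable (I0T T) by exact: measurable_itv.
have [P' HP'] := msum_ex P; have [N' HN'] := msum_ex N.
have [lam Hlam] := measure_add_ex P' N'.
have PT i : (P i setT < +oo)%E by case: (HN i).
have NT i : (N i setT < +oo)%E by case: (HN i).
have lamT : (lam setT < +oo)%E.
  rewrite Hlam HP' HN'; apply: lte_add_pinfty; apply: lte_sum_pinfty => i _; [exact: PT|exact: NT].
have lamI : lam (~` I0T T) = 0%E.
  by rewrite Hlam HP' HN' !big1 ?adde0// => i _; case: (HN i).
have domP i A : measurable A -> lam A = 0%E -> P i A = 0%E.
  move=> mA; rewrite Hlam HP' HN' => /eqP; rewrite padde_eq0 ?sume_ge0// => /andP[/eqP + _].
  move=> h; apply/eqP; rewrite eq_le measure_ge0 andbT -h (bigD1 i)//=.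
  by rewrite leeDl// sume_ge0.
have domN i A : measurable A -> lam A = 0%E -> N i A = 0%E.
  move=> mA; rewrite Hlam HP' HN' => /eqP; rewrite padde_eq0 ?sume_ge0// => /andP[_ /eqP +].
  move=> h; apply/eqP; rewrite eq_le measure_ge0 andbT -h (bigD1 i)//=.
  by rewrite leeDl// sume_ge0.
have [f Hf] := choice (fun i => RN_ex (PT i) lamT (domP i)).
have [h Hh] := choice (fun i => RN_ex (NT i) lamT (domN i)).
have intfh i : lam.-integrable setT (fun t => (f i t - h i t)%:E).
  have [_ I1 _] := Hf i; have [_ I2 _] := Hh i.
  by apply: eq_integrable (integrableB measurableT I1 I2) => // t _; rewrite /= EFinB.
exists lam, (fun t => \row_i (f i t - h i t)); split => //; split.
  by apply: le_lt_trans lamT; apply: le_measure; rewrite ?inE.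
split=> [i|t i t0].
  apply: (integrableS (measurableT : measurable setT)) => //.
  by apply: eq_integrable (intfh i) => // t _; rewrite mxE.
have [_ I1 E1] := Hf i; have [_ I2 E2] := Hh i.
have [_ _ _ _ E] := HN i; rewrite E// E1 ?E2//; try exact: measurable_itv.
rewrite -integralB_EFin; [|exact: measurable_itv|..].
- by apply: eq_integral => r _; rewrite mxE EFinB.
- by apply: integrableS I1 => //; exact: measurable_itv.
- by apply: integrableS I2 => //; exact: measurable_itv.
Qed.

End Representation.

Section StepSums.
Context {R : realType}.
Implicit Types (m : {measure set R -> \bar R}) (D : set R).

Lemma bounded_on (D : set R) (f : R -> R) (C : R) : (forall t, D t -> `|f t| <= C) ->
  [bounded f x | x in D].
Proof.
move=> H; exists C; split; first exact: num_real.
by move=> M CM t Dt; exact: le_trans (H t Dt) (ltW CM).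
Qed.

Lemma EFin_Rintegral m D (f : R -> R) : measurable D -> m.-integrable D (EFin \o f) ->
  ((\int[m]_(t in D) f t)%R%:E = \int[m]_(t in D) (f t)%:E)%E.
Proof. by move=> mD If; rewrite fineK//; exact: integrable_fin_num. Qed.

(** Dominated convergence for the step functions equal to [c n k] on the cell [I n k], with
    dominating function [C * |b|]. The cells are left abstract because two kinds occur: []s, t]]
    with values of a left-continuous function at left ends, and [[s, t[] with values of a continuous
    function at right ends. *)
Lemma step_sum_cvg m D (b phi : R -> R) (C : R) (I : nat -> nat -> set R)
    (c : nat -> nat -> R) :
  measurable D -> m.-integrable D (EFin \o b) ->
  (forall n k, measurable (I n k)) ->
  (forall n k, (k < n.+1)%N -> I n k `<=` D) ->
  (forall n t, D t -> exists2 k, (k < n.+1)%N & I n k t) ->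
  (forall n j k t, I n j t -> I n k t -> j = k) ->
  (forall n k, `|c n k| <= C) ->
  (forall t e, D t -> 0 < e -> exists N, forall n k, (N <= n)%N -> I n k t ->
     `|c n k - phi t| < e) ->
  [/\ measurable_fun D phi, m.-integrable D (EFin \o (fun t => phi t * b t)) &
      \sum_(k < n.+1) c n k * (\int[m]_(t in I n k) b t)%R @[n --> \oo] -->
        (\int[m]_(t in D) (phi t * b t))%R].
Proof.
move=> mD Ib mI ID cov uniq cC cphi.
have ev (F : R -> R) n t : D t -> exists2 k, I n k t &
    \sum_(k < n.+1) c n k * (F \_ (I n k)) t = c n k * F t.
  move=> Dt; have [k kn It] := cov n t Dt; exists k => //.
  rewrite (bigD1 (Ordinal kn))//= patchE mem_set// big1 ?addr0// => j jk.
  rewrite patchE; case: ifPn; last by rewrite mulr0.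
  by rewrite inE => /(uniq _ _ _ _ It) kj; move/eqP: jk; case; apply: val_inj.
have lim (F : R -> R) t : D t ->
    \sum_(k < n.+1) c n k * (F \_ (I n k)) t @[n --> \oo] --> phi t * F t.
  move=> Dt; apply/cvgrPdist_lt => e e0.
  have h : 0 < e / (`|F t| + 1) by rewrite divr_gt0// ltr_wpDl.
  have [N HN] := cphi t _ Dt h; exists N => // n /= Nn.
  have [k Ik ->] := ev F n t Dt; rewrite -mulrBl normrM distrC.
  apply: le_lt_trans (_ : e / (`|F t| + 1) * `|F t| < e); first by rewrite ler_wpM2r// ltW// HN.
  by rewrite mulrAC ltr_pdivrMr ?ltr_wpDl// ltr_pM2l// ltrDl.
have phiC t : D t -> `|phi t| <= C.
  move=> Dt; apply/ler_addgt0Pr => e e0; have [N HN] := cphi t e Dt e0.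
  have [k _ Ik] := cov N t Dt; have := HN N k (leqnn N) Ik; rewrite distrC => h.
  have := cC N k; have := ler_normD (phi t - c N k) (c N k); rewrite subrK; lra.
have mphi : measurable_fun D phi.
  pose h n (t : R) : R := \sum_(k < n.+1) c n k * ((cst (1 : R)) \_ (I n k)) t.
  apply: (@measurable_fun_cvg _ _ _ D h).
    move=> n; apply: measurable_sum => k; apply: measurable_funM => //.
    by rewrite patch_indic; apply: measurable_funM => //; exact: measurable_indic.
  by move=> t Dt; rewrite -[phi t]mulr1; exact: (lim (cst 1)).
have Iphi : m.-integrable D (EFin \o (fun t => phi t * b t)).
  by apply: eq_integrable (integrableMr mD mphi (bounded_on phiC) Ib).
split => //.
have IbI n k : m.-integrable D (EFin \o (fun t => c n k * (b \_ (I n k)) t)).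
  apply: eq_integrable (integrableMr (h := fun t => c n k * \1_(I n k) t) mD _ _ Ib) => //.
  - by move=> t _; rewrite /= patch_indic/= -EFinM; congr EFin; ring.
  - by apply: measurable_funM => //; exact: measurable_indic.
  - apply: (bounded_on (C := C)) => t _; rewrite normrM indicE.
    by case: (_ \in _); rewrite ?normr1 ?normr0 ?mulr1 ?mulr0// (le_trans _ (cC n k)).
pose F n t := \sum_(k < n.+1) c n k * (b \_ (I n k)) t.
have IF n : m.-integrable D (EFin \o F n).
  have := integrable_sum mD (index_enum 'I_n.+1) (P := xpredT) (fun (k : 'I_n.+1) _ => IbI n k).
  by apply: eq_integrable => // t _; rewrite /F /= sumEFin.
have A1 : {ae m, forall t, D t -> (EFin \o F n) t @[n --> \oo] --> (phi t * b t)%:E}.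
  by apply: aeW => t Dt; apply: cvg_EFin; [exact: nearW|exact: lim].
have A2 : {ae m, forall t n, D t -> (`|(EFin \o F n) t| <= C%:E * `|(b t)%:E|)%E}.
  apply: aeW => t n Dt; rewrite /F /=; have [k Ik ->] := ev b n t Dt.
  by rewrite lee_fin normrM ler_wpM2r.
have [_ _ H] := dominated_convergence mD (fun n => measurable_int _ (IF n))
  (measurable_int _ Iphi) A1 (integrableZl mD C (integrable_abse Ib)) A2.
have -> : (fun n => \sum_(k < n.+1) c n k * (\int[m]_(t in I n k) b t)%R) =
    (fun n => fine (\int[m]_(t in D) (EFin \o F n) t)%E).
  apply/funext => n; apply: EFin_inj; rewrite fineK; last exact: integrable_fin_num (IF n).
  under [RHS]eq_integral do rewrite /= -sumEFin.
  rewrite -[LHS]sumEFin.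
  rewrite (integral_sum mD (fun k : 'I_n.+1 => IbI n k)).
  apply: eq_bigr => k _.
  have Ipb : m.-integrable D (EFin \o (b \_ (I n k))).
    apply: eq_integrable (integrableMr (h := \1_(I n k)) mD _ _ Ib) => //.
    - by move=> t _; rewrite /= patch_indic/= -EFinM; congr EFin; ring.
    - by apply: (bounded_on (C := 1)) => t _; rewrite indicE; case: (_ \in _); rewrite ?normr1 ?normr0.
  have -> : (\int[m]_(t in D) (c n k * (b \_ (I n k)) t)%:E = (c n k)%:E * \int[m]_(t in D) ((b \_ (I n k)) t)%:E)%E.
    by rewrite -integralZl.
  rewrite EFinM EFin_Rintegral//; last by apply: integrableS Ib => //; apply: ID.
  congr (_ * _)%E.
  have -> : I n k = D `&` I n k by apply/esym/setIidPr; apply: ID; exact: ltn_ord.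
  rewrite integral_mkcondr; apply: eq_integral => t tD.
  by rewrite !patchE in_setI tD/=; case: ifP.
apply: fine_cvg.
by rewrite /Rintegral fineK//; exact: integrable_fin_num.
Qed.

Import HBNNSimple.

(* No measurability of [f] is assumed: in [DxRep] the density is only known to be measurable on
   [0,T], while the integral extends over [0,t[ with [t > T]. *)
Lemma integral_null_ext m (A B : set R) (f : R -> \bar R) :
  measurable A -> measurable B -> A `<=` B -> m (B `\` A) = 0%E ->
  (\int[m]_(t in B) f t = \int[m]_(t in A) f t)%E.
Proof.
move=> mA mB AB m0.
suff H (g : R -> \bar R) : (forall t, (0 <= g t)%E) ->
    (\int[m]_(t in B) g t = \int[m]_(t in A) g t)%E.
  by rewrite [LHS]integralE [RHS]integralE !H.
move=> g0; rewrite ge0_integralE// ge0_integralE//; apply/eqP; rewrite eq_le; apply/andP; split.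
  apply: ge_ereal_sup => _ [h /= hB <-].
  have E t : proj_nnsfun h mA t = (h \_ A) t by rewrite -mrestrict.
  apply: ereal_sup_ubound; exists (proj_nnsfun h mA) => /=.
    move=> t; apply: (@le_trans _ _ ((h \_ A) t)%:E); first by rewrite -E.
    rewrite !patchE; case: ifPn => // tA; apply: le_trans (hB t) _.
    by rewrite patchE mem_set//; apply: AB; exact/set_mem.
  rewrite -!integralT_nnsfun; apply: ae_eq_integral => //; try exact/measurable_EFinP.
  exists (B `\` A); split => //; first exact: measurableD.
  move=> t /= /not_implyP[_]; apply: contra_notP => tBA.
  transitivity ((h \_ A) t)%:E; first by congr EFin; rewrite -E.
  rewrite patchE; case: ifPn => // tA.
  have := hB t; rewrite patchE; case: ifPn => [tB|_ h0].
    by exfalso; apply: tBA; split; [exact/set_mem|move/mem_set; exact/negP].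
  by congr EFin; apply/esym/eqP; rewrite eq_le -lee_fin h0/=; exact: fun_ge0.
apply: ge_ereal_sup => _ [h /= hA <-].
apply: ereal_sup_ubound; exists h => //= t; apply: le_trans (hA t) _.
rewrite !patchE; case: ifPn => tA; last by case: ifP.
by rewrite mem_set//; apply: AB; exact/set_mem.
Qed.

End StepSums.

Section Grid.
Context {R : realType} (T : R).
Hypothesis T0 : 0 < T.

Definition grid (n k : nat) : R := T * k%:R / n.+1%:R.

Lemma grid0 n : grid n 0 = 0. Proof. by rewrite /grid mulr0 mul0r. Qed.

Lemma gridT n : grid n n.+1 = T. Proof. by rewrite /grid mulfK// pnatr_eq0. Qed.

Lemma grid_le n j k : (j <= k)%N -> grid n j <= grid n k.
Proof. by move=> jk; rewrite ler_pM2r ?invr_gt0// ler_pM2l// ler_nat. Qed.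

Lemma grid_ge0 n k : 0 <= grid n k.
Proof. by rewrite -(grid0 n) grid_le. Qed.

Lemma grid_leT n k : (k <= n.+1)%N -> grid n k <= T.
Proof. by rewrite -[X in _ <= X](gridT n); exact: grid_le. Qed.

Lemma gridS n k : grid n k.+1 = grid n k + T / n.+1%:R.
Proof. by rewrite /grid -natr1 mulrDr mulr1 mulrDl. Qed.

Lemma grid_oc n t : 0 < t -> t <= T -> exists2 k, (k < n.+1)%N & grid n k < t <= grid n k.+1.
Proof.
move=> t0 tT; have ex : exists k, t <= grid n k.+1 by exists n; rewrite gridT.
case: (ex_minnP ex) => k tk min; exists k; first by rewrite ltnS min// gridT.
rewrite tk andbT ltNge; case: k min {tk} => [_|k min]; first by rewrite grid0 -ltNge.
by apply/negP => /min; rewrite ltnn.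
Qed.

Lemma grid_co n t : 0 <= t -> t < T -> exists2 k, (k < n.+1)%N & grid n k <= t < grid n k.+1.
Proof.
move=> t0 tT; have ex : exists k, t < grid n k.+1 by exists n; rewrite gridT.
case: (ex_minnP ex) => k tk min; exists k; first by rewrite ltnS min// gridT.
rewrite tk andbT leNgt; case: k min {tk} => [_|k min]; first by rewrite grid0 -leNgt.
by apply/negP => /min; rewrite ltnn.
Qed.

Lemma grid_fine (e : R) : 0 < e -> exists N, forall n, (N <= n)%N -> T / n.+1%:R < e.
Proof.
move=> e0; have h : 0 < e / T by rewrite divr_gt0.
have /cvgrPdist_lt/(_ _ h)[N _ HN] := @cvg_harmonic R.
exists N => n Nn; have := HN n Nn; rewrite /harmonic/= sub0r normrN ger0_norm ?invr_ge0//.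
by rewrite ltr_pdivlMr// mulrC.
Qed.

Lemma cvg_left_delta (x : R -> R) t e : x s @[s --> t^'-] --> x t -> 0 < e ->
  exists2 dl : R, 0 < dl & forall s, t - dl < s -> s < t -> `|x s - x t| < e.
Proof.
move=> /cvgrPdist_lt/(_ e)/[apply] -[dl /= dl0 H]; exists dl => // s h1 h2.
by rewrite distrC; apply: H => //=; rewrite ger0_norm; lra.
Qed.

Lemma left_step_cvg (m : {measure set R -> \bar R}) (b x : R -> R) C :
  m.-integrable `]0, T]%classic (EFin \o b) -> (forall t, `|x t| <= C) ->
  (forall t, x s @[s --> t^'-] --> x t) ->
  [/\ measurable_fun `]0, T]%classic x,
      m.-integrable `]0, T]%classic (EFin \o (fun t => x t * b t)) &
      \sum_(k < n.+1) x (grid n k) * (\int[m]_(t in `]grid n k, grid n k.+1]%classic) b t)%R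
        @[n --> \oo] --> (\int[m]_(t in `]0, T]%classic) (x t * b t))%R].
Proof.
move=> Ib xC lc.
apply: (step_sum_cvg (C := C) (I := fun n k => `]grid n k, grid n k.+1]%classic)
  (c := fun n k => x (grid n k))) => //.
- by move=> n k kn t /=; rewrite !in_itv/= => /andP[h1 h2]; rewrite (le_lt_trans (grid_ge0 n k))//= (le_trans h2)// grid_leT.
- by move=> n t /=; rewrite in_itv/= => /andP[h1 h2]; have [k kn kt] := grid_oc n h1 h2; exists k; rewrite //= in_itv.
- move=> n j k t /=; rewrite !in_itv/= => /andP[h1 h2] /andP[h3 h4].
  case: (ltngtP j k) => // jk; exfalso.
    by have := grid_le n jk; have := le_lt_trans _ h3; move=> /(_ _ _) /[apply]; rewrite ltNge h2.
  by have := grid_le n jk; have := le_lt_trans _ h1; move=> /(_ _ _) /[apply]; rewrite ltNge h4.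
- move=> t e; rewrite /= in_itv/= => /andP[t0 tT] e0.
  have [dl dl0 H] := cvg_left_delta (lc t) e0; have [N HN] := grid_fine dl0.
  exists N => n k /HN h; rewrite /= in_itv/= gridS => /andP[h1 h2]; apply: H => //.
  by move: h h1 h2; move: (T / n.+1%:R) (grid n k) => z w ? ? ?; lra.
Qed.

Lemma within_delta (u : R -> R) (D : set R) t e : {within D, continuous u} -> D t -> 0 < e ->
  exists2 dl : R, 0 < dl & forall s, D s -> `|s - t| < dl -> `|u s - u t| < e.
Proof.
move=> /subspace_continuousP/(_ t)/[apply]/cvgrPdist_lt/(_ e)/[apply] -[dl /= dl0 H].
by exists dl => // s Ds st; rewrite distrC; apply: H => //=; rewrite distrC.
Qed.

Lemma within_bounded (u : R -> R) : {within I0T T, continuous u} ->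
  exists C, forall t, I0T T t -> `|u t| <= C.
Proof.
move=> cu; have cNu : {within I0T T, continuous (\- u)} by move=> t; apply: cvgN; exact: cu.
have [c1 _ H1] := EVT_max (ltW T0) cu; have [c2 _ H2] := EVT_max (ltW T0) cNu.
exists (`|u c1| + `|u c2|) => t It; rewrite ler_norml.
have := H1 t It; have := H2 t It; rewrite /=.
have := ler_norm (u c1); have := lerNnormlW (lexx `|u c2|).
have := normr_ge0 (u c1); have := normr_ge0 (u c2); lra.
Qed.

Lemma right_step_cvg (m : {measure set R -> \bar R}) (b u : R -> R) :
  m.-integrable `[0, T[%classic (EFin \o b) -> {within I0T T, continuous u} ->
  m.-integrable `[0, T[%classic (EFin \o (fun t => u t * b t)) /\
  \sum_(k < n.+1) u (grid n k.+1) * (\int[m]_(t in `[grid n k, grid n k.+1[%classic) b t)%R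
    @[n --> \oo] --> (\int[m]_(t in `[0, T[%classic) (u t * b t))%R.
Proof.
move=> Ib cu; have [C HC] := within_bounded cu.
(* For [k > n] the right ends of the cells leave [[0, T]], where [u] is not known to be bounded;
   clamping them makes the coefficients bounded for all indices. *)
have gI n k : I0T T (clamp 0 T (grid n k)) by exact: clamp_in (ltW T0).
pose I n k := `[grid n k, grid n k.+1[%classic; pose c n k := u (clamp 0 T (grid n k.+1)).
have ID n k : (k < n.+1)%N -> I n k `<=` `[0, T[%classic.
  move=> kn t /=; rewrite /I/= !in_itv/= => /andP[h1 h2].
  by rewrite (le_trans (grid_ge0 n k))//= (lt_le_trans h2)// grid_leT.
have cov n t : `[0, T[%classic t -> exists2 k, (k < n.+1)%N & I n k t.
  rewrite /= in_itv/= => /andP[h1 h2]; have [k kn kt] := grid_co n h1 h2.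
  by exists k; rewrite //= /I/= in_itv.
have uniq n j k t : I n j t -> I n k t -> j = k.
  rewrite /I/= !in_itv/= => /andP[h1 h2] /andP[h3 h4].
  case: (ltngtP j k) => // jk; exfalso.
    by have := le_trans (grid_le n jk) h3; rewrite leNgt h2.
  by have := le_trans (grid_le n jk) h1; rewrite leNgt h4.
have cphi t e : `[0, T[%classic t -> 0 < e ->
    exists N, forall n k, (N <= n)%N -> I n k t -> `|c n k - u t| < e.
  rewrite /= in_itv/= => /andP[t0 tT] e0.
  have It : I0T T t by rewrite /I0T/= in_itv/= t0 ltW.
  have [dl dl0 K] := within_delta cu It e0; have [N HN] := grid_fine dl0.
  exists N => n k /HN h; rewrite /I/= in_itv/= => /andP[h1 h2]; apply: K; first exact: gI.
  rewrite gridS in h2 *; rewrite /clamp.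
  have := grid_ge0 n k; move: h h1 h2; move: (T / n.+1%:R) (grid n k) => z w h h1 h2 g0.
  rewrite max_r; last by rewrite le_min (ltW T0) andbT; lra.
  by have [?|?] := leP (w + z) T; rewrite ltr_norml; lra.
have [_ I1 H] := step_sum_cvg (measurable_itv _) Ib (fun n k => measurable_itv _) ID cov uniq
  (fun n k => HC _ (gI n k.+1)) cphi.
split => //; move: H; under eq_fun.
  move=> n; under eq_bigr => k _.
    rewrite clamp_id ?grid_ge0// ?grid_leT ?ltn_ord//; over.
  over.
by [].
Qed.

End Grid.

(** * The pairing *)

Lemma integrable_setU (R : realType) (m : {measure set R -> \bar R}) (A B : set R) (f : R -> \bar R) :
  measurable A -> measurable B -> [disjoint A & B] -> m.-integrable A f -> m.-integrable B f ->
  m.-integrable (A `|` B) f.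
Proof.
move=> mA mB dj /integrableP[fA iA] /integrableP[fB iB].
have fU : measurable_fun (A `|` B) f by exact/measurable_funU.
apply/integrableP; split => //; rewrite ge0_integral_setU//; last exact: measurableT_comp.
by apply: lte_add_pinfty.
Qed.

Section Pairing.
Context {R : realType} (T : R).
Hypothesis T0 : 0 < T.

(** The cells [[s, t[] have [Dx]-mass [x t - x s] and leave out the point [T]; the last term is the
    contribution of the atom of [Dx] there. *)
Definition RSsum (u x : R -> R) (n : nat) : R :=
  \sum_(k < n.+1) u (grid T n k.+1) * (x (grid T n k.+1) - x (grid T n k)) +
  u T * (x (T + 1) - x T).

Lemma I0T_split : I0T T = `[0, T[%classic `|` [set T].
Proof.
apply/seteqP; split => t; rewrite /I0T/= !in_itv/=.
  by move=> /andP[t0]; rewrite le_eqVlt => /predU1P[->|tT]; [right|left; rewrite t0].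
by move=> [/andP[-> /ltW]//|->]; rewrite lexx (ltW T0).
Qed.

Lemma RSsum_cvg (lam : {measure set R -> \bar R}) (g x u : R -> R) :
  lam (~` I0T T) = 0%E -> lam.-integrable (I0T T) (EFin \o g) ->
  (forall t, 0 < t -> (x t - x 0)%:E = (\int[lam]_(r in Ico0 t) (g r)%:E)%E) ->
  {within I0T T, continuous u} ->
  lam.-integrable (I0T T) (EFin \o (fun t => u t * g t)) /\
  RSsum u x n @[n --> \oo] --> (\int[lam]_(t in I0T T) (u t * g t))%R.
Proof.
move=> lam0 Ig xg cu.
have mI : measurable (I0T T) by exact: measurable_itv.
have mc : measurable `[0, T[%classic by exact: measurable_itv.
have mT : measurable [set T] by exact: measurable_set1.
have cI : `[0, T[%classic `<=` I0T T by rewrite I0T_split; exact: subsetUl.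
have TI : [set T] `<=` I0T T by rewrite I0T_split; exact: subsetUr.
have djT : [disjoint `[0, T[%classic & [set T]].
  by apply/disj_setPS => t /=; rewrite in_itv/= => -[/andP[_ h] tT]; rewrite tT ltxx in h.
have Ic : lam.-integrable `[0, T[%classic (EFin \o g) by exact: integrableS Ig.
have [Iu H] := right_step_cvg T0 Ic cu.
have mg1 : lam.-integrable [set T] (EFin \o g) by exact: integrableS Ig.
have Iu1 : lam.-integrable [set T] (EFin \o (fun t => u t * g t)).
  by apply: eq_integrable (integrableZl mT (u T) mg1) => // t; rewrite inE /= => ->.
have IuI : lam.-integrable (I0T T) (EFin \o (fun t => u t * g t)).
  by rewrite I0T_split; apply: integrable_setU.
have xR t : 0 < t -> t <= T -> x t - x 0 = (\int[lam]_(r in `[0, t[) g r)%R.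
  by move=> t0 tT; rewrite /Rintegral -xg.
have xT : x (T + 1) - x 0 = (\int[lam]_(r in I0T T) g r)%R.
  rewrite /Rintegral -(@integral_null_ext _ lam (I0T T) (Ico0 (T + 1))) -?xg//; first by rewrite addr_gt0.
  - exact: measurable_itv.
  - by move=> t; rewrite /I0T/Ico0/= !in_itv/= => /andP[-> h]; rewrite (le_lt_trans h)// ltrDl.
  - apply: (subset_measure0 _ _ _ lam0); first by apply: measurableD => //; exact: measurable_itv.
      exact: measurableC.
    by move=> t [].
have gT : (\int[lam]_(r in [set T]) g r)%R = x (T + 1) - x T.
  have : x (T + 1) - x 0 = (\int[lam]_(r in `[0, T[) g r)%R + (\int[lam]_(r in [set T]) g r)%R.
    by rewrite xT [in LHS]I0T_split Rintegral_setU// -I0T_split.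
  rewrite -xR//; lra.
have incr n k : (k < n.+1)%N ->
    (\int[lam]_(t in `[grid T n k, grid T n k.+1[) g t)%R = x (grid T n k.+1) - x (grid T n k).
  move=> kn; have k1 : 0 < grid T n k.+1 by rewrite gridS ltr_wpDl ?grid_ge0// divr_gt0.
  have kT : grid T n k.+1 <= T by exact: grid_leT.
  have [k0|k0] := eqVneq k 0%N.
    by rewrite k0 grid0 -k0 -xR// grid0.
  have gk0 : 0 < grid T n k by rewrite /grid divr_gt0// mulr_gt0// ltr0n lt0n.
  have E : `[0, grid T n k.+1[%classic = `[0, grid T n k[%classic `|` `[grid T n k, grid T n k.+1[%classic.
    apply/seteqP; split => t /=; rewrite !in_itv/=.
      by move=> /andP[-> ->]; rewrite andbT /=; have [?|?] := ltP t (grid T n k); [left|right].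
    move=> [/andP[-> h]|/andP[h ->]]; last by rewrite (le_trans (ltW gk0) h).
    by rewrite (lt_le_trans h)// grid_le.
  have := xR _ k1 kT; rewrite E Rintegral_setU//.
  - by rewrite -xR//; [lra|exact: grid_leT (ltnW kn)].
  - by rewrite -E; apply: integrableS Ig => // t; rewrite /I0T/= !in_itv/= => /andP[-> h]; rewrite (le_trans (ltW h)).
  - by apply/disj_setPS => t /=; rewrite !in_itv/= => -[/andP[_ h1] /andP[h2 _]]; have := le_lt_trans h2 h1; rewrite ltxx.
split => //; rewrite [X in _ --> X](_ : _ = (\int[lam]_(t in `[0, T[) (u t * g t))%R + u T * (x (T + 1) - x T)); last first.
  rewrite [in LHS]I0T_split Rintegral_setU// -?I0T_split//; congr (_ + _).
  rewrite -gT -RintegralZl//; apply: eq_Rintegral => t; by rewrite inE /= => ->.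
apply: cvgD; last exact: cvg_cst.
move: H; under eq_fun do under eq_bigr => k _ do rewrite incr ?ltn_ord//.
by [].
Qed.

(** Summation by parts: the products [u * x] at the nodes telescope, and the jump term turns
    [u T * x T] into [u T * x (T + 1)]. Now [x] is sampled at left ends, as its left continuity
    requires. *)
Lemma RSsum_abel (u x : R -> R) n :
  RSsum u x n = u T * x (T + 1) - u 0 * x 0 -
    \sum_(k < n.+1) x (grid T n k) * (u (grid T n k.+1) - u (grid T n k)).
Proof.
have : \sum_(k < n.+1) u (grid T n k.+1) * (x (grid T n k.+1) - x (grid T n k)) +
    \sum_(k < n.+1) x (grid T n k) * (u (grid T n k.+1) - u (grid T n k)) = u T * x T - u 0 * x 0.
  rewrite -big_split/= (eq_bigr (fun k : 'I_n.+1 => u (grid T n k.+1) * x (grid T n k.+1) -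
    u (grid T n k) * x (grid T n k))) => [|k _]; last by ring.
  rewrite -(big_mkord xpredT (fun k => u (grid T n k.+1) * x (grid T n k.+1) - u (grid T n k) * x (grid T n k))).
  by rewrite (telescope_sumr (fun k => u (grid T n k) * x (grid T n k)))// gridT// grid0.
rewrite /RSsum; lra.
Qed.

Lemma RSsumB (u x y : R -> R) n : RSsum u (fun t => x t - y t) n = RSsum u x n - RSsum u y n.
Proof.
have E : \sum_(k < n.+1) u (grid T n k.+1) *
      (x (grid T n k.+1) - y (grid T n k.+1) - (x (grid T n k) - y (grid T n k))) =
    \sum_(k < n.+1) u (grid T n k.+1) * (x (grid T n k.+1) - x (grid T n k)) -
    \sum_(k < n.+1) u (grid T n k.+1) * (y (grid T n k.+1) - y (grid T n k)).
  by rewrite -sumrB; apply: eq_bigr => k _; ring.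
by rewrite /RSsum E; ring.
Qed.

Variable d : nat.
Implicit Types (v : Vtype R d) (x y : R -> 'rV[R]_d).

Lemma inV_coord v i : inV T v -> {within I0T T, continuous (fun t => v.2 t ord0 i)}.
Proof.
move=> /subspace_continuousP cv; apply/subspace_continuousP => t It.
by have /cvg_coordP := cv t It; apply.
Qed.

Definition RSvec v x n : R :=
  dotv v.1 (x 0) + \sum_i RSsum (fun t => v.2 t ord0 i) (fun t => x t ord0 i) n.

(* The pairing is a limit of Riemann-Stieltjes sums, whichever representation of [Dx] is used. *)
Lemma pairing_cvg v x : inV T v -> inX T x -> RSvec v x n @[n --> \oo] --> pairing T v x.
Proof.
move=> Vv Xx.
pose val (lam : {measure set R -> \bar R}) (g : R -> 'rV[R]_d) : R :=
  dotv v.1 (x 0) + \sum_i (\int[lam]_(t in I0T T) (v.2 t ord0 i * g t ord0 i))%R.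
have rep lam g : DxRep T x lam g ->
    [/\ forall i, lam.-integrable (I0T T) (EFin \o (fun t => v.2 t ord0 i * g t ord0 i)) &
        RSvec v x n @[n --> \oo] --> val lam g].
  move=> [l0 [l1 [Ig xg]]].
  have H i := RSsum_cvg l0 (Ig i) (fun t t0 => xg t i t0) (inV_coord (i := i) Vv).
  split; first by move=> i; case: (H i).
  by apply: cvgD; [exact: cvg_cst|apply: cvg_sumr => i; case: (H i)].
have valE lam g (r : R) : DxRep T x lam g -> (r%:E = (dotv v.1 (x 0))%:E +
    \sum_(i < d) \int[lam]_(t in (I0T T)) (v.2 t ord0 i * g t ord0 i)%R%:E)%E -> r = val lam g.
  move=> /rep[I1 _] E; apply: EFin_inj; rewrite E /val EFinD; congr (_ + _)%E.
  by rewrite -sumEFin; apply: eq_bigr => i _; rewrite EFin_Rintegral//; exact: measurable_itv.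
have [lam [g Hlg]] := DxRep_ex T0 Xx.
have ex : [set r : R | exists (lam : {measure set R -> \bar R}) (g : R -> 'rV[R]_d),
    DxRep T x lam g /\ (r%:E = (dotv v.1 (x 0))%:E +
    \sum_(i < d) \int[lam]_(t in (I0T T)) (v.2 t ord0 i * g t ord0 i)%R%:E)%E] (val lam g).
  exists lam, g; split => //; rewrite /val EFinD; congr (_ + _)%E.
  by rewrite -sumEFin; apply: eq_bigr => i _; rewrite EFin_Rintegral//; [exact: measurable_itv|case: (rep _ _ Hlg)].
have := @xgetI _ 0 _ _ ex; rewrite -/(pairing T v x) => -[lam' [g' [H' E']]].
by rewrite (valE _ _ _ H' E'); case: (rep _ _ H').
Qed.

Lemma pairing_eq v x (r : R) : inV T v -> inX T x -> RSvec v x n @[n --> \oo] --> r ->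
  pairing T v x = r.
Proof. by move=> Vv Xx H; rewrite -(cvg_lim _ (pairing_cvg Vv Xx))//; exact: cvg_lim. Qed.

Lemma pairingB v x y : inV T v -> inX T x -> inX T y -> inX T (fun t => x t - y t) ->
  pairing T v (fun t => x t - y t) = pairing T v x - pairing T v y.
Proof.
move=> Vv Xx Xy Xxy; apply: pairing_eq => //.
have -> : RSvec v (fun t => x t - y t) = fun n => RSvec v x n - RSvec v y n.
  apply/funext => n; rewrite /RSvec dotvBr.
  have -> : \sum_i RSsum (fun t => v.2 t ord0 i) (fun t => (x t - y t) ord0 i) n =
      \sum_i RSsum (fun t => v.2 t ord0 i) (fun t => x t ord0 i) n -
      \sum_i RSsum (fun t => v.2 t ord0 i) (fun t => y t ord0 i) n.
    by rewrite -sumrB; apply: eq_bigr => i _; rewrite -RSsumB; congr RSsum; apply/funext => t; rewrite !mxE.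
  by ring.
by apply: cvgB; exact: pairing_cvg.
Qed.

Lemma I0T_split0 : I0T T = [set 0] `|` `]0, T]%classic.
Proof.
apply/seteqP; split => t; rewrite /I0T/= !in_itv/=.
  by move=> /andP[]; rewrite le_eqVlt => /predU1P[<-|t0 tT]; [left|right; rewrite t0].
by move=> [->|/andP[/ltW -> //]]; rewrite lexx (ltW T0).
Qed.

Lemma sX_measurable (x : R -> R) : sX T x -> measurable_fun (I0T T) x.
Proof.
move=> [lc bv _ _]; have [C xC] := sBV_bounded bv.
(* With the zero measure integrability is free and only the measurability conclusion of
   [left_step_cvg] remains. *)
have I0 : (mzero : {measure set R -> \bar R}).-integrable `]0, T]%classic (EFin \o (cst (0 : R))).
  exact: integrable0.
have [mx _ _] := left_step_cvg T0 I0 xC lc.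
rewrite I0T_split0; apply/measurable_funU => //; split => //.
exact: measurable_fun_set1.
Qed.

Lemma sX_integrableM (m : {measure set R -> \bar R}) (b x : R -> R) :
  m.-integrable (I0T T) (EFin \o b) -> sX T x ->
  m.-integrable (I0T T) (EFin \o (fun t => x t * b t)).
Proof.
move=> Ib Xx; have mx := sX_measurable Xx; case: Xx => _ /sBV_bounded[C xC] _ _.
by apply: eq_integrable (integrableMr _ mx (bounded_on (fun t _ => xC t)) Ib) => //; exact: measurable_itv.
Qed.

(** The cells []s, t]] cover [[0, T]] up to the point 0, which is negligible for [m]. *)
Lemma parts_sum_cvg (m : {measure set R -> \bar R}) (b x : R -> R) :
  m.-integrable (I0T T) (EFin \o b) -> m [set 0] = 0%E -> sX T x ->
  \sum_(k < n.+1) x (grid T n k) * ((\int[m]_(t in Icc0 (grid T n k.+1)) b t)%R -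
    (\int[m]_(t in Icc0 (grid T n k)) b t)%R) @[n --> \oo] -->
  (\int[m]_(t in I0T T) (x t * b t))%R.
Proof.
move=> Ib m0 Xx; have Ixb := sX_integrableM Ib Xx.
case: Xx => lc /sBV_bounded[C xC] _ _.
have sub : `]0, T]%classic `<=` I0T T by rewrite I0T_split0; exact: subsetUr.
have mI : measurable (I0T T) by exact: measurable_itv.
have mo : measurable `]0, T]%classic by exact: measurable_itv.
have Ib1 : m.-integrable `]0, T]%classic (EFin \o b) by exact: integrableS Ib.
have [_ _ H] := left_step_cvg T0 Ib1 xC lc.
have -> : (\int[m]_(t in I0T T) (x t * b t))%R = (\int[m]_(t in `]0, T]%classic) (x t * b t))%R.
  rewrite /Rintegral (@integral_null_ext _ m `]0, T]%classic (I0T T))//.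
  apply: (subset_measure0 _ _ _ m0) => //; first exact: measurableD.
  by rewrite I0T_split0 => t [[|]].
move: H; under eq_fun.
  move=> n; under eq_bigr => k _.
    have -> : (\int[m]_(t in `]grid T n k, grid T n k.+1]%classic) b t)%R =
      (\int[m]_(t in Icc0 (grid T n k.+1)) b t)%R - (\int[m]_(t in Icc0 (grid T n k)) b t)%R.
      have gk : grid T n k <= grid T n k.+1 by exact: grid_le.
      have E : Icc0 (grid T n k.+1) = Icc0 (grid T n k) `|` `]grid T n k, grid T n k.+1]%classic.
        apply/seteqP; split => t; rewrite /Icc0/= !in_itv/=.
          by move=> /andP[-> ->]; rewrite andbT/=; have [?|?] := leP t (grid T n k); [left|right].
        move=> [/andP[-> h]|/andP[h ->]]; first exact: le_trans gk.
        by rewrite (le_trans (grid_ge0 T0 n k) (ltW h)).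
      rewrite E Rintegral_setU.
      - by ring.
      - exact: measurable_itv.
      - exact: measurable_itv.
      - rewrite -E; apply: integrableS Ib => //; first exact: measurable_itv.
        move=> t; rewrite /Icc0 /I0T/= !in_itv/= => /andP[-> h]; apply: le_trans h _.
        by apply: grid_leT => //; exact: ltn_ord.
      - apply/disj_setPS => t; rewrite /Icc0/= !in_itv/= => -[/andP[_ h1] /andP[h2 _]].
        by have := lt_le_trans h2 h1; rewrite ltxx.
    over.
  over.
by [].
Qed.

Lemma integrable_dotv (m : {measure set R -> \bar R}) (D : set R) (x a : R -> 'rV[R]_d) :
  measurable D -> (forall i, m.-integrable D (EFin \o (fun t => x t ord0 i * a t ord0 i))) ->
  m.-integrable D (EFin \o (fun t => dotv (x t) (a t))) /\
  (\int[m]_(t in D) dotv (x t) (a t))%R = \sum_i (\int[m]_(t in D) (x t ord0 i * a t ord0 i))%R.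
Proof.
move=> mD I.
have H := integrable_sum mD (index_enum 'I_d) (P := xpredT) (fun i _ => I i).
have Id : m.-integrable D (EFin \o (fun t => dotv (x t) (a t))).
  by apply: eq_integrable H => // t _; rewrite /= sumEFin.
split => //; apply: EFin_inj; rewrite EFin_Rintegral// -sumEFin.
transitivity (\int[m]_(t in D) (\sum_i (EFin \o (fun t => x t ord0 i * a t ord0 i)) t)%R)%E.
  by apply: eq_integral => t _; rewrite /= sumEFin.
by rewrite integral_sum//; apply: eq_bigr => i _; rewrite EFin_Rintegral.
Qed.

Lemma inX_dotv (m : {measure set R -> \bar R}) x (a : R -> 'rV[R]_d) : inX T x ->
  (forall i, m.-integrable (I0T T) (EFin \o (fun t => a t ord0 i))) ->
  m.-integrable (I0T T) (EFin \o (fun t => dotv (x t) (a t))).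
Proof.
move=> /inX_coord Xx I.
have I' i := sX_integrableM (I i) (Xx i).
by case: (integrable_dotv (measurable_itv _) I').
Qed.

(** After summation by parts, the increments of [v] over the cells split into integrals against [mu]
    and [sig], so both sums converge separately; the boundary term at 0 merges with
    [dotv v.1 (x 0)]. *)
Lemma pairing_parts (mu sig : {measure set R -> \bar R}) v x (a s : R -> 'rV[R]_d) :
  inV T v -> inX T x -> mu [set 0] = 0%E -> sig [set 0] = 0%E ->
  (forall i, mu.-integrable (I0T T) (EFin \o (fun t => a t ord0 i))) ->
  (forall i, sig.-integrable (I0T T) (EFin \o (fun t => s t ord0 i))) ->
  (forall t (i : 'I_d), I0T T t -> ((v.2 t ord0 i - v.2 0 ord0 i)%:E =
    \int[mu]_(r in Icc0 t) (a r ord0 i)%:E + \int[sig]_(r in Icc0 t) (s r ord0 i)%:E)%E) ->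
  pairing T v x = dotv (v.1 - v.2 0) (x 0) + dotv (v.2 T) (x (T + 1)) -
    (\int[mu]_(t in I0T T) dotv (x t) (a t))%R - (\int[sig]_(t in I0T T) dotv (x t) (s t))%R.
Proof.
move=> Vv Xx m0 s0 Ia Is Hv.
have /inX_coord xX := Xx.
have mI : measurable (I0T T) by exact: measurable_itv.
have Ia' i := sX_integrableM (Ia i) (xX i).
have Is' i := sX_integrableM (Is i) (xX i).
have [_ ->] := integrable_dotv mI Ia'; have [_ ->] := integrable_dotv mI Is'.
have vE t i : I0T T t -> v.2 t ord0 i - v.2 0 ord0 i =
    (\int[mu]_(r in Icc0 t) (a r ord0 i))%R + (\int[sig]_(r in Icc0 t) (s r ord0 i))%R.
  move=> It; apply: EFin_inj; rewrite Hv// EFinD.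
  have sub : Icc0 t `<=` I0T T.
    move: It; rewrite /Icc0 /I0T/= !in_itv/= => /andP[_ tT] r /=.
    by rewrite !in_itv/= => /andP[-> /le_trans]; apply.
  have mt : measurable (Icc0 t) by exact: measurable_itv.
  by rewrite !EFin_Rintegral//; apply: integrableS sub _.
apply: pairing_eq => //.
have E n i : RSsum (fun t => v.2 t ord0 i) (fun t => x t ord0 i) n =
    v.2 T ord0 i * x (T + 1) ord0 i - v.2 0 ord0 i * x 0 ord0 i -
    (\sum_(k < n.+1) x (grid T n k) ord0 i * ((\int[mu]_(r in Icc0 (grid T n k.+1)) (a r ord0 i))%R -
       (\int[mu]_(r in Icc0 (grid T n k)) (a r ord0 i))%R)) -
    (\sum_(k < n.+1) x (grid T n k) ord0 i * ((\int[sig]_(r in Icc0 (grid T n k.+1)) (s r ord0 i))%R -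
       (\int[sig]_(r in Icc0 (grid T n k)) (s r ord0 i))%R)).
  rewrite RSsum_abel// -[RHS]addrA -opprD -big_split/=; congr (_ - _).
  apply: eq_bigr => k _; rewrite -mulrDr; congr (_ * _).
  have gI j : (j <= n.+1)%N -> I0T T (grid T n j).
    by move=> jn; rewrite /I0T/= in_itv/= grid_ge0//= grid_leT.
  have := vE _ i (gI k.+1 (ltn_ord k)); have := vE _ i (gI k (ltnW (ltn_ord k))).
  by lra.
rewrite /RSvec.
have -> : (fun n => dotv v.1 (x 0) + \sum_i RSsum (fun t => v.2 t ord0 i) (fun t => x t ord0 i) n) =
  (fun n => dotv (v.1 - v.2 0) (x 0) + dotv (v.2 T) (x (T + 1)) -
    \sum_i (\sum_(k < n.+1) x (grid T n k) ord0 i * ((\int[mu]_(r in Icc0 (grid T n k.+1)) (a r ord0 i))%R -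
       (\int[mu]_(r in Icc0 (grid T n k)) (a r ord0 i))%R)) -
    \sum_i (\sum_(k < n.+1) x (grid T n k) ord0 i * ((\int[sig]_(r in Icc0 (grid T n k.+1)) (s r ord0 i))%R -
       (\int[sig]_(r in Icc0 (grid T n k)) (s r ord0 i))%R))).
  apply/funext => n; under eq_bigr do rewrite E.
  rewrite !sumrB dotvDl dotvNl /dotv; ring.
apply: cvgB; first apply: cvgB; first exact: cvg_cst.
- by apply: cvg_sumr => i; exact: parts_sum_cvg.
- by apply: cvg_sumr => i; exact: parts_sum_cvg.
Qed.

End Pairing.

(** * Stability of X: stopping, steps, gluing and change of the ends *)

Section Closure.
Context {R : realType} (T : R).
Hypothesis T0 : 0 < T.
Implicit Types (x y : R -> R) (p s : R).

Lemma sXD x y : sX T x -> sX T y -> sX T (fun t => x t + y t).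
Proof.
move=> [lx bx x0 xT] [ly by_ y0 yT]; split.
- by move=> t; apply: cvgD.
- exact: sBVD.
- by move=> t t0; rewrite x0// y0.
- by move=> t s h1 h2; rewrite (xT t s)// (yT t s).
Qed.

Lemma sXN x : sX T x -> sX T (fun t => - x t).
Proof.
move=> [lx bx x0 xT]; split.
- by move=> t; apply: cvgN.
- exact: sBVN.
- by move=> t t0; rewrite x0.
- by move=> t s h1 h2; rewrite (xT t s).
Qed.

Lemma sX_cst (c : R) : sX T (cst c).
Proof.
split=> //; first by move=> t; exact: cvg_cst.
by exists 0 => n s _ _; rewrite big1// => k _; rewrite subrr normr0.
Qed.

Lemma sX_stop x p : 0 <= p -> p <= T -> sX T x -> sX T (fun t => x (Num.min t p)).
Proof.
move=> p0 pT [lx bx x0 xT]; split.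
- move=> t; have [tp|pt] := leP t p.
    have E : {near t^'-, x =1 (fun s => x (Num.min s p))}.
      near=> s; have st : s < t by near: s; exact: nbhs_left_lt.
      by rewrite min_l// (le_trans (ltW st)).
    by apply: cvg_trans (near_eq_cvg E) _; exact: lx.
  apply: cvg_near_cst; near=> s.
  by rewrite min_r//; near: s; exact: nbhs_left_ge.
- by apply: (@sBV_comp R setT x (fun t => Num.min t p)) => // s t st; rewrite le_min2.
- by move=> t t0; rewrite !min_l ?(le_trans t0)// x0.
- by move=> t s h1 h2; rewrite !min_r// (le_trans pT)// ltW.
Unshelve. all: by end_near. Qed.

Lemma sX_step p (c : R) : 0 <= p -> p <= T -> sX T (fun t => c * (p < t)%R%:R).
Proof.
move=> p0 pT; split.
- move=> t; have [tp|pt] := leP t p.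
    apply: cvg_near_cst; near=> s; have st : s < t by near: s; exact: nbhs_left_lt.
    by rewrite ltNge (le_trans (ltW st) tp).
  by apply: cvg_near_cst; near=> s; have -> : p < s by near: s; exact: nbhs_left_gt.
- have [M HM] := @nondecreasing_sBV R (fun t => (p < t)%R%:R) 0 1
    ltac:(by move=> s t st /=; rewrite ler_nat; case: ltP => // /lt_le_trans/(_ st) ->)
    ltac:(by move=> t /=; case: ltP; rewrite lexx ler01).
  exists (`|c| * M) => n s s1 s2; apply: le_trans (ler_wpM2l (normr_ge0 c) (HM n s s1 s2)).
  by rewrite mulr_sumr; apply: ler_sum => k _; rewrite -mulrBr normrM.
- by move=> t t0; rewrite !ltNge p0 (le_trans t0 p0).
- by move=> t s h1 h2; rewrite (le_lt_trans pT h1) (le_lt_trans pT h2).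
Unshelve. all: by end_near. Qed.

(** With [z = x - y], the part of [z] on []s, p]] is the difference of its parts on [t <= p] and
    [t <= s]; each of these is [z] stopped there minus a step that kills the constant tail. *)
Lemma sX_glue x y s p : 0 <= s -> s <= p -> p <= T -> sX T x -> sX T y ->
  sX T (fun t => if s < t <= p then x t else y t).
Proof.
move=> s0 sp pT Xx Xy; have p0 := le_trans s0 sp; have sT := le_trans sp pT.
pose z t := x t + - y t; have Xz : sX T z by apply: sXD => //; exact: sXN.
have H := sXD (sXD Xy (sXD (sX_stop p0 pT Xz) (sXN (sX_step (z p) p0 pT))))
  (sXN (sXD (sX_stop s0 sT Xz) (sXN (sX_step (z s) s0 sT)))).
move: H; congr (sX T _).
apply/funext => t; have [ts|st] := leP t s.
  have tp := le_trans ts sp; by rewrite /= (min_l tp) ltNge tp/=; ring.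
have [tp|pt] := leP t p; first by rewrite /z /=; ring.
by rewrite /= /z; ring.
Qed.

Lemma sX_ends x (a b : R) : sX T x ->
  sX T (fun t => if t <= 0 then a else if T < t then b else x t).
Proof.
move=> Xx; have H := sXD (sXD (sXD Xx (sX_cst (a - x 0))) (sXN (sX_step (a - x 0) (lexx 0) (ltW T0))))
  (sX_step (b - x (T + 1)) (ltW T0) (lexx T)).
have [_ _ x0 xT] := Xx; move: H; congr (sX T _).
apply/funext => t; have [t0|t0] := leP t 0; rewrite /=.
  by rewrite ltNge (le_trans t0 (ltW T0))/= x0//; ring.
have [tT|Tt] := leP t T; rewrite /=; first by ring.
by rewrite (xT t (T + 1)) ?ltrDl//; ring.
Qed.

Variable d : nat.
Implicit Types (z : R -> 'rV[R]_d).

Lemma inXD z1 z2 : inX T z1 -> inX T z2 -> inX T (fun t => z1 t + z2 t).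
Proof.
move=> /inX_coord H1 /inX_coord H2; apply/inX_coord => i.
by under eq_fun do rewrite mxE; exact: sXD.
Qed.

Lemma inXN z : inX T z -> inX T (fun t => - z t).
Proof.
by move=> /inX_coord H; apply/inX_coord => i; under eq_fun do rewrite mxE; exact: sXN.
Qed.

Lemma inXB z1 z2 : inX T z1 -> inX T z2 -> inX T (fun t => z1 t - z2 t).
Proof. by move=> H1 H2; apply: inXD => //; exact: inXN. Qed.

Lemma inX_cst (u : 'rV[R]_d) : inX T (cst u).
Proof. by apply/inX_coord => i; exact: sX_cst. Qed.

Lemma inX_step p (u : 'rV[R]_d) : 0 <= p -> p <= T -> inX T (fun t => (p < t)%R%:R *: u).
Proof.
move=> p0 pT; apply/inX_coord => i.
by under eq_fun do rewrite mxE mulrC; exact: sX_step.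
Qed.

Lemma inX_glue z1 z2 s p : 0 <= s -> s <= p -> p <= T -> inX T z1 -> inX T z2 ->
  inX T (fun t => if s < t <= p then z1 t else z2 t).
Proof.
move=> s0 sp pT /inX_coord H1 /inX_coord H2; apply/inX_coord => i.
rewrite (_ : (fun t => _) = (fun t => if s < t <= p then z1 t ord0 i else z2 t ord0 i)).
  exact: sX_glue.
by apply/funext => t; case: ifP.
Qed.

(** On [[0, T]] only the value at 0 changes, a null set for atomless measures, so the ends can be
    prescribed without altering any integral. *)
Definition set_ends (a b : 'rV[R]_d) z (t : R) : 'rV[R]_d :=
  if t <= 0 then a else if T < t then b else z t.

Lemma inX_ends a b z : inX T z -> inX T (set_ends a b z).
Proof.
move=> /inX_coord H; apply/inX_coord => i.
rewrite (_ : (fun t => _) = (fun t => if t <= 0 then a ord0 i else if T < t then b ord0 i else z t ord0 i)).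
  exact: sX_ends.
by apply/funext => t; rewrite /set_ends; case: ifP => // _; case: ifP.
Qed.

Lemma set_ends0 a b z : set_ends a b z 0 = a.
Proof. by rewrite /set_ends lexx. Qed.

Lemma set_endsT a b z : set_ends a b z (T + 1) = b.
Proof. by rewrite /set_ends leNgt addr_gt0//= ltrDl ltr01. Qed.

Lemma set_endsE a b z t : 0 < t -> t <= T -> set_ends a b z t = z t.
Proof. by move=> t0 tT; rewrite /set_ends leNgt t0/= ltNge tT. Qed.

Implicit Types (v : Vtype R d).

(** The step jumping just after [p] is represented by the Dirac mass at [p] with density [c], so the
    limit of the sums is an integral against that mass. *)
Lemma RSsum_step (u : R -> R) p (c : R) : 0 <= p -> p <= T -> {within I0T T, continuous u} ->
  RSsum T u (fun t => c * (p < t)%R%:R) n @[n --> \oo] --> c * u p.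
Proof.
move=> p0 pT cu.
have Ip : p \in I0T T by rewrite inE /I0T/= in_itv/= p0.
have mI : measurable (I0T T) by exact: measurable_itv.
pose lam : {measure set R -> \bar R} := dirac p.
have lamE A : lam A = (p \in A)%:R%:E by exact: diracE.
have lamI (D : set R) (f : R -> \bar R) : measurable D -> measurable_fun D f ->
  (\int[lam]_(t in D) f t = lam D * f p)%E by move=> ? ?; exact: integral_dirac.
have h1 : lam (~` I0T T) = 0%E by rewrite lamE in_setC Ip.
have h2 : lam.-integrable (I0T T) (EFin \o cst c).
  apply: measurable_bounded_integrable => //; first by rewrite lamE ltry.
  exact: (bounded_on (C := `|c|)).
have h3 t : 0 < t -> (c * (p < t)%R%:R - c * (p < 0)%R%:R)%:E = (\int[lam]_(r in Ico0 t) (cst c r)%:E)%E.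
  move=> t0; have mt : measurable (Ico0 t) by exact: measurable_itv.
  rewrite lamI//; last by apply/measurable_EFinP; exact: measurable_cst.
  have p00 : (p < 0) = false by rewrite ltNge p0.
  have pt : (p \in Ico0 t) = (p < t) by apply/idP/idP; rewrite inE /Ico0/= in_itv/= p0.
  by rewrite lamE pt p00 mulr0 subr0 EFinM muleC.
have [_] := RSsum_cvg T0 h1 h2 h3 cu.
rewrite (_ : (\int[lam]_(t in I0T T) (u t * cst c t))%R = c * u p); first exact.
rewrite /Rintegral lamI//; last first.
  apply/measurable_EFinP; apply: measurable_funM => //.
  exact: subspace_continuous_measurable_fun.
by rewrite lamE Ip mul1e /= mulrC.
Qed.

Lemma pairingD v z1 z2 : inV T v -> inX T z1 -> inX T z2 ->
  pairing T v (fun t => z1 t + z2 t) = pairing T v z1 + pairing T v z2.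
Proof.
move=> Vv X1 X2.
have := pairingB T0 Vv (inXD X1 X2) X2 _.
have -> : (fun t => z1 t + z2 t - z2 t) = z1 by apply/funext => t; rewrite addrK.
by move=> /(_ X1) ->; rewrite subrK.
Qed.

Lemma pairing_step v p (c : 'rV[R]_d) : inV T v -> 0 <= p -> p <= T ->
  pairing T v (fun t => (p < t)%R%:R *: c) = dotv c (v.2 p).
Proof.
move=> Vv p0 pT; apply: pairing_eq => //; first exact: inX_step.
have -> : dotv c (v.2 p) = dotv v.1 ((p < 0)%R%:R *: c) + dotv c (v.2 p).
  by rewrite ltNge p0 dotvZr mul0r add0r.
apply: cvgD; first exact: cvg_cst.
apply: cvg_sumr => i.
rewrite (_ : (fun t => ((p < t)%R%:R *: c) ord0 i) = (fun t => c ord0 i * (p < t)%R%:R)); last first.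
  by apply/funext => t; rewrite mxE mulrC.
by apply: RSsum_step => //; exact: inV_coord.
Qed.

(** Pulses of height [c k] on []s k, s k.+1]], each written as a difference of two steps so that its
    pairing is an increment of [v]. *)
Definition steps (c : nat -> 'rV[R]_d) (s : nat -> R) (n : nat) (t : R) : 'rV[R]_d :=
  \sum_(k < n) ((s k < t)%R%:R *: c k - (s k.+1 < t)%R%:R *: c k).

Lemma steps_inX c (s : nat -> R) n : (forall k, I0T T (s k)) -> inX T (steps c s n).
Proof.
move=> sI; have s0 k : 0 <= s k by have := sI k; rewrite /I0T/= in_itv/= => /andP[].
have sT k : s k <= T by have := sI k; rewrite /I0T/= in_itv/= => /andP[].
elim: n => [|n IH].
  by rewrite (_ : steps c s 0 = cst 0); [exact: inX_cst|apply/funext => t; rewrite /steps big_ord0].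
rewrite (_ : steps c s n.+1 = (fun t => steps c s n t + ((s n < t)%R%:R *: c n - (s n.+1 < t)%R%:R *: c n))).
  by apply: inXD => //; apply: inXB; exact: inX_step.
by apply/funext => t; rewrite /steps big_ord_recr.
Qed.

Lemma pairing_steps v c (s : nat -> R) n : inV T v -> (forall k, I0T T (s k)) ->
  pairing T v (steps c s n) = \sum_(k < n) dotv (c k) (v.2 (s k) - v.2 (s k.+1)).
Proof.
move=> Vv sI; have s0 k : 0 <= s k by have := sI k; rewrite /I0T/= in_itv/= => /andP[].
have sT k : s k <= T by have := sI k; rewrite /I0T/= in_itv/= => /andP[].
elim: n => [|n IH].
  rewrite big_ord0 (_ : steps c s 0 = (fun t => cst 0 t - cst 0 t)).
    by rewrite pairingB ?subrr//; [exact: inX_cst|exact: inX_cst|apply: inXB; exact: inX_cst].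
  by apply/funext => t; rewrite /steps big_ord0 subrr.
rewrite big_ord_recr/= -IH.
rewrite (_ : steps c s n.+1 = (fun t => steps c s n t + ((s n < t)%R%:R *: c n - (s n.+1 < t)%R%:R *: c n))).
  rewrite pairingD//; [|exact: steps_inX|by apply: inXB; exact: inX_step].
  congr (_ + _); rewrite pairingB//; [|exact: inX_step|exact: inX_step|by apply: inXB; exact: inX_step].
  by rewrite !pairing_step// dotvBr.
by apply/funext => t; rewrite /steps big_ord_recr.
Qed.

Lemma steps_val c (s : nat -> R) n t : (forall k, s k <= s k.+1) ->
  steps c s n t = 0 \/ exists k, steps c s n t = c k.
Proof.
move=> nd; have nd' : {homo s : i j / (i <= j)%N >-> i <= j} by apply: homo_leq => // x y z; exact: le_trans.
have big_ n' : s n' < t -> steps c s n' t = 0.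
  move=> st; rewrite /steps big1// => k _.
  have h1 : s k < t := le_lt_trans (nd' _ _ (ltnW (ltn_ord k))) st.
  have h2 : s k.+1 < t := le_lt_trans (nd' _ _ (ltn_ord k)) st.
  by rewrite h1 h2 subrr.
elim: n => [|n IH]; first by left; rewrite /steps big_ord0.
have E : steps c s n.+1 t = steps c s n t + ((s n < t)%R%:R *: c n - (s n.+1 < t)%R%:R *: c n).
  by rewrite /steps big_ord_recr.
have [ts|st] := leP t (s n).
  have ts' := le_trans ts (nd n).
  by rewrite E !ltNge ts ts'/= !scale0r subrr addr0.
rewrite E st big_// add0r; case: ltP => _; first by left; rewrite subrr.
by right; exists n; rewrite scale1r scale0r subr0.
Qed.

End Closure.

(** * Densities and atoms *)

Section Densities.
Context {R : realType}.
Implicit Types (m nu : {measure set R -> \bar R}).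

Lemma abs_density_ex m (D : set R) (f : R -> R) : measurable D -> m.-integrable D (EFin \o f) ->
  exists nu, (nu setT < +oo)%E /\
    forall A, measurable A -> nu A = (\int[m]_(t in A `&` D) `|f t|%:E)%E.
Proof.
move=> mD If; have mf := measurable_int _ If.
pose F t := (((fun t => `|f t|%:E) \_ D) t).
have mF : measurable_fun [set: R] F.
  apply/(measurable_restrictT _ mD); apply/measurable_EFinP; apply: measurableT_comp => //.
  exact/measurable_EFinP.
have F0 t : (0 <= F t)%E by rewrite /F patchE; case: ifP.
have [nu Hnu] := density_ex m mF F0; exists nu; split.
  rewrite Hnu /F -integral_mkcond; case/integrableP : If => _.
  by apply: le_lt_trans.
by move=> A mA; rewrite Hnu /F integral_mkcondr.
Qed.

Lemma density_integral m nu (rho : R -> R) : (nu setT < +oo)%E -> (m setT < +oo)%E ->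
  (forall t, 0 <= rho t) -> m.-integrable setT (EFin \o rho) ->
  (forall A, measurable A -> nu A = (\int[m]_(t in A) (rho t)%:E)%E) ->
  forall (f : R -> \bar R) E, measurable_fun setT f -> (forall t, (0 <= f t)%E) -> measurable E ->
  (\int[nu]_(t in E) f t = \int[m]_(t in E) (f t * (rho t)%:E))%E.
Proof.
move=> nuT mT rho0 Irho nuE f E mf f0 mE.
have finnu : fin_num_fun nu by move=> A mA; exact: fin_measure.
have finm : fin_num_fun m by move=> A mA; exact: fin_measure.
pose nu' : {finite_measure set R -> \bar R} := finite_copy finnu.
pose m' : {finite_measure set R -> \bar R} := finite_copy finm.
have dom : nu' `<< m'.
  move=> A nA B mB BA; have m0 : m B = 0%E by exact: nA.
  rewrite [LHS](nuE B mB); apply: null_set_integral => //.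
  by apply: measurable_funTS; exact: measurable_int Irho.
pose g := Radon_Nikodym_SigmaFinite.f nu' m'.
have Ig : m'.-integrable setT g by exact: Radon_Nikodym_SigmaFinite.f_integrable.
have aeg : ae_eq m' setT g (EFin \o rho).
  apply: integral_ae_eq => //; first exact: measurable_int Irho.
  move=> A _ mA; rewrite -(Radon_Nikodym_SigmaFinite.f_integral dom mA); exact: nuE.
transitivity (\int[m']_(t in E) (f t * g t))%E.
  by rewrite -(Radon_Nikodym_SigmaFinite.change_of_variables dom f0 mE (measurable_funTS mf)).
apply: ae_eq_integral => //.
- by apply: measurable_funTS; apply: emeasurable_funM => //; exact: measurable_int Ig.
- by apply: measurable_funTS; apply: emeasurable_funM => //; exact: measurable_int Irho.
- by apply: filterS aeg => t /= /(_ I) ->.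
Qed.

Section DensityReal.
Variables (m nu : {measure set R -> \bar R}) (rho : R -> R).
Hypotheses (nuT : (nu setT < +oo)%E) (mT : (m setT < +oo)%E) (rho0 : forall t, 0 <= rho t)
  (Irho : m.-integrable setT (EFin \o rho))
  (nuE : forall A, measurable A -> nu A = (\int[m]_(t in A) (rho t)%:E)%E).
Variables (f : R -> R) (E : set R).
Hypotheses (mf : measurable_fun setT f) (mE : measurable E).

Lemma density_integrable :
  nu.-integrable E (EFin \o f) <-> m.-integrable E (EFin \o (fun t => f t * rho t)).
Proof.
have mfE : measurable_fun setT (EFin \o f) by exact/measurable_EFinP.
have mr : measurable_fun setT rho by apply/measurable_EFinP; exact: measurable_int Irho.
have chg : (\int[nu]_(t in E) `|(f t)%:E| = \int[m]_(t in E) `|(f t * rho t)%:E|)%E.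
  rewrite (density_integral nuT mT rho0 Irho nuE)//; last by apply: measurableT_comp.
  by apply: eq_integral => t _; rewrite /= normrM EFinM (ger0_norm (rho0 t)).
split=> /integrableP[_ I]; apply/integrableP; split.
- by apply: measurable_funTS; apply/measurable_EFinP; exact: measurable_funM.
- by rewrite -chg.
- exact: measurable_funTS.
- by rewrite chg.
Qed.

Lemma density_int : (\int[nu]_(t in E) (f t)%:E = \int[m]_(t in E) (f t * rho t)%:E)%E.
Proof.
have mfE : measurable_fun setT (EFin \o f) by exact/measurable_EFinP.
rewrite [LHS]integralE [RHS]integralE.
congr (_ - _)%E; rewrite (density_integral nuT mT rho0 Irho nuE)//.
- by apply: eq_integral => t _; rewrite !funeposE -!EFin_max -EFinM maxr_pMl// mul0r.
- exact: measurable_funepos.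
- by apply: eq_integral => t _; rewrite !funenegE -!EFinN -!EFin_max -EFinM maxr_pMl// mul0r mulNr.
- exact: measurable_funeneg.
Qed.

End DensityReal.

(** Punctured intervals around [t] decrease to the empty set, so their mass for the finite measure
    of density [|f|] tends to 0. The point [t] must be removed because it may be an atom. *)
Lemma punctured_small m (D : set R) (f : R -> R) (t e : R) : measurable D ->
  m.-integrable D (EFin \o f) -> 0 < e -> exists2 dl : R, 0 < dl &
    forall A, measurable A -> A `<=` D -> (forall r, A r -> `|r - t| < dl /\ r <> t) ->
      `|(\int[m]_(r in A) f r)%R| < e.
Proof.
move=> mD If e0; have [nu [nuT Hnu]] := abs_density_ex mD If.
pose F k := `]t - k.+1%:R^-1, t + k.+1%:R^-1[%classic `\ t.
have mF k : measurable (F k) by apply: measurableD => //; exact: measurable_itv.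
have F0 : \bigcap_k F k = set0.
  apply/seteqP; split => r //= H.
  have [_ rt] := H 0%N I.
  have rt0 : 0 < `|r - t| by rewrite normr_gt0 subr_eq0; exact/eqP.
  have /cvgrPdist_lt/(_ _ rt0)[N _ HN] := @cvg_harmonic R.
  have := HN N (leqnn N); rewrite /harmonic/= sub0r normrN ger0_norm ?invr_ge0// => h.
  have [+ _] := H N I; rewrite /= in_itv/= => /andP[h1 h2].
  have : `|r - t| < N.+1%:R^-1 by rewrite ltr_norml; move: h1 h2; move: (N.+1%:R^-1) => z ? ?; lra.
  by move=> /lt_trans/(_ h); rewrite ltxx.
have nF : {homo F : n k / (n <= k)%N >-> (k <= n)%O}.
  move=> n k nk; apply/subsetPset => r [/= + rt]; split => //; move: a; rewrite /= !in_itv/=.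
  have : (k.+1%:R^-1 : R) <= n.+1%:R^-1 by rewrite lef_pV2 ?posrE// ler_nat.
  by move: (k.+1%:R^-1) (n.+1%:R^-1) => z w zw /andP[h1 h2]; apply/andP; split; lra.
have cF : nu (F k) @[k --> \oo] --> nu set0.
  rewrite -F0; apply: nonincreasing_cvg_mu => //; last by rewrite F0.
  by apply: le_lt_trans nuT; apply: le_measure; rewrite ?inE.
rewrite measure0 in cF.
have [k _ /(_ k (leqnn k)) /= hk] : \forall k \near \oo, (nu (F k) < e%:E)%E.
  have /fine_cvgP[_ /cvgrPdist_lt/(_ _ e0)] := cF; apply: filterS => k /=.
  rewrite sub0r normrN ger0_norm ?fine_ge0// -lte_fin fineK//; exact: fin_measure.
exists k.+1%:R^-1; first by rewrite invr_gt0.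
move=> A mA AD HA; rewrite -lte_fin; apply: le_lt_trans hk.
have IA : m.-integrable A (EFin \o f) by exact: integrableS If.
rewrite EFin_normr_Rintegral//; apply: le_trans (le_abse_integral _ mA (measurable_int _ IA)) _.
rewrite Hnu//; apply: ge0_subset_integral => //.
- exact: measurableI.
- apply/measurable_EFinP; apply: measurableT_comp => //.
  apply: (measurable_funS mD) => //.
  by apply/measurable_EFinP; exact: measurable_int If.
- move=> r Ar; have [h1 h2] := HA r Ar; split; last exact: AD.
  split => //=; rewrite in_itv/=; move: h1; rewrite ltr_norml; move: (k.+1%:R^-1) => z ?.
  by apply/andP; split; lra.
Qed.

End Densities.

Section Atoms.
Context {R : realType} (T : R).
Hypothesis T0 : 0 < T.
Implicit Types (m mu sig : {measure set R -> \bar R}).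

Lemma Rint_Icc0_diff m (b : R -> R) s t : m.-integrable (I0T T) (EFin \o b) -> 0 <= s -> s <= t -> t <= T ->
  (\int[m]_(r in Icc0 t) b r)%R = (\int[m]_(r in Icc0 s) b r)%R + (\int[m]_(r in `]s, t]%classic) b r)%R.
Proof.
move=> Ib s0 st tT.
have E : Icc0 t = Icc0 s `|` `]s, t]%classic.
  apply/seteqP; split => r; rewrite /Icc0/= !in_itv/=.
    by move=> /andP[-> ->]; rewrite andbT/=; have [?|?] := leP r s; [left|right].
  move=> [/andP[-> h]|/andP[h ->]]; first exact: le_trans st.
  by rewrite (le_trans s0 (ltW h)).
rewrite [in LHS]E Rintegral_setU; [by []|exact: measurable_itv|exact: measurable_itv| |].
- rewrite -E; apply: integrableS Ib; [exact: measurable_itv|exact: measurable_itv|].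
  by move=> r; rewrite /Icc0 /I0T/= !in_itv/= => /andP[-> h]; exact: le_trans tT.
- apply/disj_setPS => r; rewrite /Icc0/= !in_itv/= => -[/andP[_ h1] /andP[h2 _]].
  by have := lt_le_trans h2 h1; rewrite ltxx.
Qed.

Lemma Rint_set1 m (b : R -> R) t : (\int[m]_(r in [set t]) b r)%R = b t * fine (m [set t]).
Proof.
have := @Rintegral_cst _ _ _ m [set t] (measurable_set1 t) (b t) => <-.
by apply: eq_Rintegral => r; rewrite inE /= => ->.
Qed.

Lemma Rint_oc_split m (b : R -> R) s t : m.-integrable (I0T T) (EFin \o b) -> 0 <= s -> s < t -> t <= T ->
  (\int[m]_(r in `]s, t]%classic) b r)%R = (\int[m]_(r in `]s, t[%classic) b r)%R + b t * fine (m [set t]).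
Proof.
move=> Ib s0 st tT.
have E : `]s, t]%classic = `]s, t[%classic `|` [set t].
  apply/seteqP; split => r /=; rewrite !in_itv/=.
    by move=> /andP[-> +]; rewrite le_eqVlt => /predU1P[->|->]; [right|left].
  by move=> [/andP[-> /ltW ->]//|->]; rewrite st lexx.
rewrite [in LHS]E Rintegral_setU ?Rint_set1; [by []|exact: measurable_itv|exact: measurable_set1| |].
- rewrite -E; apply: integrableS Ib; [exact: measurable_itv|exact: measurable_itv|].
  by move=> r; rewrite /I0T/= !in_itv/= => /andP[h1 h2]; rewrite (ltW (le_lt_trans s0 h1)) (le_trans h2).
- by apply/disj_setPS => r /=; rewrite in_itv/= => -[/andP[_ h1] rt]; rewrite rt ltxx in h1.
Qed.

Lemma Rint_continuous m (b : R -> R) : m.-integrable (I0T T) (EFin \o b) ->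
  (forall t, m [set t] = 0%E) -> {within I0T T, continuous (fun t => (\int[m]_(r in Icc0 t) b r)%R)}.
Proof.
move=> Ib m0; apply/subspace_continuousP => t It; apply/cvgrPdist_lt => e e0.
have mI : measurable (I0T T) by exact: measurable_itv.
have [dl dl0 H] := punctured_small t mI Ib e0.
exists dl => // s /=; rewrite /ball/= /from_subspace => st Is.
move: (It) (Is); rewrite /I0T/= !in_itv/= => /andP[t0 tT] /andP[s0 sT].
have [ts|ts|->] := ltgtP s t.
- rewrite (Rint_Icc0_diff Ib s0 (ltW ts) tT) addrAC subrr add0r Rint_oc_split// m0 mulr0 addr0.
  apply: H; first exact: measurable_itv.
    by move=> r; rewrite /I0T/= !in_itv/= => /andP[h1 h2]; rewrite (ltW (le_lt_trans s0 h1)) (le_trans (ltW h2)).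
  move=> r /=; rewrite in_itv/= => /andP[h1 h2]; split; last by move=> E; rewrite E ltxx in h2.
  by move: st; rewrite !ltr_norml; lra.
- rewrite (Rint_Icc0_diff Ib t0 (ltW ts) sT) opprD addrA subrr add0r normrN.
  apply: H; first exact: measurable_itv.
    by move=> r; rewrite /I0T/= !in_itv/= => /andP[h1 h2]; rewrite (ltW (le_lt_trans t0 h1)) (le_trans h2).
  move=> r /=; rewrite in_itv/= => /andP[h1 h2]; split; last by move=> E; rewrite E ltxx in h1.
  by move: st; rewrite !ltr_norml; lra.
- by rewrite subrr normr0.
Qed.

Variable d : nat.

Lemma DvDec_Rint mu sig (v : Vtype R d) a s : DvDec T mu v a s sig -> forall t i, I0T T t ->
  v.2 t ord0 i - v.2 0 ord0 i =
    (\int[mu]_(r in Icc0 t) a r ord0 i)%R + (\int[sig]_(r in Icc0 t) s r ord0 i)%R.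
Proof.
move=> [_ [_ [_ [Ia [Is [_ H]]]]]] t i It; apply: EFin_inj; rewrite H// EFinD.
have sub : Icc0 t `<=` I0T T.
  move: It; rewrite /Icc0 /I0T/= !in_itv/= => /andP[_ tT] r /=.
  by rewrite !in_itv/= => /andP[-> /le_trans]; apply.
have mt : measurable (Icc0 t) by exact: measurable_itv.
have mI : measurable (I0T T) by exact: measurable_itv.
by rewrite !EFin_Rintegral//; [exact: integrableS (Is i)|exact: integrableS (Ia i)].
Qed.

(* [v] and the absolutely continuous part are continuous, hence so is the singular part. *)
Lemma DvDec_atomless mu sig (v : Vtype R d) a s : (forall t, mu [set t] = 0%E) -> inV T v ->
  DvDec T mu v a s sig -> forall t, sig [set t] = 0%E.
Proof.
move=> mu0 Vv Dv t.
have [sI [sT [_ [Ia [Is [s1 _]]]]]] := Dv.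
have mI : measurable (I0T T) by exact: measurable_itv.
have [It|It] := pselect (I0T T t); last first.
  by apply: (subset_measure0 _ _ _ sI) => //; [exact: measurableC|move=> r ->].
have [//|st0] := eqVneq (sig [set t]) 0%E; exfalso.
have sfin : sig [set t] \is a fin_num.
  rewrite ge0_fin_numE//; apply: le_lt_trans sT; apply: le_measure; rewrite ?inE//.
  by move=> r ->.
have f0 : fine (sig [set t]) != 0 by rewrite fine_eq0.
(* The jump of [v] at [t] equals [s t] times the mass of the atom. It vanishes by continuity, so
   [s t = 0]; this contradicts [enorm (s t) = 1], which holds at every atom of [sig]. *)
have sz i : s t ord0 i = 0.
  have H := DvDec_Rint Dv.
  move: (It); rewrite /I0T/= in_itv/= => /andP[t0 tT].
  suff : s t ord0 i * fine (sig [set t]) = 0 by move/eqP; rewrite mulf_eq0 (negPf f0) orbF => /eqP.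
  move: t0; rewrite le_eqVlt => /predU1P[t0|t0].
    have := H 0 i; rewrite subrr /I0T/= in_itv/= lexx (ltW T0).
    have -> : Icc0 0 = [set 0 : R].
      apply/seteqP; split => [r|r /= ->]; rewrite /Icc0/= in_itv/= ?lexx//.
      by move=> /le_anti ->.
    by rewrite !Rint_set1 mu0 mulr0 add0r t0 => /(_ isT).
  (* One third of [e] for each of three small quantities: the two integrals over []r, t[] and the
     increment of [v]. *)
  apply/eqP; rewrite -normr_le0; apply/ler_addgt0Pr => e e0; rewrite add0r.
  have e3 : 0 < e / 3 by lra.
  have [d1 d10 H1] := punctured_small t mI (Ia i) e3.
  have [d2 d20 H2] := punctured_small t mI (Is i) e3.
  have [d3 d30 H3] := within_delta (inV_coord (i := i) Vv) It e3.
  pose dl := Num.min t (Num.min d1 (Num.min d2 d3)).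
  have dl0 : 0 < dl by rewrite !lt_min t0 d10 d20 d30.
  pose r := t - dl / 2.
  have [h0 [h1 [h2 h3]]] : dl <= t /\ dl <= d1 /\ dl <= d2 /\ dl <= d3.
    by rewrite /dl !ge_min !lexx !orbT.
  have r0 : 0 <= r by rewrite /r; lra.
  have rt : r < t by rewrite /r; lra.
  have Ir : I0T T r by rewrite /I0T/= in_itv/= r0 (le_trans (ltW rt)).
  have := H t i It; have := H r i Ir.
  rewrite (Rint_Icc0_diff (Ia i) r0 (ltW rt) tT) (Rint_Icc0_diff (Is i) r0 (ltW rt) tT).
  rewrite (Rint_oc_split (Ia i) r0 rt tT) (Rint_oc_split (Is i) r0 rt tT) mu0 mulr0 addr0.
  have sub : `]r, t[%classic `<=` I0T T.
    by move=> q; rewrite /I0T/= !in_itv/= => /andP[g1 g2]; rewrite (ltW (le_lt_trans r0 g1)) (le_trans (ltW g2)).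
  have pr (q : R) : `]r, t[%classic q -> `|q - t| < dl / 2 /\ q <> t.
    rewrite /= in_itv/= => /andP[g1 g2]; split; last by move=> E; rewrite E ltxx in g2.
    by rewrite ltr_norml; move: g1; rewrite /r; lra.
  have B1 : `|(\int[mu]_(q in `]r, t[%classic) a q ord0 i)%R| < e / 3.
    by apply: H1 => // q /pr[? ?]; split => //; lra.
  have B2 : `|(\int[sig]_(q in `]r, t[%classic) s q ord0 i)%R| < e / 3.
    by apply: H2 => // q /pr[? ?]; split => //; lra.
  have B3 : `|v.2 r ord0 i - v.2 t ord0 i| < e / 3.
    by apply: H3 => //; rewrite /r ltr_norml; lra.
  move: B1 B2 B3; rewrite !ltr_norml ler_norml; lra.
have [N [mN N0 HN]] := s1.
have : ~ N t.
  move=> Nt; move/eqP: st0; apply; apply: (subset_measure0 _ _ _ N0) => //; first by move=> r ->.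
move=> Nt; have : enorm (s t) = 1 by apply: contrapT => h; apply: Nt; apply: HN => /(_ It).
rewrite /enorm big1 ?sqrtr0 => [/esym/eqP|i _]; last by rewrite sz expr0n.
by rewrite oner_eq0.
Qed.

End Atoms.

(** * Lebesgue decomposition of Dv *)

Section Decomposition.
Context {R : realType} (T : R) (d : nat).
Hypothesis T0 : 0 < T.

Lemma concentrated_fin (m : {measure set R -> \bar R}) :
  m (~` I0T T) = 0%E -> (m (I0T T) < +oo)%E -> (m setT < +oo)%E.
Proof.
move=> m0 mI; have mIm : measurable (I0T T) by exact: measurable_itv.
rewrite -(setUv (I0T T)) measureU//; [|exact: measurableC|exact: setICr].
by apply: lte_add_pinfty => //; apply: le_lt_trans (ltry 0); rewrite le_eqVlt; apply/orP; left; apply/eqP.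
Qed.

Lemma clamp_lip (a b s t : R) : a <= b -> `|clamp a b s - clamp a b t| <= `|s - t|.
Proof.
move=> ab; rewrite /clamp.
have [sb|sb] := leP s b; have [tb|tb] := leP t b;
  have [?|?] := leP a s; have [?|?] := leP a t; have [?|?] := leP a b;
  rewrite ler_norml; have := ler_norm (s - t); have := lerNnormlW (lexx `|s - t|); lra.
Qed.

Lemma clamp_inX (v : Vtype R d) : inVBV T v -> inX T (fun t => v.2 (clamp 0 T t)).
Proof.
move=> [Vv /BV_coord bv]; apply/inX_coord => i.
have cI t : I0T T (clamp 0 T t) by exact: clamp_in (ltW T0).
split.
- move=> t; apply/cvgrPdist_lt => e e0.
  have [dl dl0 H] := within_delta (inV_coord (i := i) Vv) (cI t) e0.
  exists dl => // s /= st _; rewrite distrC; apply: H => //.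
  by apply: le_lt_trans (clamp_lip _ _ (ltW T0)) _; rewrite distrC.
- have [M HM] := bv i; exists M => n s s1 _.
  by apply: (HM n (clamp 0 T \o s)) => k /=; [exact: (clamp_nd _ _ (s1 k))|exact: cI].
- by move=> t t0; rewrite /clamp !min_l ?(le_trans t0 (ltW T0))// ?(ltW T0)// max_l// maxxx.
- by move=> t s Tt Ts; rewrite /clamp !min_r// ltW.
Qed.

(** [v] extended by constants belongs to [X], so its measure comes from [DxRep_ex]. There increments
    are integrals over [[0, t[]; the passage to [[0, t]] uses continuity at [t], by comparison with
    a slightly larger [r], and the final value when [t = T]. *)
Lemma inVBV_rep (v : Vtype R d) : inVBV T v ->
  exists (lam : {measure set R -> \bar R}) (g : R -> 'rV[R]_d),
    [/\ lam (~` I0T T) = 0%E, (lam setT < +oo)%E,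
      (forall i, lam.-integrable (I0T T) (EFin \o (fun t => g t ord0 i))) &
      (forall t i, I0T T t -> v.2 t ord0 i - v.2 0 ord0 i = (\int[lam]_(r in Icc0 t) g r ord0 i)%R)].
Proof.
move=> Vv; have [Vc _] := Vv.
have mI : measurable (I0T T) by exact: measurable_itv.
have [lam [g [l0 [lI [Ig Hg]]]]] := DxRep_ex T0 (clamp_inX Vv).
exists lam, g; split => //.
  exact: concentrated_fin.
move=> t i It; have := It; rewrite /I0T/= in_itv/= => /andP[t0 tT].
have vE r : I0T T r -> v.2 (clamp 0 T r) = v.2 r.
  by rewrite /I0T/= in_itv/= => /andP[? ?]; rewrite clamp_id.
have I00 : I0T T 0 by rewrite /I0T/= in_itv/= lexx ltW.
move: tT; rewrite le_eqVlt => /predU1P[tT|tT].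
  have := Hg (T + 1) i; rewrite (vE 0)// {1}/clamp min_r ?lerDl// max_r ?(ltW T0)// tT.
  rewrite addr_gt0// => /(_ isT) E; apply: EFin_inj; rewrite E EFin_Rintegral//; last 1 first.
  - exact: Ig.
  apply: integral_null_ext => //; first exact: measurable_itv.
    by move=> r; rewrite /Icc0 /Ico0/= !in_itv/= => /andP[-> h]; rewrite (le_lt_trans h)// ltrDl.
  apply: (subset_measure0 _ _ _ l0); first by apply: measurableD => //; exact: measurable_itv.
    exact: measurableC.
  by move=> r [].
apply/eqP; rewrite -subr_eq0 -normr_le0; apply/ler_addgt0Pr => e e0; rewrite add0r.
have e2 : 0 < e / 2 by lra.
have [d1 d10 H1] := punctured_small t mI (Ig i) e2.
have [d2 d20 H2] := within_delta (inV_coord (i := i) Vc) It e2.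
pose dl := Num.min (T - t) (Num.min d1 d2).
have dl0 : 0 < dl by rewrite !lt_min d10 d20 subr_gt0 tT.
have [h0 [h1 h2]] : dl <= T - t /\ dl <= d1 /\ dl <= d2 by rewrite /dl !ge_min !lexx !orbT.
pose r := t + dl / 2.
have tr : t < r by rewrite /r; lra.
have rT : r <= T by rewrite /r; lra.
have r0 : 0 < r by rewrite (le_lt_trans t0).
have Ir : I0T T r by rewrite /I0T/= in_itv/= (ltW r0).
have mc : measurable (Icc0 t) by exact: measurable_itv.
have mo : measurable `]t, r[%classic by exact: measurable_itv.
have E : Ico0 r = Icc0 t `|` `]t, r[%classic.
  apply/seteqP; split => q; rewrite /Icc0 /Ico0/= !in_itv/=.
    by move=> /andP[-> ->]; rewrite andbT/=; have [?|?] := leP q t; [left|right].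
  move=> [/andP[-> h]|/andP[h ->]]; first exact: le_lt_trans tr.
  by rewrite (le_trans t0 (ltW h)).
have subr_ : Ico0 r `<=` I0T T.
  by move=> q; rewrite /I0T /Ico0/= !in_itv/= => /andP[-> h]; rewrite (le_trans (ltW h)).
have : v.2 r ord0 i - v.2 0 ord0 i =
    (\int[lam]_(q in Icc0 t) g q ord0 i)%R + (\int[lam]_(q in `]t, r[%classic) g q ord0 i)%R.
  have := Hg r i r0; rewrite !vE// => H.
  transitivity ((\int[lam]_(q in Ico0 r) g q ord0 i)%R); first by rewrite /Rintegral -H.
  rewrite E Rintegral_setU//.
  - by rewrite -E; apply: integrableS (Ig i) => //; exact: measurable_itv.
  - apply/disj_setPS => q; rewrite /Icc0/= !in_itv/= => -[/andP[_ g1] /andP[g2 _]].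
    by have := lt_le_trans g2 g1; rewrite ltxx.
have B1 : `|(\int[lam]_(q in `]t, r[%classic) g q ord0 i)%R| < e / 2.
  apply: H1 => //.
    by move=> q Hq; apply: subr_; rewrite E; right.
  move=> q /=; rewrite in_itv/= => /andP[g1 g2]; split; last by move=> qt; rewrite qt ltxx in g1.
  by rewrite ger0_norm; move: g1 g2; rewrite /r; lra.
have B2 : `|v.2 r ord0 i - v.2 t ord0 i| < e / 2.
  by apply: H2 => //; rewrite /r ltr_norml; lra.
move: B1 B2; rewrite !ltr_norml ler_norml; lra.
Qed.

(** With respect to [m = mu + lam], write [mu = rho m] and [Dv = G m]. The set [N] where [rho]
    vanishes is [mu]-null; off [N] the density with respect to [mu] is [G / rho], and on [N] the
    polar decomposition of [G] gives [sig] with density [enorm G] and direction [G / enorm G]. *)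
Lemma DvDec_ex (mu : {measure set R -> \bar R}) (v : Vtype R d) :
  (mu setT < +oo)%E -> inVBV T v -> exists a s sig, DvDec T mu v a s sig.
Proof.
move=> muT Vv; have [lam [g [l0 lT Ig Hg]]] := inVBV_rep Vv.
have mI : measurable (I0T T) by exact: measurable_itv.
have [m Hm] := measure_add_ex mu lam.
have mT : (m setT < +oo)%E by rewrite Hm; exact: lte_add_pinfty.
have [rho [rho0 Irho HR]] : exists f : R -> R, [/\ forall t, 0 <= f t, m.-integrable setT (EFin \o f) &
    forall A, measurable A -> mu A = (\int[m]_(t in A) (f t)%:E)%E].
  apply: RN_ex => // A _; rewrite Hm => /eqP; rewrite padde_eq0 ?measure_ge0//.
  by move=> /andP[/eqP].
have [rho' [rho'0 Irho' HR']] : exists f : R -> R, [/\ forall t, 0 <= f t, m.-integrable setT (EFin \o f) &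
    forall A, measurable A -> lam A = (\int[m]_(t in A) (f t)%:E)%E].
  apply: RN_ex => // A _; rewrite Hm => /eqP; rewrite padde_eq0 ?measure_ge0//.
  by move=> /andP[_ /eqP].
have mrho : measurable_fun setT rho by apply/measurable_EFinP; exact: measurable_int Irho.
have mrho' : measurable_fun setT rho' by apply/measurable_EFinP; exact: measurable_int Irho'.
pose gI i := (fun t => g t ord0 i) \_ (I0T T).
have mgI i : measurable_fun setT (gI i).
  by apply/(measurable_restrictT _ mI); apply/measurable_EFinP; exact: measurable_int (Ig i).
have IgI i : lam.-integrable setT (EFin \o gI i).
  have /(integrable_mkcond _ mI) := Ig i; congr (is_true (lam.-integrable _ _)).
  by apply/funext => t; rewrite /gI /= !patchE; case: ifP.
pose G t : 'rV[R]_d := \row_i (gI i t * rho' t).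
pose Gi i t := gI i t * rho' t.
have mG i : measurable_fun setT (Gi i) by exact: measurable_funM.
have IG i : m.-integrable setT (EFin \o Gi i).
  by apply/(density_integrable lT mT rho'0 Irho' HR' (mgI i) measurableT).
pose N := rho @^-1` [set 0].
have mN : measurable N by rewrite -[N]setTI; exact: mrho.
pose en t := enorm (G t).
have enE t : en t = Num.sqrt (\sum_i Gi i t ^+ 2).
  by rewrite /en /enorm; congr Num.sqrt; apply: eq_bigr => i _; rewrite mxE.
have men : measurable_fun setT en.
  rewrite (_ : en = Num.sqrt \o (fun t => \sum_i Gi i t ^+ 2)); last by apply/funext => t; rewrite enE.
  apply: measurableT_comp; first by apply: continuous_measurable_fun; exact: sqrt_continuous.
  by apply: measurable_sum => i; apply: measurable_funX.
have en0 t : 0 <= en t by rewrite enE sqrtr_ge0.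
pose w t := en t * \1_N t.
have mw : measurable_fun setT w by apply: measurable_funM => //; exact: measurable_indic.
have w0 t : 0 <= w t by rewrite /w mulr_ge0// indicE.
have Iw : m.-integrable setT (EFin \o w).
  have Is : m.-integrable setT (EFin \o (fun t => \sum_i `|Gi i t|)).
    have := integrable_sum measurableT (index_enum 'I_d) (P := xpredT) (fun i _ => integrable_abse (IG i)).
    by apply: eq_integrable => // t _; rewrite /= -sumEFin.
  apply: le_integrable Is => //; first exact/measurable_EFinP.
  move=> t _; rewrite /= lee_fin ger0_norm// ger0_norm ?sumr_ge0//.
  rewrite /w indicE; apply: le_trans (_ : en t <= _).
    by case: (_ \in _); rewrite ?mulr1 ?mulr0.
  by apply: le_trans (enorm_le_sum _) _; apply: ler_sum => i _; rewrite mxE.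
have [sig Hsig] : exists sig : {measure set R -> \bar R}, forall A, sig A = (\int[m]_(t in A) (w t)%:E)%E.
  by apply: density_ex => //; exact/measurable_EFinP.
have sT : (sig setT < +oo)%E.
  rewrite Hsig; case/integrableP : Iw => _; apply: le_lt_trans; rewrite le_eqVlt; apply/orP; left; apply/eqP.
  by apply: eq_integral => t _; rewrite /= ger0_norm.
have HsE A : measurable A -> sig A = (\int[m]_(t in A) (w t)%:E)%E by [].
pose a t : 'rV[R]_d := \row_i (Gi i t / rho t).
pose s t : 'rV[R]_d := \row_i (Gi i t / en t).
have mdiv i (f : R -> R) : measurable_fun setT f -> (forall t, 0 <= f t) -> measurable_fun setT (fun t => Gi i t / f t).
  move=> mf f0; rewrite (_ : (fun t => Gi i t / f t) = (fun t => Gi i t * f t `^ (-1))).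
    by apply: measurable_funM => //; apply: (measurableT_comp (measurable_powR _)).
  by apply/funext => t; rewrite powR_inv1.
have ma i := mdiv i rho mrho rho0; have ms i := mdiv i en men en0.
(* Division by zero yields 0, so multiplying back by the divisor restricts [Gi] to where the divisor
   is nonzero; for [enorm G] this loses nothing, since [Gi] vanishes with it. *)
have arho i t : Gi i t / rho t * rho t = Gi i t * \1_(~` N) t.
  rewrite indicE; have [r0|r0] := eqVneq (rho t) 0.
    by rewrite r0 mulr0 memNset ?mulr0// => /(_ r0).
  by rewrite divfK// mem_set ?mulr1//; exact/eqP.
have sw i t : Gi i t / en t * w t = Gi i t * \1_N t.
  rewrite /w mulrA; congr (_ * _); have [r0|r0] := eqVneq (en t) 0; last by rewrite divfK.
  rewrite r0 mulr0; apply/esym/eqP; rewrite -normr_le0.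
  by have := coord_le_enorm (G t) i; rewrite mxE -/(en t) r0.
have I1 i : m.-integrable setT (EFin \o (fun t => Gi i t / rho t * rho t)).
  apply: eq_integrable (integrableMr (h := \1_(~` N)) measurableT _ _ (IG i)) => //.
  - by move=> t _; rewrite /= arho mulrC.
  - by apply: measurable_indic; exact: measurableC.
  - by apply: (bounded_on (C := 1)) => t _; rewrite indicE; case: (_ \in _); rewrite ?normr1 ?normr0.
have I2 i : m.-integrable setT (EFin \o (fun t => Gi i t / en t * w t)).
  apply: eq_integrable (integrableMr (h := \1_N) measurableT _ _ (IG i)) => //.
  - by move=> t _; rewrite /= sw mulrC.
  - by apply: (bounded_on (C := 1)) => t _; rewrite indicE; case: (_ \in _); rewrite ?normr1 ?normr0.
have Ia i : mu.-integrable setT (EFin \o (fun t => Gi i t / rho t)).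
  by apply/(density_integrable muT mT rho0 Irho HR (ma i) measurableT).
have Is i : sig.-integrable setT (EFin \o (fun t => Gi i t / en t)).
  by apply/(density_integrable sT mT w0 Iw HsE (ms i) measurableT).
exists a, s, sig; split.
  rewrite Hsig; under eq_integral => t.
    rewrite inE /= => It; have -> : w t = 0.
      rewrite /w enE big1 ?sqrtr0 ?mul0r// => i _.
      by rewrite /Gi /gI patchE memNset// mul0r expr0n.
    over.
  by rewrite integral0.
split; first by apply: le_lt_trans sT; apply: le_measure; rewrite ?inE.
split.
  exists N; split => //; split.
    by rewrite HR//; under eq_integral => t do (rewrite inE /N/= => ->); rewrite integral0.
  rewrite Hsig; under eq_integral => t.
    rewrite inE /= => nN; have -> : w t = 0 by rewrite /w indicE memNset// mulr0.
    over.
  by rewrite integral0.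
split.
  move=> i; apply: (integrableS (measurableT : measurable setT)) => //.
  by apply: eq_integrable (Ia i) => // t _; rewrite /= mxE.
split.
  move=> i; apply: (integrableS (measurableT : measurable setT)) => //.
  by apply: eq_integrable (Is i) => // t _; rewrite /= mxE.
split.
  have mZ : measurable (en @^-1` [set 0]) by rewrite -[X in measurable X]setTI; exact: men.
  exists (en @^-1` [set 0]); split => //.
    rewrite Hsig; under eq_integral => t.
      rewrite inE /= => e0; have -> : w t = 0 by rewrite /w e0 mul0r.
      over.
    by rewrite integral0.
  move=> t /= /not_implyP[_]; apply: contra_notP => /eqP e0.
  rewrite /enorm (eq_bigr (fun i => Gi i t ^+ 2 / en t ^+ 2)); last first.
    by move=> i _; rewrite mxE expr_div_n.
  rewrite -mulr_suml.
  have -> : \sum_i Gi i t ^+ 2 = en t ^+ 2 by rewrite enE sqr_sqrtr// sumr_ge0// => i _; exact: sqr_ge0.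
  by rewrite divff ?sqrtr1// expf_neq0.
move=> t i It.
have sub : Icc0 t `<=` I0T T.
  move: It; rewrite /Icc0 /I0T/= !in_itv/= => /andP[_ tT] r /=.
  by rewrite !in_itv/= => /andP[-> /le_trans]; apply.
have mt : measurable (Icc0 t) by exact: measurable_itv.
under eq_integral do rewrite mxE; under [X in (_ + X)%E]eq_integral do rewrite mxE.
rewrite (density_int muT mT rho0 Irho HR (ma i) mt) (density_int sT mT w0 Iw HsE (ms i) mt).
rewrite -integralD//; [|exact: integrableS (I1 i)|exact: integrableS (I2 i)].
rewrite Hg// EFin_Rintegral//; last exact: integrableS (Ig i).
transitivity (\int[lam]_(r in Icc0 t) (gI i r)%:E)%E.
  by apply: eq_integral => r; rewrite inE => /sub rI; rewrite /gI patchE mem_set.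
rewrite (density_int lT mT rho'0 Irho' HR' (mgI i) mt); apply: eq_integral => r _.
rewrite arho sw -EFinD -mulrDr !indicE in_setC; congr EFin.
by case: (_ \in N); rewrite /= ?add0r ?addr0 mulr1.
Qed.

End Decomposition.

(** * Integrals of extended real functions and exchange of suprema *)

Section Integrals.
Context {R : realType}.
Implicit Types (m : {measure set R -> \bar R}) (D : set R) (f : R -> \bar R) (g : R -> R).

Lemma eintE m D f : eint m D f =
  if (\int[m]_(t in D) f^\+ t < +oo)%E then (\int[m]_(t in D) f t)%E else +oo%E.
Proof. by rewrite /eint; under eq_integral do rewrite -funeposE. Qed.

Lemma eint_integrable m D f : measurable D -> m.-integrable D f -> eint m D f = (\int[m]_(t in D) f t)%E.
Proof.
move=> mD If; rewrite eintE ifT//.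
have := integrable_pos_fin_num mD If; by rewrite fin_numE => /andP[_]; rewrite ltey.
Qed.

Lemma integrable_eint m D f : measurable D -> measurable_fun D f -> (eint m D f < +oo)%E ->
  eint m D f != -oo%E -> m.-integrable D f.
Proof.
move=> mD mf; rewrite eintE; case: ifP => [fp _|//]; rewrite integralE => fN.
have p0 : (0 <= \int[m]_(x in D) f^\+ x)%E by apply: integral_ge0.
have n0 : (0 <= \int[m]_(x in D) f^\- x)%E by apply: integral_ge0.
have fn : (\int[m]_(x in D) f^\- x < +oo)%E.
  rewrite ltey; apply: contra fN => /eqP ->.
  by have : (\int[m]_(x in D) f^\+ x < +oo)%E by []; case: (\int[m]_(x in D) f^\+ x)%E.
apply/integrableP; split => //.
under eq_integral do rewrite -/((abse \o f) _) fune_abse.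
rewrite ge0_integralD//; first exact: lte_add_pinfty.
- exact: measurable_funepos.
- exact: measurable_funeneg.
Qed.

(** Subtracting an integrable minorant reduces [eint] to the integral of a nonnegative function,
    where monotone convergence applies; the value [+oo] of [eint] corresponds to an infinite
    integral of the difference. *)
Lemma eint_split m D f g : measurable D -> measurable_fun D f -> m.-integrable D (EFin \o g) ->
  (forall t, D t -> ((g t)%:E <= f t)%E) ->
  eint m D f = (\int[m]_(t in D) (f t - (g t)%:E) + \int[m]_(t in D) (g t)%:E)%E.
Proof.
move=> mD mf Ig gf.
have mg : measurable_fun D (EFin \o g) by exact: measurable_int Ig.
have mF : measurable_fun D (fun t => f t - (g t)%:E)%E by exact: emeasurable_funB.
have F0 t : D t -> (0 <= f t - (g t)%:E)%E by move=> Dt; rewrite sube_ge0 ?gf.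
have p0 : (0 <= \int[m]_(x in D) (f x - (g x)%:E))%E by exact: integral_ge0.
have [fin|] := ltP (\int[m]_(t in D) (f t - (g t)%:E))%E (+oo)%E.
  have IF : m.-integrable D (fun t => f t - (g t)%:E)%E.
    apply/integrableP; split => //; apply: le_lt_trans fin; rewrite le_eqVlt; apply/orP; left; apply/eqP.
    by apply: eq_integral => t; rewrite inE => /F0 /gee0_abs.
  have If : m.-integrable D f.
    apply: eq_integrable (integrableD mD IF Ig) => // t; rewrite inE => Dt /=.
    by rewrite EFinN subeK.
  rewrite eint_integrable// -integralD//; apply: eq_integral => t _ /=.
  by rewrite EFinN subeK.
rewrite leye_eq => /eqP E; rewrite E addye; last first.
  by have := integrable_fin_num mD Ig; rewrite fin_numE => /andP[].
rewrite eintE; case: ifP => // fp; exfalso.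
suff : (\int[m]_(t in D) (f t - (g t)%:E) < +oo)%E by rewrite E.
apply: (@le_lt_trans _ _ (\int[m]_(t in D) (f^\+ t + `|(g t)%:E|))%E).
  apply: ge0_le_integral => //.
  - by apply: emeasurable_funD; [exact: measurable_funepos|exact: measurableT_comp].
  - move=> t Dt; apply: leeD; first by rewrite funeposE le_max lexx.
    by rewrite -EFinN lee_fin -normrN ler_norm.
rewrite ge0_integralD//.
- apply: lte_add_pinfty => //; by case/integrableP : Ig.
- exact: measurable_funepos.
- exact: measurableT_comp.
Qed.

Lemma eint_lb_integrable m D (f phi : R -> \bar R) : measurable D -> measurable_fun D f ->
  m.-integrable D phi -> (forall t, D t -> (phi t <= f t)%E) -> (eint m D f < +oo)%E ->
  m.-integrable D f.
Proof.
move=> mD mf Ip pf fy; apply: integrable_eint => //; move: fy; rewrite eintE.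
case: ifP => // fp _; rewrite integralE.
have fn : (\int[m]_(x in D) f^\- x < +oo)%E.
  apply: (@le_lt_trans _ _ (\int[m]_(x in D) phi^\- x)%E).
    apply: ge0_le_integral => //; [exact: measurable_funeneg|apply: measurable_funeneg; exact: measurable_int Ip|].
    by move=> t Dt; rewrite !funenegE ge_max !le_max lexx orbT leeN2 pf.
  by have := integrable_neg_fin_num mD Ip; rewrite fin_numE => /andP[_]; rewrite ltey.
have p0 : (0 <= \int[m]_(x in D) f^\+ x)%E by apply: integral_ge0.
have n0 : (0 <= \int[m]_(x in D) f^\- x)%E by apply: integral_ge0.
by move: fp fn p0 n0; case: (\int[m]_(x in D) f^\+ x)%E; case: (\int[m]_(x in D) f^\- x)%E.
Qed.

Lemma eint_ge m D (f phi : R -> \bar R) : measurable D -> measurable_fun D f ->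
  m.-integrable D phi -> (forall t, D t -> (phi t <= f t)%E) ->
  (\int[m]_(t in D) phi t <= eint m D f)%E.
Proof.
move=> mD mf Ip pf; have [fy|] := ltP (eint m D f) +oo%E; last by rewrite leye_eq => /eqP ->; exact: leey.
have If := eint_lb_integrable mD mf Ip pf fy.
by rewrite eint_integrable//; apply: le_integral => // t; rewrite inE => /pf.
Qed.

Lemma eint_eq_ae m D (f phi : R -> \bar R) : measurable D -> measurable_fun D f ->
  m.-integrable D phi -> (forall t, D t -> (phi t <= f t)%E) ->
  (eint m D f <= \int[m]_(t in D) phi t)%E -> \forall t \ae m, D t -> f t = phi t.
Proof.
move=> mD mf Ip pf le; have Pfin := integrable_fin_num mD Ip.
have fy : (eint m D f < +oo)%E by apply: le_lt_trans le _; rewrite ltey; case: (\int[m]_(t in D) phi t)%E Pfin.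
have If := eint_lb_integrable mD mf Ip pf fy; move: le; rewrite eint_integrable// => le.
have mF : measurable_fun D (fun t => f t - phi t)%E.
  by apply: emeasurable_funB => //; exact: measurable_int Ip.
have B0 : (\int[m]_(t in D) `|f t - phi t|)%E = 0.
  have F0 : \forall t \ae m, D t -> (0 <= f t - phi t)%E.
    move: (integrable_ae mD Ip); apply: filterS => t Ht Dt; rewrite sube_ge0 ?pf//.
    by rewrite Ht ?orbT.
  transitivity (\int[m]_(t in D) (f t - phi t))%E.
    apply: ae_eq_integral => //; first exact: measurableT_comp.
    by move: F0; apply: filterS => t Ht Dt; apply/gee0_abs/Ht.
  rewrite integralB//; apply/eqP; rewrite eq_le sube_le0 le/=.
  by rewrite sube_ge0 ?Pfin ?orbT//; apply: le_integral => // t; rewrite inE => /pf.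
have := (ae_eq_integral_abs m mD mF).1 B0; move: (integrable_ae mD Ip); apply: filterS2 => t Ht H Dt.
by rewrite -[LHS](@subeK _ _ (phi t)) ?Ht// H// add0e.
Qed.

Fixpoint runmax (f : nat -> R -> R) (n : nat) (t : R) : R :=
  if n is k.+1 then Num.max (runmax f k t) (f k.+1 t) else f 0%N t.

Lemma runmax_ge (f : nat -> R -> R) n t : f n t <= runmax f n t.
Proof. by case: n => [|n] /=; rewrite ?le_max lexx ?orbT. Qed.

Lemma runmax_nd (f : nat -> R -> R) t n k : (n <= k)%N -> runmax f n t <= runmax f k t.
Proof.
move=> /subnK <-; elim: (k - n)%N => // j IH; rewrite addSn /=.
by apply: le_trans IH _; rewrite le_max lexx.
Qed.

Lemma integrable_max m D (f g : R -> R) : measurable D -> m.-integrable D (EFin \o f) ->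
  m.-integrable D (EFin \o g) -> m.-integrable D (EFin \o (fun t => Num.max (f t) (g t))).
Proof.
move=> mD If Ig; have I := integrableD mD (integrable_abse If) (integrable_abse Ig).
apply: le_integrable I => //.
  apply/measurable_EFinP; apply: measurable_maxr; apply/measurable_EFinP.
    exact: measurable_int If.
  exact: measurable_int Ig.
move=> t _ /=; rewrite lee_fin [leRHS]ger0_norm ?addr_ge0//.
by rewrite /Num.max; case: ifP => _; rewrite ?lerDl ?lerDr.
Qed.

Lemma integrable_runmax m D (f : nat -> R -> R) : measurable D -> (forall n, m.-integrable D (EFin \o f n)) ->
  forall n, m.-integrable D (EFin \o runmax f n).
Proof. by move=> mD If; elim => [|n IH] //=; apply: integrable_max. Qed.

(** Monotone convergence for [runmax f n - f 0], whose limit is almost everywhere at least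
    [F - f 0]. The supremum over [n] is expressed through its upper bounds [b], which is the form in
    which [conjv_qint] and [support_qint] deliver it. *)
Lemma eint_runmax m D (F : R -> \bar R) (f : nat -> R -> R) (al : R) :
  measurable D -> measurable_fun D F -> (forall n, m.-integrable D (EFin \o f n)) ->
  (forall t, D t -> ((f 0%N t)%:E <= F t)%E) ->
  (\forall t \ae m, D t -> forall b, (forall n, ((f n t)%:E <= b)%E) -> (F t <= b)%E) ->
  (al%:E < eint m D F)%E -> exists n, al < (\int[m]_(t in D) runmax f n t)%R.
Proof.
move=> mD mF If fF H alF; apply/not_existsP => A.
have IM := integrable_runmax mD If.
have {}A n : (\int[m]_(t in D) runmax f n t)%R <= al by rewrite leNgt; apply/negP/A.
pose G n t := (runmax f n t - f 0%N t)%:E.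
have G0 n t : D t -> (0 <= G n t)%E by move=> _; rewrite lee_fin subr_ge0; exact: (@runmax_nd f t 0%N n).
have mG n : measurable_fun D (G n).
  by apply/measurable_EFinP; apply: measurable_funB; apply/measurable_EFinP;
    [exact: measurable_int (IM n)|exact: measurable_int (If 0%N)].
have ndG t : D t -> {homo G^~ t : n k / (n <= k)%N >-> (n <= k)%E}.
  by move=> _ n k nk; rewrite lee_fin lerD2r runmax_nd.
have cG t : D t -> cvgn (G^~ t) by move=> Dt; apply: ereal_nondecreasing_is_cvgn => n k; exact: ndG.
have C := @cvg_monotone_convergence _ _ _ m D mD _ mG G0 ndG.
have E n : (\int[m]_(t in D) G n t = ((\int[m]_(t in D) runmax f n t)%R - (\int[m]_(t in D) f 0%N t)%R)%:E)%E.
  rewrite -RintegralB// EFin_Rintegral//; exact: (integrableB mD (IM n) (If 0%N)).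
have B : (\int[m]_(t in D) limn (G^~ t) <= (al - (\int[m]_(t in D) f 0%N t)%R)%:E)%E.
  rewrite -(cvg_lim _ C)//; apply: lime_le; first by apply/cvg_ex; eexists; exact: C.
  by apply: nearW => n; rewrite E lee_fin lerD2r.
move: alF; rewrite (eint_split mD mF (If 0%N) fF) -EFin_Rintegral//; apply/negP; rewrite -leNgt.
rewrite -leeBrDr//; apply: le_trans B; apply: ae_ge0_le_integral => //.
- by move=> t Dt; rewrite sube_ge0 ?fF.
- by apply: emeasurable_funB => //; exact: measurable_int (If 0%N).
- move=> t Dt; apply: (le_trans (G0 0%N t Dt)).
  by apply: lime_ge (cG t Dt) _; apply: nearW => n; exact: ndG.
- apply: (emeasurable_fun_cvg G) => // t Dt; exact: cG.
move: H; apply: filterS => t Ht Dt; rewrite leeBlDr//; apply: Ht => // n.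
apply: (@le_trans _ _ (G n t + (f 0%N t)%:E)%E).
  by rewrite /G -EFinD subrK lee_fin runmax_ge.
rewrite leeD2r//; apply: lime_ge (cG t Dt) _; near=> k; apply: ndG => //.
near: k; exact: nbhs_infty_ge.
Unshelve. all: by end_near. Qed.

End Integrals.

(** * Exchange of supremum and integral by gluing *)

Section Exchange.
Context {R : realType} (T : R).
Hypothesis T0 : 0 < T.
Implicit Types (m : {measure set R -> \bar R}).

(** The sets approximable by members of [AA] form a sigma-algebra: symmetric differences are
    unchanged by complements, errors add under unions, and countable unions are exhausted by finite
    ones since [m] is finite. Intervals []s, p]] belong to it after clamping their ends, because [m]
    is carried by []0, T]]. *)
Lemma algebra_approx m (AA : set (set R)) : (m setT < +oo)%E -> m (~` `]0, T]%classic) = 0%E ->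
  (forall A, AA A -> measurable A) -> (forall A, AA A -> AA (~` A)) ->
  (forall A B, AA A -> AA B -> AA (A `|` B)) ->
  (forall s p : R, 0 <= s -> s <= p -> p <= T -> AA `]s, p]%classic) ->
  forall B e, measurable B -> 0 < e -> exists2 A, AA A & (m ((A `\` B) `|` (B `\` A)) < e%:E)%E.
Proof.
move=> mT m0 mAA AAC AAU AAI.
pose GG := [set B : set R | measurable B /\
  forall e : R, 0 < e -> exists2 A, AA A & (m ((A `\` B) `|` (B `\` A)) < e%:E)%E].
have mD (A B : set R) : measurable A -> measurable B -> measurable ((A `\` B) `|` (B `\` A)).
  by move=> mA mB; apply: measurableU; apply: measurableD.
have GGC B : GG B -> GG (~` B).
  move=> [mB H]; split; first exact: measurableC.
  move=> e e0; have [A AA_ lt] := H e e0; exists (~` A); first exact: AAC.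
  apply: le_lt_trans lt; rewrite le_measure// ?inE; [|by apply: mD => //; exact: mAA|].
    by apply: mD; apply: measurableC => //; exact: mAA.
  by move=> t [] /= [h1 h2]; [right|left]; split => //; apply: contrapT.
have GGle (A B F : set R) (a b : R) : (m A < a%:E)%E -> (m B < b%:E)%E ->
    measurable A -> measurable B -> measurable F -> F `<=` A `|` B -> (m F < (a + b)%:E)%E.
  move=> lA lB mA mB mF sub.
  apply: (@le_lt_trans _ _ (m (A `|` B))); first by rewrite le_measure// ?inE//; exact: measurableU.
  apply: le_lt_trans (measureU2 _ mA mB) _; rewrite EFinD; exact: lteD.
have GGU B C : GG B -> GG C -> GG (B `|` C).
  move=> [mB HB] [mC HC]; split; first exact: measurableU.
  move=> e e0; have e2 : 0 < e / 2 by lra.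
  have [A AA1 l1] := HB _ e2; have [E AA2 l2] := HC _ e2.
  exists (A `|` E); first exact: AAU.
  have -> : e = e / 2 + e / 2 by lra.
  apply: (GGle _ _ _ _ _ l1 l2) => //.
  - by apply: mD => //; exact: mAA.
  - by apply: mD => //; exact: mAA.
  - by apply: mD; apply: measurableU => //; exact: mAA.
  - move=> t [] /= [h1 h2]; last by move: h1 h2 => [] ? ?; [left; right|right; right]; split => // ?; tauto.
    by move: h1 h2 => [] ? ?; [left; left|right; left]; split => // ?; tauto.
have GG0 : GG set0.
  split; first exact: measurable0.
  move=> e e0; exists `]0, 0]%classic; first by apply: AAI => //; exact: ltW.
  by rewrite set_itvoc0 !set0D setU0 measure0 lte_fin.
have GGI (s p : R) : GG `]s, p]%classic.
  split; first exact: measurable_itv.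
  move=> e e0; pose s' := clamp 0 T s; pose p' := clamp 0 T p.
  have [ps|sp] := ltP p s.
    exists `]0, 0]%classic; first by apply: AAI => //; exact: ltW.
    rewrite set_itvoc0 set_itv_ge ?bnd_simp -?leNgt ?ltW//.
    by rewrite !set0D setU0 measure0 lte_fin.
  have := clamp_in s (ltW T0); have := clamp_in p (ltW T0); rewrite !in_itv/= => /andP[p0 pT] /andP[s0 sT].
  exists `]s', p']%classic; first by apply: AAI => //; exact: clamp_nd.
  apply: (@le_lt_trans _ _ (m (~` `]0, T]%classic))); last by rewrite m0 lte_fin.
  rewrite le_measure// ?inE//; first by apply: mD; exact: measurable_itv.
    by apply: measurableC; exact: measurable_itv.
  move=> t h; rewrite /= in_itv/= => /andP[t0 tT]; move: h; rewrite /= !in_itv/= /s' /p' /clamp.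
  by rewrite !gt_max !le_max !gt_min !le_min t0 tT (leNgt t 0) t0 (ltNge T t) tT/= !orbF ?andbT; tauto.
have sub : <<s @ocitv R >> `<=` GG.
  apply: smallest_sub; last by move=> X /ocitvP[->|[[a b] _ ->]].
  split => //; first by move=> A GA; rewrite setTD; exact: GGC.
  move=> F GF; have mF k : measurable (F k) by case: (GF k).
  pose U n := \big[setU/set0]_(k < n) F k.
  have GU n : GG (U n) by elim: n => [|n IH]; rewrite /U ?big_ord0 ?big_ord_recr//=; exact: GGU.
  have mU n : measurable (U n) by case: (GU n).
  have mFU : measurable (\bigcup_k F k) by exact: bigcupT_measurable.
  split => // e e0; have e2 : 0 < e / 2 by lra.
  pose V n := (\bigcup_k F k) `\` U n.
  have Vc : m (V n) @[n --> \oo] --> m (\bigcap_n V n).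
    apply: nonincreasing_cvg_mu.
    - by apply: le_lt_trans mT; rewrite le_measure// ?inE//; exact: measurableD.
    - by move=> n; exact: measurableD.
    - by apply: bigcapT_measurable => n; exact: measurableD.
    - move=> n k nk; apply/subsetPset => t [h1 h2]; split => // h; apply: h2.
      by move: h; rewrite /U -!bigcup_mkord => -[j /= jn Fj]; exists j => //=; exact: leq_trans nk.
  have V0 : \bigcap_n V n = set0.
    apply/seteqP; split => // t h; have [[k _ Fk] _] := h 0%N I.
    by have [_] := h k.+1 I; apply; rewrite /U -bigcup_mkord; exists k => //=.
  rewrite V0 measure0 in Vc.
  have [n _ Hn] : \forall n \near \oo, (m (V n) < (e / 2)%:E)%E.
    move: Vc => /(_ [set y | (y < (e / 2)%:E)%E]) H; apply: H.
    by apply: open_nbhs_nbhs; split; [exact: open_ereal_lt_ereal|rewrite /= lte_fin].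
  have [_ /(_ _ e2) [A AA1 l1]] := GU n.
  exists A => //; have -> : e = e / 2 + e / 2 by lra.
  apply: (GGle _ _ _ _ _ l1 (Hn n (leqnn n))) => //.
  - by apply: mD => //; exact: mAA.
  - exact: measurableD.
  - by apply: mD => //; exact: mAA.
  - move=> t [] /= [h1 h2]; last by have [h|h] := pselect (U n t); [left; right|right; split].
    left; left; split => // h; apply: h2; move: h; rewrite /U -bigcup_mkord => -[j _ Fj].
    by exists j.
by move=> B e /sub [_]; apply.
Qed.

Context {V : Type}.
Variables (m : {measure set R -> \bar R}) (ZZ : set (R -> V)) (psi : R -> V -> R).
Hypothesis m0 : m [set 0] = 0%E.
Hypothesis Zglue : forall z1 z2 (s p : R), ZZ z1 -> ZZ z2 -> 0 <= s -> s <= p -> p <= T ->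
  ZZ (fun t => if s < t <= p then z1 t else z2 t).
Hypothesis Ipsi : forall z, ZZ z -> m.-integrable (I0T T) (EFin \o (fun t => psi t (z t))).

(* The set where [z1] does better is approximated by finite unions of intervals. *)
Lemma exchange2 z1 z2 (e : R) : ZZ z1 -> ZZ z2 -> 0 < e -> exists2 z, ZZ z &
  (forall t, psi t (z t) <= Num.max (psi t (z1 t)) (psi t (z2 t))) /\
  (\int[m]_(t in I0T T) Num.max (psi t (z1 t)) (psi t (z2 t)))%R - e <=
    (\int[m]_(t in I0T T) psi t (z t))%R.
Proof.
move=> Z1 Z2 e0; have mI : measurable (I0T T) by exact: measurable_itv.
have I1 := Ipsi Z1; have I2 := Ipsi Z2.
pose f t := psi t (z1 t) - psi t (z2 t).
have If : m.-integrable (I0T T) (EFin \o f) by exact: (integrableB mI I1 I2).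
have mf : measurable_fun (I0T T) f by apply/measurable_EFinP; exact: measurable_int If.
(* [k] has density [|psi t (z1 t) - psi t (z2 t)|]: gluing along [A] instead of the ideal set [B]
   costs exactly the [k]-mass of their symmetric difference. *)
have [k [kT Hk]] := abs_density_ex mI If.
pose glue (A : set R) (y1 y2 : R -> V) t := if t \in A then y1 t else y2 t.
(* Requiring gluing for all pairs makes [AA] an algebra: a complement swaps the two functions, a
   union glues twice. *)
pose AA := [set A : set R | measurable A /\ forall y1 y2, ZZ y1 -> ZZ y2 -> ZZ (glue A y1 y2)].
have k0 : k (~` `]0, T]%classic) = 0%E.
  have mo : measurable (~` `]0, T]%classic) by apply: measurableC; exact: measurable_itv.
  rewrite Hk//; apply: null_set_integral.
  - exact: measurableI.
  - apply: (measurable_funS mI); first by move=> t [].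
    by apply/measurable_EFinP; apply: measurableT_comp.
  - apply: (subset_measure0 _ _ _ m0) => //; first exact: measurableI.
    move=> t []; rewrite /I0T /= !in_itv/= => h /andP[t0 tT]; apply/eqP.
    by rewrite eq_le t0 andbT leNgt; apply/negP => h'; apply: h; rewrite h' tT.
pose B := I0T T `&` f @^-1` [set r | 0 <= r].
have mB : measurable B.
  apply: mf => //; rewrite (_ : [set r | _] = `[0, +oo[%classic)//.
  by apply/seteqP; split => r; rewrite /= in_itv/= andbT.
have [A [mA GA] lt] : exists2 A, AA A & (k ((A `\` B) `|` (B `\` A)) < e%:E)%E.
  apply: (@algebra_approx k AA kT k0) => //.
  - by move=> A [].
  - move=> A [mA H]; split; first exact: measurableC.
    move=> y1 y2 Y1 Y2; have := H _ _ Y2 Y1; congr ZZ; apply/funext => t.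
    by rewrite /glue in_setC; case: (t \in A).
  - move=> A E [mA HA] [mE HE]; split; first exact: measurableU.
    move=> y1 y2 Y1 Y2; have := HA _ _ Y1 (HE _ _ Y1 Y2); congr ZZ; apply/funext => t.
    by rewrite /glue in_setU; case: (t \in A).
  - move=> s p s0 sp pT; split; first exact: measurable_itv.
    move=> y1 y2 Y1 Y2; have := Zglue Y1 Y2 s0 sp pT; congr ZZ; apply/funext => t.
    by rewrite /glue mem_setE in_itv.
exists (glue A z1 z2); first exact: GA.
split.
  by move=> t; rewrite /glue; case: ifP => _; rewrite le_max lexx ?orbT.
have ZA := GA _ _ Z1 Z2; have IA := Ipsi ZA.
have IM := integrable_max mI I1 I2.
rewrite lerBlDr -lerBlDl -RintegralB//.
set S := _ `|` _ in lt.
have mS : measurable S by apply: measurableU; apply: measurableD.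
rewrite -lee_fin; apply: le_trans (ltW lt); rewrite EFin_Rintegral//; last exact: (integrableB mI IM IA).
rewrite Hk// integral_mkcondl le_eqVlt; apply/orP; left; apply/eqP.
apply: eq_integral => t; rewrite inE => It; rewrite patchE /S in_setU !in_setD /B in_setI (mem_set It) /=.
have -> : (t \in f @^-1` [set r | 0 <= r]) = (psi t (z2 t) <= psi t (z1 t)).
  by rewrite -subr_ge0; apply/idP/idP; rewrite inE.
rewrite /glue; case: (leP (psi t (z2 t)) (psi t (z1 t))) => h; case: (t \in A); rewrite /= ?subrr// /f.
  by rewrite ger0_norm// subr_ge0.
by rewrite ltr0_norm ?opprB// subr_lt0.
Qed.

Lemma exchange (z : nat -> R -> V) n (e : R) : (forall k, ZZ (z k)) -> 0 < e -> exists2 y, ZZ y &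
  (forall t, psi t (y t) <= runmax (fun k t => psi t (z k t)) n t) /\
  (\int[m]_(t in I0T T) runmax (fun k t => psi t (z k t)) n t)%R - e <=
    (\int[m]_(t in I0T T) psi t (y t))%R.
Proof.
move=> Zz; have mI : measurable (I0T T) by exact: measurable_itv.
elim: n e => [|n IH] e e0; first by exists (z 0%N) => //; split => //; rewrite lerBlDr lerDl ltW.
have e2 : 0 < e / 2 by lra.
have [y Zy [yle Hy]] := IH _ e2; have [w Zw [wle Hw]] := exchange2 Zy (Zz n.+1) e2.
have IR := integrable_runmax mI (fun k => Ipsi (Zz k)) n.
have I1 := integrable_max mI (Ipsi Zy) (Ipsi (Zz n.+1)).
have I2 := integrable_max mI IR (Ipsi (Zz n.+1)).
exists w => //; split.
  move=> t; apply: le_trans (wle t) _; rewrite /= ge_max !le_max yle lexx ?orbT//.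
(* Taking the maximum with a fixed number is nonexpansive, so replacing the running maximum by
   [psi t (y t)] loses at most what was lost at the previous stage. *)
have : (\int[m]_(t in I0T T) (Num.max (runmax (fun k t => psi t (z k t)) n t) (psi t (z n.+1 t)) -
    Num.max (psi t (y t)) (psi t (z n.+1 t))))%R <=
  (\int[m]_(t in I0T T) (runmax (fun k t => psi t (z k t)) n t - psi t (y t)))%R.
  apply: le_Rintegral => //.
  - exact: (integrableB mI I2 I1).
  - exact: (integrableB mI IR (Ipsi Zy)).
  move=> t _; have := yle t; set a := runmax _ _ _; set b := psi t (y t); set c := psi _ _ => ba.
  by have [?|?] := leP a c; have [?|?] := leP b c; lra.
rewrite !RintegralB//; [|exact: (Ipsi Zy)].
move: Hy Hw => /=; lra.
Qed.

End Exchange.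

(** * Normal integrands *)

Section MeasurableSets.
Context {R : realType} (D : set R).
Hypothesis mD : measurable D.
Implicit Types P Q : R -> Prop.

Lemma meas_ex (I : countType) (P : I -> R -> Prop) :
  (forall i, measurable (D `&` [set t | P i t])) ->
  measurable (D `&` [set t | exists i, P i t]).
Proof.
move=> H; rewrite (_ : _ `&` _ = \bigcup_i (D `&` [set t | P i t])).
  by apply: countable_bigcupT_measurable => //; exact: countableP.
apply/seteqP; split => t; first by move=> [Dt [i Pi]]; exists i.
by move=> [i _ [Dt Pi]]; split => //; exists i.
Qed.

Lemma meas_not P : measurable (D `&` [set t | P t]) -> measurable (D `&` [set t | ~ P t]).
Proof.
move=> H; rewrite (_ : _ `&` _ = D `\` (D `&` [set t | P t])); first exact: measurableD.
by apply/seteqP; split => t [Dt /= nP]; split => //; [case|move=> Pt; exact: nP].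
Qed.

Lemma meas_all (I : countType) (P : I -> R -> Prop) :
  (forall i, measurable (D `&` [set t | P i t])) ->
  measurable (D `&` [set t | forall i, P i t]).
Proof.
move=> H; have := meas_not (meas_ex (fun i => meas_not (H i))); congr (measurable (_ `&` _)).
by apply/seteqP; split => t /=; [move=> + i; apply: contra_notP => ?; exists i|move=> H' [i]; exact].
Qed.

Lemma meas_and P Q : measurable (D `&` [set t | P t]) -> measurable (D `&` [set t | Q t]) ->
  measurable (D `&` [set t | P t /\ Q t]).
Proof.
move=> mP mQ; rewrite (_ : _ `&` _ = (D `&` [set t | P t]) `&` (D `&` [set t | Q t])).
  exact: measurableI.
by apply/seteqP; split => t /=; tauto.
Qed.

Lemma meas_imply P Q : measurable (D `&` [set t | P t]) -> measurable (D `&` [set t | Q t]) ->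
  measurable (D `&` [set t | P t -> Q t]).
Proof.
move=> mP mQ; have := meas_not (meas_and mP (meas_not mQ)); congr (measurable (_ `&` _)).
by apply/seteqP; split => t /=; have [] := pselect (Q t); have [] := pselect (P t); tauto.
Qed.

Lemma meas_lt (f g : R -> R) : measurable_fun D f -> measurable_fun D g ->
  measurable (D `&` [set t | f t < g t]).
Proof.
move=> mf mg; have := measurable_funB mg mf mD (measurable_itv `]0, +oo[%R).
congr (measurable (_ `&` _)); apply/seteqP; split => t;
  by rewrite /= in_itv/= andbT subr_gt0.
Qed.

Lemma measurable_gt (f : R -> \bar R) :
  (forall c : R, measurable (D `&` [set t | (c%:E < f t)%E])) -> measurable_fun D f.
Proof.
move=> H; apply: (measurability _ (ErealGenOInfty.measurableE R)) => _ [_ [c ->] <-].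
by have := H c; congr measurable; apply/seteqP; split => t [Dt]; rewrite /= in_itv/= andbT => ?.
Qed.

Lemma meas_gt (f : R -> \bar R) (c : R) : measurable_fun D f ->
  measurable (D `&` [set t | (c%:E < f t)%E]).
Proof.
move=> mf; have := mf mD _ (emeasurable_itv `]c%:E, +oo[%O); congr (measurable (_ `&` _)).
by apply/seteqP; split => t; rewrite /= in_itv/= andbT.
Qed.

Lemma meas_lty (f : R -> \bar R) : measurable_fun D f ->
  measurable (D `&` [set t | (f t < +oo)%E]).
Proof.
move=> mf; have := mf mD _ (emeasurable_itv `]-oo, +oo%E[%O); congr (measurable (_ `&` _)).
Qed.

End MeasurableSets.

Section NormalIntegrand.
Context {R : realType} (T : R) (d : nat).
Implicit Types (x y z : R -> 'rV[R]_d) (g : R -> 'rV[R]_d -> \bar R).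
Variable h : R -> 'rV[R]_d -> \bar R.
Hypothesis hh : normal_integrand T h.
Let mI : measurable (I0T T). Proof. exact: measurable_itv. Qed.
Let V := 'rV[R]_d.

Lemma open_cube (w : V) e : open (cube w e).
Proof.
rewrite openE => u uc; apply: (@filter_forall _ _ _ (nbhs u)) => i.
have h0 : 0 < e - `|u ord0 i - w ord0 i| by rewrite subr_gt0; exact: uc.
apply: filterS (nbhs_cube u h0) => y /(_ i) yu; rewrite /= -(subrKA (u ord0 i)).
by apply: le_lt_trans (ler_normD _ _) _; rewrite -ltrBrDr.
Qed.

Lemma nbhs_pair (w : V) (b : R) (A : set (V * R)) : nbhs (w, b) A ->
  exists2 e, 0 < e & forall u r, cube w e u -> `|r - b| < e -> A (u, r).
Proof.
move=> [[B C] /= [/nbhs_cubeP[e e0 eB] /nbhs_ballP[r /= r0 rC]] H].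
exists (Num.min e r); first by rewrite lt_min e0.
move=> u c cu cb; apply: H; split => /=.
  by apply: eB => i; apply: (lt_le_trans (cu i)); rewrite ge_min lexx.
apply: rC; rewrite /ball /= distrC; apply: (lt_le_trans cb); by rewrite ge_min lexx orbT.
Qed.

Definition box (w : V) (b e : R) : set (V * R) := [set p | cube w e p.1 /\ `|p.2 - b| < e].

Lemma open_box (w : V) (b e : R) : open (box w b e).
Proof.
rewrite (_ : box w b e = (fst @^-1` cube w e) `&` (snd @^-1` ball b e)); last first.
  by apply/seteqP; split => p [? k]; split => //; move: k; rewrite /ball/= distrC.
apply: openI.
  by apply: open_comp; [move=> p _; exact: cvg_fst|exact: open_cube].
by apply: open_comp; [move=> p _; exact: cvg_snd|rewrite -ball_normE; exact: ball_open].
Qed.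

(* As [epi (h t)] is closed, [h t (x t) <= c] iff [epi (h t)] meets every rational box around
   [(x t, c)]. *)
Lemma measurable_integrand x : (forall i, measurable_fun (I0T T) (fun t => x t ord0 i)) ->
  measurable_fun (I0T T) (fun t => h t (x t)).
Proof.
move=> mx; have [_ [hcl hms]] := hh.
apply: measurable_gt => // c.
have rn0 n : 0 < (n.+1%:R^-1 : R) by rewrite invr_gt0.
pose O q n := box (qvec q) c n.+1%:R^-1.
pose P n (q : 'rV[rat]_d) t := (forall i, `|x t ord0 i - qvec q ord0 i| < n.+1%:R^-1) /\
  epi (h t) `&` O q n !=set0.
have : measurable (I0T T `&` [set t | ~ forall n, exists q, P n q t]).
  apply: meas_not => //; apply: meas_all => // n; apply: meas_ex => q; apply: meas_and.
    apply: meas_all => // i; apply: meas_lt => //; apply: measurableT_comp => //.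
    exact: measurable_funB.
  by rewrite setIC; apply: hms; exact: open_box.
congr measurable; apply/seteqP; split => t [It].
  move=> A; split => //=; rewrite ltNge; apply/negP => le; apply: A => n.
  have [q qx] := qvec_dense (x t) (rn0 n); exists q; split => [i|].
    by have := qx i; rewrite distrC.
  exists (x t, c); split => //; split => //=; last by rewrite subrr normr0.
  by move=> i; have := qx i; rewrite distrC.
rewrite /= ltNge => /negP ch; split => // A; apply: ch.
apply: (hcl t It (x t, c)) => B /nbhs_pair[e e0 HB].
have [n ne] : exists n, 2 * n.+1%:R^-1 < e.
  have [n _ Hn] := near_infty_natSinv_lt (PosNum (divr_gt0 e0 (ltr0n R 2))).
  exists n; have := Hn n (leqnn n); rewrite /=; set z := n.+1%:R^-1; lra.
have [q [Pq [[u r] [eu [/= cu cr]]]]] := A n.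
exists (u, r); split => //; apply: HB; last by move: cr ne (rn0 n); set z := n.+1%:R^-1; lra.
move=> i; have := Pq i; have := cu i; move: ne; set z := n.+1%:R^-1; rewrite !ltr_norml; lra.
Qed.

Lemma measurable_integrand_cst (u : V) : measurable_fun (I0T T) (fun t => h t u).
Proof. by apply: (measurable_integrand (x := cst u)) => i; exact: measurable_cst. Qed.

Lemma measurable_dotv x y : (forall i, measurable_fun (I0T T) (fun t => x t ord0 i)) ->
  (forall i, measurable_fun (I0T T) (fun t => y t ord0 i)) ->
  measurable_fun (I0T T) (fun t => dotv (x t) (y t)).
Proof. by move=> mx my; apply: measurable_sum => i; exact: measurable_funM. Qed.

Hypothesis solid : forall t, I0T T t -> exists u e, 0 < e /\ cube u e `<=` edom (h t).

Lemma measurable_conjv y : (forall i, measurable_fun (I0T T) (fun t => y t ord0 i)) ->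
  measurable_fun (I0T T) (fun t => conjv (h t) (y t)).
Proof.
move=> my; have [hc _] := hh; apply: measurable_gt => // c.
have : measurable (I0T T `&`
    [set t | exists q : 'rV[rat]_d, (c%:E < (dotv (qvec q) (y t))%:E - h t (qvec q))%E]).
  apply: meas_ex => q; apply: meas_gt => //; apply: emeasurable_funB.
    by apply/measurable_EFinP; apply: (measurable_dotv (x := cst (qvec q))).
  exact: measurable_integrand_cst.
congr measurable; apply/seteqP; split => t [It].
  by move=> [q lt]; split => //; apply: lt_le_trans lt _; exact: conjv_ge.
rewrite /= ltNge => /negP B; split => //; apply: contrapT => A; apply: B.
have [u [e [e0 ue]]] := solid It.
apply: (conjv_qint (hc t It) e0 ue) => q [r r0 qr]; rewrite leNgt; apply/negP => lt; apply: A.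
exists q; rewrite EFinB edom_fin// in lt; first exact: hc.
by apply: qr => i; rewrite subrr normr0.
Qed.

Lemma measurable_support y : (forall i, measurable_fun (I0T T) (fun t => y t ord0 i)) ->
  measurable_fun (I0T T) (fun t => support (edom (h t)) (y t)).
Proof.
move=> my; have [hc _] := hh; apply: measurable_gt => // c.
have : measurable (I0T T `&`
    [set t | exists q : 'rV[rat]_d, (c%:E < (dotv (qvec q) (y t))%:E)%E /\ (h t (qvec q) < +oo)%E]).
  apply: meas_ex => q; apply: meas_and; last by apply: meas_lty => //; exact: measurable_integrand_cst.
  apply: meas_gt => //; by apply/measurable_EFinP; apply: (measurable_dotv (x := cst (qvec q))).
congr measurable; apply/seteqP; split => t [It].
  move=> [q [lt D]]; split => //; apply: lt_le_trans lt _; apply: ereal_sup_ubound.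
  by exists (qvec q).
rewrite /= ltNge => /negP B; split => //; apply: contrapT => A; apply: B.
have [u [e [e0 ue]]] := solid It.
apply: (support_qint (hc t It) e0 ue) => q [r r0 qr]; rewrite leNgt; apply/negP => lt; apply: A.
by exists q; split => //; apply: qr => i; rewrite subrr normr0.
Qed.

(* The small cubes centred at the vertices of a cube around [w] meet [edom (h t)] on a common
   interval to the left of [p], and the convex hull of any choice of points in them contains a
   neighbourhood of [w]. *)
Lemma left_cube (w : V) (r p : R) : left_isc T (fun t => edom (h t)) -> I0T T p -> 0 < r ->
  cube w r `<=` edom (h p) ->
  exists2 s, s < p & forall t, I0T T t -> s < t <= p -> cube w (r / 4) `<=` edom (h t).
Proof.
move=> isc Ip r0 wr; have r4 : 0 < r / 4 by lra.
(* Vertices at distance [r / 2] with tolerance [r / 4]: a point near the vertex [c f] is still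
   strictly beyond any [y] of [cube w (r / 4)], on the side prescribed by [f]. *)
pose c (f : {ffun 'I_d -> bool}) : V := w + \row_i ((-1) ^+ f i * (r / 2)).
have H (f : {ffun 'I_d -> bool}) : exists s, s < p /\ forall t, I0T T t -> s < t <= p ->
    edom (h t) `&` cube (c f) (r / 4) !=set0.
  have [_ /(_ p) []] := isc _ (@open_cube (c f) (r / 4)).
    split => //; exists (c f); split; first by apply: wr; exact: cube_vertex.
    by move=> i; rewrite subrr normr0.
  by move=> s sp Hs; exists s; split => // t It st; have [] := Hs t It st.
have [S HS] := choice H.
exists (\big[Num.max/p - 1]_f S f).
  by apply: bigmax_lt => [|f _]; [lra|case: (HS f)].
move=> t It /andP[st tp] y yw; apply: cvx_orthants; first by apply: cvx_edom; apply: hh.1.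
move=> s; have [_ /(_ t It) [|u [Du cu]]] := HS (finfun s).
  by rewrite tp andbT; apply: le_lt_trans st; exact: le_bigmax.
exists u => // i; have := cu i; have := yw i; rewrite !mxE ffunE !ltr_norml.
by case: (s i); rewrite ?expr1 ?expr0 ?mulN1r ?mul1r; lra.
Qed.

End NormalIntegrand.

(** * Functions staying uniformly inside the domain *)

Section InteriorFunctions.
Context {R : realType} (T : R) (d : nat).
Hypothesis T0 : 0 < T.
Variables (mu : {measure set R -> \bar R}) (h : R -> 'rV[R]_d -> \bar R).
Hypothesis hh : normal_integrand T h.
Hypothesis hint_dom : forall x, inX T x -> in_int_Linf_dom T mu h x -> (Ih T mu h x < +oo)%E.
Hypothesis hdom_cl : forall x, inX T x -> (Ih T mu h x < +oo)%E ->
  forall t, (I0T T) t -> closure (edom (h t)) (x t).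
Hypothesis hproper : forall x, inX T x -> Ih T mu h x != -oo%E.
Implicit Types (x z : R -> 'rV[R]_d).
Let mI : measurable (I0T T). Proof. exact: measurable_itv. Qed.

Lemma inX_measurable x i : inX T x -> measurable_fun (I0T T) (fun t => x t ord0 i).
Proof. by move=> /inX_coord /(_ i) Xi; exact: sX_measurable Xi. Qed.

Lemma inX_integrand x : inX T x -> measurable_fun (I0T T) (fun t => h t (x t)).
Proof. by move=> Xx; apply: measurable_integrand => // i; exact: inX_measurable. Qed.

Lemma Ih_integrable x : inX T x -> (Ih T mu h x < +oo)%E ->
  mu.-integrable (I0T T) (fun t => h t (x t)).
Proof. by move=> Xx fx; apply: integrable_eint => //; [exact: inX_integrand|exact: hproper]. Qed.

(** Small constant translates of [x] remain in the interior, hence in the domain of [Ih], and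
    [hdom_cl] places their values in the closure of [edom (h t)] for every [t]. This gives a cube in
    the closure, and half of it lies in the domain by convexity. *)
Lemma int_dom_cube x : inX T x -> in_int_Linf_dom T mu h x ->
  exists2 e, 0 < e & forall t, I0T T t -> cube (x t) e `<=` edom (h t).
Proof.
(* The Euclidean norm is at most the sum of [d] coordinates, each allowed [eta] for the translation
   and [eta] for the perturbation; this choice makes the total less than [eps]. *)
move=> Xx [eps eps0 H]; pose eta := eps / (2 * (d%:R + 1)).
have d0 : 0 <= d%:R :> R by [].
have eta0 : 0 < eta by rewrite divr_gt0// mulr_gt0// ltr_wpDl.
have etaE : (eta + eta) *+ d < eps.
  have E : eta * (2 * (d%:R + 1)) = eps by rewrite /eta divfK// mulf_neq0// gt_eqF// ltr_wpDl.
  by rewrite -mulr_natr; nra.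
exists (eta / 2); first by lra.
move=> t It; apply: cube_closure => //; first by apply: cvx_edom; apply: hh.1.
move=> w wx; pose u := w - x t.
have ue i : `|u ord0 i| < eta by have := wx i; rewrite !mxE.
have Xu : inX T (fun t => x t + u) by apply: inXD => //; exact: inX_cst.
have -> : w = x t + u by rewrite /u addrC subrK.
clearbody u.
apply: (hdom_cl Xu) => //; apply: hint_dom => //; exists eta => // y my [dl dle A].
apply: H => //; exists ((eta + eta) *+ d) => //; move: A; apply: filterS => r A Ir.
apply: le_trans (enorm_le_sum _) _; rewrite -[X in _ *+ X]card_ord -sumr_const.
apply: ler_sum => i _; have := coord_le_enorm (y r - (x r + u)) i; have := A Ir; have := ue i.
rewrite !mxE => h1 h2 h3; have -> : y r ord0 i - x r ord0 i = (y r ord0 i - (x r ord0 i + u ord0 i)) + u ord0 i by ring.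
apply: le_trans (ler_normD _ _) _; apply: lerD; last exact: ltW.
by apply: le_trans h3 _; apply: le_trans h2 _; exact: ltW.
Qed.

(** The radius is valid at every [t], not only [mu]-almost everywhere, so that the values stay in
    the domain also on the [mu]-null set where [sig] lives; the class is stable under gluing. *)
Definition unif_int z : Prop := inX T z /\
  exists2 e, 0 < e & forall t, I0T T t -> cube (z t) e `<=` edom (h t).

Lemma unif_int_dom z t : unif_int z -> I0T T t -> edom (h t) (z t).
Proof. by move=> [_ [e e0 H]] It; apply: (H t It) => i; rewrite subrr normr0. Qed.

Lemma unif_int_Ih z : unif_int z -> (Ih T mu h z < +oo)%E.
Proof.
move=> [Xz [e e0 H]]; apply: hint_dom => //; exists e => // y my [dl dle A].
move: A; apply: filterS => t A It; apply: (H t It) => i.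
have := coord_le_enorm (y t - z t) i; rewrite !mxE => B.
exact: le_lt_trans (le_trans B (A It)) dle.
Qed.

Lemma unif_int_fine z t : unif_int z -> I0T T t -> (fine (h t (z t)))%:E = h t (z t).
Proof. by move=> Zz It; apply: edom_fin; [exact: hh.1|exact: unif_int_dom]. Qed.

Lemma unif_int_integrable z : unif_int z ->
  mu.-integrable (I0T T) (EFin \o (fun t => fine (h t (z t)))) /\
  Ih T mu h z = (\int[mu]_(t in I0T T) fine (h t (z t)))%R%:E.
Proof.
move=> Zz; have If := Ih_integrable Zz.1 (unif_int_Ih Zz).
have If' : mu.-integrable (I0T T) (EFin \o (fun t => fine (h t (z t)))).
  by apply: eq_integrable If => // t; rewrite inE => It /=; rewrite unif_int_fine.
split => //; rewrite EFin_Rintegral// /Ih eint_integrable//.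
by apply: eq_integral => t; rewrite inE => It; rewrite unif_int_fine.
Qed.

Lemma unif_int_glue z1 z2 s p e : 0 <= s -> s <= p -> p <= T -> inX T z1 -> unif_int z2 -> 0 < e ->
  (forall t, I0T T t -> s < t <= p -> cube (z1 t) e `<=` edom (h t)) ->
  unif_int (fun t => if s < t <= p then z1 t else z2 t).
Proof.
move=> s0 sp pT X1 [X2 [e2 e20 H2]] e0 H1; split; first exact: inX_glue.
exists (Num.min e e2); first by rewrite lt_min e0.
move=> t It; case: ifP => st w wz; first apply: (H1 t It st); last apply: (H2 t It);
  by move=> i; apply: lt_le_trans (wz i) _; rewrite ge_min lexx ?orbT.
Qed.

Hypothesis hisc : left_isc T (fun t => edom (h t)).
Hypothesis hint_ne : exists2 x, inX T x & in_int_Linf_dom T mu h x.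

Lemma unif_int_ex : exists z, unif_int z.
Proof. by have [x Xx ix] := hint_ne; exists x; split => //; exact: int_dom_cube. Qed.

Lemma dom_solid t : I0T T t -> exists u e, 0 < e /\ cube u e `<=` edom (h t).
Proof. by have [z [_ [e e0 H]]] := unif_int_ex => It; exists (z t), e; split => //; exact: H. Qed.

(* The functions equal to a rational point [q] on an interval [(s, p]] with [s] rational, where [p]
   is rational or the supremum of the admissible right ends, and to a fixed function elsewhere. *)
Lemma unif_int_dense : exists z_ : nat -> R -> 'rV[R]_d, (forall k, unif_int (z_ k)) /\
  forall t q, I0T T t -> 0 < t -> qint (h t) q -> exists k, z_ k t = qvec q.
Proof.
have [xb Zb] := unif_int_ex.
pose rad n : R := n.+1%:R^-1.
have rad0 n : 0 < rad n by rewrite invr_gt0.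
pose good (q : 'rV[rat]_d) n (s p : R) := forall t, I0T T t -> s < t <= p -> cube (qvec q) (rad n) `<=` edom (h t).
pose ends q n (s : R) := [set p : R | I0T T p /\ s < p /\ good q n s p].
pose rend q n s (o : option rat) : R := if o is Some p then ratr p else sup (ends q n s).
pose ok q n s p := [/\ Num.max s 0 <= p, p <= T & good q n s p].
pose zi (i : 'rV[rat]_d * nat * rat * option rat) : R -> 'rV[R]_d := let: (q, n, s, o) := i in
  let p := rend q n (ratr s) o in
  if `[< ok q n (ratr s) p >] then (fun t => if Num.max (ratr s) 0 < t <= p then qvec q else xb t) else xb.
have Zi i : unif_int (zi i).
  case: i => [[[q n] s] o] /=; case: asboolP => // -[h1 h2 h3].
  apply: (@unif_int_glue (cst (qvec q)) xb _ _ (rad n)) => //; first by rewrite le_max lexx orbT.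
    exact: inX_cst.
  by move=> t It /andP[st tp]; apply: h3 => //; rewrite tp andbT; apply: le_lt_trans st; rewrite le_max lexx.
pose z_ k := if unpickle k is Some i then zi i else xb.
exists z_; split => [k|t q It t0 [r r0 qr]].
  by rewrite /z_; case: unpickle.
suff [i Ei] : exists i, zi i t = qvec q by exists (pickle i); rewrite /z_ pickleK.
have [s0 s0t H] := left_cube hh hisc It r0 qr.
have [n nr] : exists n, rad n <= r / 4.
  have r4 : 0 < r / 4 by lra.
  by have [n _ Hn] := near_infty_natSinv_lt (PosNum r4); exists n; exact: ltW (Hn n (leqnn n)).
have [s] := rat_in_itvoo s0t; rewrite in_itv/= => /andP[s0s st].
have Et : ends q n (ratr s) t.
  split => //; split => // t' It' /andP[st' t't] w wq; apply: (H t' It').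
    by rewrite t't andbT (lt_trans s0s).
  by move=> i; exact: lt_le_trans (wq i) nr.
have ubT : ubound (ends q n (ratr s)) T.
  by move=> p [+ _]; rewrite /I0T/= in_itv/= => /andP[].
have tsup : t <= sup (ends q n (ratr s)).
  by apply: ub_le_sup => //; exists T.
have ms : Num.max (ratr s) 0 < t by rewrite gt_max st t0.
(* When [t] is the supremum of the admissible right ends, no admissible rational lies beyond it and
   [t] may be irrational; the code [None], standing for the supremum, covers this case. *)
move: tsup; rewrite le_eqVlt => /predU1P[tE|].
  exists (q, n, s, None) => /=; rewrite -tE; rewrite ifT; first by rewrite ms lexx.
  by apply/asboolP; split; [exact: ltW|exact: ubT|case: Et => _ []].
move=> /sup_gt[|p [Ip [sp gp]] tp]; first by exists t.
have [p'] := rat_in_itvoo tp; rewrite in_itv/= => /andP[tp' p'p].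
exists (q, n, s, Some p') => /=; rewrite ifT; first by rewrite ms ltW.
apply/asboolP; split.
- by apply: ltW; exact: lt_trans tp'.
- by apply: (le_trans (ltW p'p)); apply: ubT; split.
- by move=> t' It' /andP[h1 h2]; apply: gp => //; rewrite h1 (le_trans h2)// ltW.
Qed.

End InteriorFunctions.

(** * The conjugate *)

Section Splitting.
Context {R : realType}.
Implicit Types (m mu sig : {measure set R -> \bar R}) (D N : set R).

Lemma ae_eq_integrable m D (f g : R -> \bar R) : measurable D -> measurable_fun D g ->
  m.-integrable D f -> ae_eq m D f g -> m.-integrable D g.
Proof.
move=> mD mg If fg; case/integrableP : (If) => mf fin; apply/integrableP; split => //.
have -> // : (\int[m]_(x in D) `|g x| = \int[m]_(x in D) `|f x|)%E.
apply: ae_eq_integral => //; [exact: measurableT_comp|exact: measurableT_comp|].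
by move: fg; apply: filterS => t H Dt /=; rewrite H.
Qed.

Variables (mu sig : {measure set R -> \bar R}) (N : set R).
Hypothesis mN : measurable N.
Hypothesis muN : mu N = 0%E.
Hypothesis sigN : sig (~` N) = 0%E.

Lemma integral_split D (f1 f2 : R -> R) : measurable D ->
  mu.-integrable D (EFin \o f1) -> sig.-integrable D (EFin \o f2) ->
  (measure_add mu sig).-integrable D (EFin \o (fun t => if t \in N then f2 t else f1 t)) /\
  (\int[measure_add mu sig]_(t in D) (if t \in N then f2 t else f1 t))%R =
    (\int[mu]_(t in D) f1 t)%R + (\int[sig]_(t in D) f2 t)%R.
Proof.
move=> mD I1 I2; set f := fun t => if t \in N then f2 t else f1 t.
have m1 : measurable_fun D f1 by apply/measurable_EFinP; exact: measurable_int I1.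
have m2 : measurable_fun D f2 by apply/measurable_EFinP; exact: measurable_int I2.
have mf : measurable_fun D f.
  apply: measurable_fun_if => //.
  - apply: (measurable_fun_bool true) => //; rewrite (_ : _ @^-1` _ = N); first exact: measurableI.
    by apply/seteqP; split => t /=; [move/set_mem|move/mem_set].
  - by apply: measurable_funS m2 => // t [].
  - by apply: measurable_funS m1 => // t [].
have mEf : measurable_fun D (EFin \o f) by exact/measurable_EFinP.
have E1 : ae_eq mu D (EFin \o f1) (EFin \o f).
  exists N; split => // t /= /not_implyP[Dt]; rewrite /f; case: ifP => [|_ []//]; by rewrite inE.
have E2 : ae_eq sig D (EFin \o f2) (EFin \o f).
  exists (~` N); split => //; first exact: measurableC.
  move=> t /= /not_implyP[Dt H] Nt; apply: H; by rewrite /f mem_set.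
have J1 := ae_eq_integrable mD mEf I1 E1; have J2 := ae_eq_integrable mD mEf I2 E2.
have If : (measure_add mu sig).-integrable D (EFin \o f).
  apply/integrableP; split => //; rewrite ge0_integral_measure_add//; last exact: measurableT_comp.
  by apply: lte_add_pinfty; [case/integrableP : J1|case/integrableP : J2].
split => //; apply: EFin_inj; rewrite EFinD !EFin_Rintegral// integral_measure_add//.
congr (_ + _)%E; apply: ae_eq_integral => //; try exact/measurable_EFinP;
  [move: E1|move: E2]; apply: filterS => t H Dt; exact/esym/H.
Qed.

End Splitting.

(** Lets the terms of a sum be approached from below by reals one at a time. The infinite cases
    agree because [-oo] absorbs [+oo] in sums. *)
Lemma lee_add_approx (R : realType) (x y M : \bar R) :
  (forall a : R, (a%:E < x)%E -> (a%:E + y <= M)%E) -> (x + y <= M)%E.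
Proof.
case: x => [r| |] H; last by rewrite addNye leNye.
  case: y H => [b| |] H.
  - apply/lee_addgt0Pr => e e0; have := H (r - e); rewrite lte_fin ltrBlDr ltrDl => /(_ e0).
    by move=> H'; apply: le_trans (leeD2r e%:E H'); rewrite -!EFinD lee_fin; lra.
  - by have := H (r - 1); rewrite lte_fin ltrBlDr ltrDl => /(_ ltr01); rewrite addey.
  - by rewrite addeNy leNye.
case: y H => [b| |] H; last by rewrite addeNy leNye.
- case: M H => [c| |] H; rewrite ?leey//.
  + by exfalso; have := H (c - b + 1) (ltry _); rewrite -EFinD lee_fin; lra.
  + by have := H 0 (ltry _).
- by have := H 0 (ltry _); rewrite addey.
Qed.

Section Ends.
Context {R : realType} (T : R) (d : nat).
Hypothesis T0 : 0 < T.
Implicit Types (m : {measure set R -> \bar R}).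

Lemma integral_ends m (f g : R -> \bar R) : m [set 0] = 0%E -> (forall t, 0 < t -> t <= T -> f t = g t) ->
  (\int[m]_(t in I0T T) f t = \int[m]_(t in I0T T) g t)%E.
Proof.
move=> m0 fg; have E k : (\int[m]_(t in I0T T) k t = \int[m]_(t in `]0%R, T]%classic) k t)%E.
  apply: integral_null_ext; [exact: measurable_itv|exact: measurable_itv| |].
    by rewrite (I0T_split0 T0) => t ?; right.
  apply: (subset_measure0 _ _ _ m0) => //.
    by apply: measurableD; exact: measurable_itv.
  by rewrite (I0T_split0 T0) => t [[]].
by rewrite !E; apply: eq_integral => t; rewrite inE /= in_itv/= => /andP[? ?]; exact: fg.
Qed.

Lemma eint_ends m (f g : R -> \bar R) : m [set 0] = 0%E -> (forall t, 0 < t -> t <= T -> f t = g t) ->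
  eint m (I0T T) f = eint m (I0T T) g.
Proof.
move=> m0 fg; rewrite /eint (integral_ends m0 fg); congr (if (_ < _)%E then _ else _).
by apply: (integral_ends m0) => t ? ?; rewrite fg.
Qed.

Lemma eq_eint m (D : set R) (f g : R -> \bar R) : (forall t, D t -> f t = g t) ->
  eint m D f = eint m D g.
Proof.
move=> fg; rewrite /eint; have -> : (\int[m]_(t in D) f t = \int[m]_(t in D) g t)%E.
  by apply: eq_integral => t; rewrite inE => /fg.
congr (if (_ < _)%E then _ else _).
by apply: eq_integral => t; rewrite inE => /fg ->.
Qed.

End Ends.

Section Conjugate.
Context {R : realType} (T : R) (d : nat).
Hypothesis T0 : 0 < T.
Variables (mu : {measure set R -> \bar R}) (h : R -> 'rV[R]_d -> \bar R).
Hypothesis hmu : good_measure T mu.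
Hypothesis hh : normal_integrand T h.
Hypothesis hint_dom : forall x, inX T x -> in_int_Linf_dom T mu h x -> (Ih T mu h x < +oo)%E.
Hypothesis hdom_cl : forall x, inX T x -> (Ih T mu h x < +oo)%E ->
  forall t, (I0T T) t -> closure (edom (h t)) (x t).
Hypothesis hproper : forall x, inX T x -> Ih T mu h x != -oo%E.
Hypothesis hisc : left_isc T (fun t => edom (h t)).
Hypothesis hint_ne : exists2 x, inX T x & in_int_Linf_dom T mu h x.
Implicit Types (x z : R -> 'rV[R]_d).
Let mI : measurable (I0T T). Proof. exact: measurable_itv. Qed.
Let mu0 : mu [set 0] = 0%E. Proof. by case: hmu => _ [_ []]. Qed.
Let solid t : I0T T t -> exists u e, 0 < e /\ cube u e `<=` edom (h t).
Proof. exact: (dom_solid hh hint_dom hdom_cl hint_ne). Qed.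

Variables (v : Vtype R d) (a s : R -> 'rV[R]_d) (sig : {measure set R -> \bar R}).
Hypothesis Vv : inV T v.
Hypothesis dec : DvDec T mu v a s sig.

Lemma DvDec_sig0 : sig [set 0] = 0%E.
Proof. by apply: (DvDec_atomless T0 _ Vv dec); case: hmu => _ [_ []]. Qed.

Lemma DvDec_measurable i : measurable_fun (I0T T) (fun t => (- a t) ord0 i) /\
  measurable_fun (I0T T) (fun t => (- s t) ord0 i).
Proof.
have [_ [_ [_ [Ia [Is _]]]]] := dec; split.
  rewrite (_ : (fun t => _) = (fun t => - a t ord0 i)); last by apply/funext => t; rewrite mxE.
  by apply: measurableT_comp => //; apply/measurable_EFinP; exact: measurable_int (Ia i).
rewrite (_ : (fun t => _) = (fun t => - s t ord0 i)); last by apply/funext => t; rewrite mxE.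
by apply: measurableT_comp => //; apply/measurable_EFinP; exact: measurable_int (Is i).
Qed.

Lemma DvDec_integrable x : inX T x ->
  mu.-integrable (I0T T) (EFin \o (fun t => dotv (x t) (- a t))) /\
  sig.-integrable (I0T T) (EFin \o (fun t => dotv (x t) (- s t))).
Proof.
have [_ [_ [_ [Ia [Is _]]]]] := dec => Xx; split.
  apply: eq_integrable (integrableN (inX_dotv T0 Xx Ia)) => // t _.
  by rewrite /= dotvNr EFinN.
apply: eq_integrable (integrableN (inX_dotv T0 Xx Is)) => // t _.
by rewrite /= dotvNr EFinN.
Qed.

Lemma pairing_dec x : inX T x ->
  pairing T v x = dotv (x 0) (v.1 - v.2 0) + dotv (xTplus T x) (v.2 T) +
    (\int[mu]_(t in I0T T) dotv (x t) (- a t))%R + (\int[sig]_(t in I0T T) dotv (x t) (- s t))%R.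
Proof.
move=> Xx; have [_ [_ [_ [Ia [Is [_ E]]]]]] := dec; have [I1 I2] := DvDec_integrable Xx.
rewrite (pairing_parts T0 Vv Xx mu0 DvDec_sig0 Ia Is E) !(dotvC (x _)) /xTplus dotvC.
have N (m : {measure set R -> \bar R}) (f : R -> 'rV[R]_d) :
    m.-integrable (I0T T) (EFin \o (fun t => dotv (x t) (- f t))) ->
    (\int[m]_(t in I0T T) dotv (x t) (- f t))%R = - (\int[m]_(t in I0T T) dotv (x t) (f t))%R.
  move=> If; rewrite -[RHS]mulN1r -RintegralZl//.
    by apply: eq_Rintegral => t _; rewrite dotvNr mulN1r.
  by apply: eq_integrable (integrableN If) => // t _; rewrite /= dotvNr opprK.
by rewrite !N// dotvC; ring.
Qed.

Let F1 t := conjv (h t) (- a t).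
Let F2 t := support (edom (h t)) (- s t).

Lemma Jfun_support : Jfun T mu (fun t => conjv (h t)) (fun t => - a t) (fun t => - s t) sig =
  (eint mu (I0T T) F1 + eint sig (I0T T) F2)%E.
Proof.
rewrite /Jfun; congr (_ + _)%E; apply: eq_eint => t It; apply: recession_conjv.
- exact: hh.1.
- exact: hh.2.1.
- by have [u [e [e0 H]]] := solid It; exists u; apply: H => i; rewrite subrr normr0.
Qed.

Lemma measurable_F1 : measurable_fun (I0T T) F1.
Proof. by apply: (measurable_conjv hh solid) => i; case: (DvDec_measurable i). Qed.

Lemma measurable_F2 : measurable_fun (I0T T) F2.
Proof. by apply: (measurable_support hh solid) => i; case: (DvDec_measurable i). Qed.

Section Fenchel.
Variable x : R -> 'rV[R]_d.
Hypothesis Xx : inX T x.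
Hypothesis fx : (Ih T mu h x < +oo)%E.

Lemma fenchel_integrable :
  mu.-integrable (I0T T) (fun t => (dotv (x t) (- a t))%:E - h t (x t))%E /\
  (\int[mu]_(t in I0T T) ((dotv (x t) (- a t))%:E - h t (x t)) =
    (\int[mu]_(t in I0T T) dotv (x t) (- a t))%R%:E - Ih T mu h x)%E.
Proof.
have [I1 _] := DvDec_integrable Xx; have Ih_ := Ih_integrable T0 hh hproper Xx fx.
split; first exact: integrableB.
by rewrite integralB// EFin_Rintegral// /Ih eint_integrable.
Qed.

Lemma fenchel_mu : ((\int[mu]_(t in I0T T) dotv (x t) (- a t))%R%:E - Ih T mu h x <=
  eint mu (I0T T) F1)%E.
Proof.
have [I E] := fenchel_integrable; rewrite -E; apply: eint_ge => //; first exact: measurable_F1.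
by move=> t _; exact: conjv_ge.
Qed.

(** Finiteness of [Ih] constrains [x] only [mu]-almost everywhere; it is [hdom_cl] that controls
    [x t] at the points charged by [sig]. *)
Lemma dotv_support t : I0T T t -> ((dotv (x t) (- s t))%:E <= F2 t)%E.
Proof.
move=> It; have := hdom_cl Xx fx It => cl; rewrite /F2.
move E : (support _ _) => [r| |]; [|by rewrite leey|].
  by rewrite lee_fin; apply: (support_closure cl); rewrite E.
(* The value [-oo] is excluded: it would also bound the support function by
   [dotv (x t) (- s t) - 1]. *)
have H : (support (edom (h t)) (- s t) <= (dotv (x t) (- s t) - 1)%:E)%E by rewrite E leNye.
by exfalso; have := support_closure cl H; lra.
Qed.

Lemma fenchel_sig : ((\int[sig]_(t in I0T T) dotv (x t) (- s t))%R%:E <= eint sig (I0T T) F2)%E.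
Proof.
have [_ I2] := DvDec_integrable Xx; rewrite EFin_Rintegral//.
by apply: eint_ge => //; [exact: measurable_F2|exact: dotv_support].
Qed.

End Fenchel.

Let psi1 z t := dotv (z t) (- a t) - fine (h t (z t)).
Let psi2 z t := dotv (z t) (- s t).

Let psi1_integrable z : unif_int T h z -> mu.-integrable (I0T T) (EFin \o psi1 z).
Proof.
move=> Zz; have [I1 _] := DvDec_integrable Zz.1.
by have [If _] := unif_int_integrable T0 hh hint_dom hproper Zz; exact: (integrableB mI I1 If).
Qed.

Let psi2_integrable z : unif_int T h z -> sig.-integrable (I0T T) (EFin \o psi2 z).
Proof. by move=> Zz; have [_ I2] := DvDec_integrable Zz.1. Qed.

Let psi1_le z t : unif_int T h z -> I0T T t -> ((psi1 z t)%:E <= F1 t)%E.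
Proof.
move=> Zz It; rewrite /psi1 EFinB (unif_int_fine hh Zz It); exact: conjv_ge.
Qed.

Let psi2_le z t : unif_int T h z -> I0T T t -> ((psi2 z t)%:E <= F2 t)%E.
Proof.
move=> Zz It; apply: ereal_sup_ubound; exists (z t) => //; exact: (unif_int_dom Zz It).
Qed.

(** [unif_int_dense] reaches only [t > 0], since intervals []s, p]] with [0 <= s] miss 0; the single
    point 0 is negligible. *)
Let ae_pos (m : {measure set R -> \bar R}) (P : R -> Prop) : m [set 0] = 0%E ->
  (forall t, I0T T t -> 0 < t -> P t) -> \forall t \ae m, I0T T t -> P t.
Proof.
move=> m0 H; exists [set 0]; split => // t /= /not_implyP[It nP].
move: (It); rewrite /I0T /= in_itv/= le_eqVlt => /andP[/predU1P[->//|t0] _].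
by case: nP; exact: H.
Qed.

Lemma F1_dense (z_ : nat -> R -> 'rV[R]_d) t :
  (forall q, qint (h t) q -> exists k, z_ k t = qvec q) -> I0T T t ->
  forall b, (forall k, ((psi1 (z_ k) t)%:E <= b)%E) -> (F1 t <= b)%E.
Proof.
move=> H It b Hb; have [u [e [e0 ue]]] := solid It; apply: (conjv_qint (hh.1 _ It) e0 ue) => q /H [k E].
by have := Hb k; rewrite /psi1 E.
Qed.

Lemma F2_dense (z_ : nat -> R -> 'rV[R]_d) t :
  (forall q, qint (h t) q -> exists k, z_ k t = qvec q) -> I0T T t ->
  forall b, (forall k, ((psi2 (z_ k) t)%:E <= b)%E) -> (F2 t <= b)%E.
Proof.
move=> H It b Hb; have [u [e [e0 ue]]] := solid It; apply: (support_qint (hh.1 _ It) e0 ue) => q /H [k E].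
by have := Hb k; rewrite /psi2 E.
Qed.

(* [m := mu + sig] with [mu N = sig (~` N) = 0] turns the two integrals into a single one, so that
   the two suprema are approached by the same function. *)
Lemma J_approx a1 a2 : (a1%:E < eint mu (I0T T) F1)%E -> (a2%:E < eint sig (I0T T) F2)%E ->
  exists2 z, unif_int T h z &
    a1 + a2 <= (\int[mu]_(t in I0T T) psi1 z t)%R + (\int[sig]_(t in I0T T) psi2 z t)%R.
Proof.
move=> lt1 lt2; have sig0 := DvDec_sig0.
have [_ [_ [[N [mN [muN sigN]]] _]]] := dec.
have [z_ [Zz Hz]] := unif_int_dense hh hint_dom hdom_cl hisc hint_ne.
have [n1 H1] := eint_runmax mI measurable_F1 (fun k => psi1_integrable (Zz k))
  (fun t It => psi1_le (Zz 0%N) It)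
  (ae_pos mu0 (fun t It t0 => F1_dense (fun q => Hz t q It t0) It)) lt1.
have [n2 H2] := eint_runmax mI measurable_F2 (fun k => psi2_integrable (Zz k))
  (fun t It => psi2_le (Zz 0%N) It)
  (ae_pos sig0 (fun t It t0 => F2_dense (fun q => Hz t q It t0) It)) lt2.
pose n := maxn n1 n2.
have I1 := integrable_runmax mI (fun k => psi1_integrable (Zz k)).
have I2 := integrable_runmax mI (fun k => psi2_integrable (Zz k)).
have {}H1 : a1 < (\int[mu]_(t in I0T T) runmax (fun k => psi1 (z_ k)) n t)%R.
  apply: lt_le_trans H1 _; apply: le_Rintegral => // t _; apply: runmax_nd; exact: leq_maxl.
have {}H2 : a2 < (\int[sig]_(t in I0T T) runmax (fun k => psi2 (z_ k)) n t)%R.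
  apply: lt_le_trans H2 _; apply: le_Rintegral => // t _; apply: runmax_nd; exact: leq_maxr.
pose m := measure_add mu sig.
pose psi t u := if t \in N then dotv u (- s t) else dotv u (- a t) - fine (h t u).
have Ipsi z (Z : unif_int T h z) := integral_split mN muN sigN mI (psi1_integrable Z) (psi2_integrable Z).
have [IM EM] := integral_split mN muN sigN mI (I1 n) (I2 n).
have rmE : runmax (fun k t => psi t (z_ k t)) n =
    (fun t => if t \in N then runmax (fun k => psi2 (z_ k)) n t else runmax (fun k => psi1 (z_ k)) n t).
  apply/funext => t; rewrite /psi; elim: (n) => [|k IH] /=; first by case: ifP.
  by rewrite IH; case: ifP.
have m0 : m [set 0] = 0%E.
  have := @measure_addE _ _ _ mu sig [set 0]; rewrite -/m => ->; by rewrite mu0 sig0 adde0.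
have Zglue z1 z2 (p q : R) : unif_int T h z1 -> unif_int T h z2 -> 0 <= p -> p <= q -> q <= T ->
    unif_int T h (fun t => if p < t <= q then z1 t else z2 t).
  by move=> [X1 [e e0 H]] Z2 p0 pq qT; apply: (unif_int_glue p0 pq qT X1 Z2 e0) => t It _; exact: H.
(* The slack left by the two strict inequalities is the loss allowed in the exchange. *)
pose e := (\int[mu]_(t in I0T T) runmax (fun k => psi1 (z_ k)) n t)%R +
  (\int[sig]_(t in I0T T) runmax (fun k => psi2 (z_ k)) n t)%R - (a1 + a2).
have e0 : 0 < e by rewrite subr_gt0; exact: ltrD.
have [z Z [_]] := exchange T0 (psi := psi) m0 Zglue (fun z Z => (Ipsi z Z).1) n Zz e0.
by rewrite rmE EM (Ipsi z Z).2 /e opprB addrC subrK => H; exists z.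
Qed.

Variables k0 kT : 'rV[R]_d -> \bar R.
Hypothesis hk0 : closed_proper_convex k0.
Hypothesis hkT : closed_proper_convex kT.
Let f := ffun T mu h k0 kT.

Lemma ffun_fin x : inX T x -> (f x < +oo)%E ->
  [/\ Ih T mu h x \is a fin_num, k0 (x 0) \is a fin_num & kT (xTplus T x) \is a fin_num].
Proof.
move=> Xx; have := hproper Xx; have := hk0.1.1 (x 0); have := hkT.1.1 (xTplus T x).
rewrite /f /ffun; case: (Ih T mu h x) => [?| |]; case: (k0 _) => [?| |];
  by case: (kT _) => [?| |].
Qed.

Lemma fconj_le : (fconj T f v <= eint mu (I0T T) F1 + eint sig (I0T T) F2 +
  conjv k0 (v.1 - v.2 0)%R + conjv kT (v.2 T))%E.
Proof.
apply: ge_ereal_sup => _ [x Xx <-]; have [fy|] := ltP (f x) +oo%E; last first.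
  by rewrite leye_eq => /eqP ->; rewrite addeNy leNye.
have [fI f0 fT] := ffun_fin Xx fy; rewrite (pairing_dec Xx).
have fIy : (Ih T mu h x < +oo)%E by move: fI; rewrite fin_numE => /andP[_]; rewrite ltey.
have := fenchel_sig Xx fIy; have := fenchel_mu Xx fIy.
have := conjv_ge k0 (x 0) (v.1 - v.2 0); have := conjv_ge kT (xTplus T x) (v.2 T).
rewrite /f /ffun -(fineK fI) -(fineK f0) -(fineK fT) -!EFinB.
move=> h1 h2 h3 h4; apply: le_trans (leeD (leeD (leeD h3 h4) h2) h1).
by rewrite -!EFinD lee_fin; lra.
Qed.

Lemma conjv_gt (k : 'rV[R]_d -> \bar R) (w : 'rV[R]_d) (b : R) : convex_fun k ->
  (b%:E < conjv k w)%E -> exists u, k u \is a fin_num /\ b < dotv u w - fine (k u).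
Proof.
move=> ck /ereal_sup_gt[_ [u _ <-]] lt; exists u; have := ck.1 u; move: lt.
by case: (k u) => [r| |] //=; rewrite -EFinB lte_fin.
Qed.

Lemma fconj_ge : (eint mu (I0T T) F1 + eint sig (I0T T) F2 +
  conjv k0 (v.1 - v.2 0)%R + conjv kT (v.2 T) <= fconj T f v)%E.
Proof.
(* The terms are reordered so that [lee_add_approx] peels them off one by one. The approximations of
   the end terms fix the ends [u0], [uT] of [x], those of the integrals fix [z] on []0, T]]. *)
rewrite addeC (addeC (_ + _)%E (conjv k0 _)) (addeC (eint mu _ _)).
apply: lee_add_approx => aT /(conjv_gt hkT.1) [uT [fT ltT]].
rewrite (addeCA aT%:E); apply: lee_add_approx => a0 /(conjv_gt hk0.1) [u0 [f0 lt0]].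
rewrite (addeA a0%:E) (addeCA (a0%:E + _)%E); apply: lee_add_approx => a2 lt2.
rewrite (addeA a2%:E) addeC; apply: lee_add_approx => a1 lt1.
have [z Z le] := J_approx lt1 lt2; pose x := set_ends T u0 uT z.
have Xx : inX T x by apply: inX_ends => //; exact: Z.1.
have xz t : 0 < t -> t <= T -> x t = z t by exact: set_endsE.
apply: (@le_trans _ _ ((pairing T v x)%:E - f x)%E); last by apply: ereal_sup_ubound; exists x.
have [I1 I2] := DvDec_integrable Z.1; have [If E] := unif_int_integrable T0 hh hint_dom hproper Z.
rewrite /f /ffun (_ : Ih T mu h x = Ih T mu h z); last by apply: (eint_ends T0 mu0) => t t0 tT; rewrite xz.
rewrite E (pairing_dec Xx) /xTplus /x set_ends0 (set_endsT T0) -/x -(fineK f0) -(fineK fT).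
have -> : (\int[mu]_(t in I0T T) dotv (x t) (- a t))%R = (\int[mu]_(t in I0T T) dotv (z t) (- a t))%R.
  by congr fine; apply: (integral_ends T0 mu0) => t t0 tT; rewrite xz.
have -> : (\int[sig]_(t in I0T T) dotv (x t) (- s t))%R = (\int[sig]_(t in I0T T) dotv (z t) (- s t))%R.
  by congr fine; apply: (integral_ends T0 DvDec_sig0) => t t0 tT; rewrite xz.
move: le; rewrite /psi1 /psi2 RintegralB// => le.
by rewrite -!EFinD lee_fin; lra.
Qed.

Lemma fconj_dec : fconj T f v = (Jfun T mu (fun t => conjv (h t)) (fun t => - a t)%R (fun t => - s t)%R sig +
  conjv k0 (v.1 - v.2 0)%R + conjv kT (v.2 T))%E.
Proof. by rewrite Jfun_support; apply/le_anti/andP; split; [exact: fconj_le|exact: fconj_ge]. Qed.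

End Conjugate.

(** * Infinite values of the conjugate and subgradients *)

Lemma eint_le_ae (R : realType) (m : {measure set R -> \bar R}) (D : set R) (f g : R -> \bar R) :
  measurable D -> measurable_fun D f -> m.-integrable D g ->
  (\forall t \ae m, D t -> (f t <= g t)%E) -> (eint m D f <= \int[m]_(t in D) g t)%E.
Proof.
move=> mD mf Ig fg; have mg := measurable_int _ Ig.
have P : (\int[m]_(x in D) f^\+ x <= \int[m]_(x in D) g^\+ x)%E.
  apply: ae_ge0_le_integral => //; [exact: measurable_funepos|exact: measurable_funepos|].
  move: fg; apply: filterS => t H Dt; rewrite !funeposE ge_max !le_max lexx orbT andbT; by rewrite H.
have N : (\int[m]_(x in D) g^\- x <= \int[m]_(x in D) f^\- x)%E.
  apply: ae_ge0_le_integral => //; [exact: measurable_funeneg|exact: measurable_funeneg|].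
  move: fg; apply: filterS => t H Dt; rewrite !funenegE ge_max !le_max lexx orbT andbT leeN2; by rewrite H.
rewrite eintE ifT; last first.
  apply: le_lt_trans P _; have := integrable_pos_fin_num mD Ig.
  by rewrite fin_numE => /andP[_]; rewrite ltey.
by rewrite (integralE _ _ f) (integralE _ _ g); exact: leeB.
Qed.

Lemma subdiff_conjv (R : realType) (d : nat) (g : 'rV[R]_d -> \bar R) u y : convex_fun g -> edom g !=set0 ->
  (conjv g y <= (dotv u y)%:E - g u)%E -> subdiff g u y.
Proof.
move=> cg ng le u'; have := le_trans (conjv_ge g u' y) le.
have := conjvNy y cg ng; have := cg.1 u; have := cg.1 u'; rewrite dotvBr !(dotvC y).
move: le; case: (g u) => [r| |]; case: (g u') => [r'| |] //=.
- by rewrite -!EFinB -EFinD !lee_fin => *; lra.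
- by rewrite leey.
Qed.

(** Real lower bounds exclude [-oo] and the real upper bound on the sum excludes [+oo]; then a sum
    that does not exceed the sum of its lower bounds has all terms tight. *)
Lemma sum4_tight (R : realType) (a b c e : \bar R) (p q r t : R) :
  (p%:E <= a)%E -> (q%:E <= b)%E -> (r%:E <= c)%E -> (t%:E <= e)%E ->
  (a + b + c + e <= (p + q + r + t)%:E)%E ->
  [/\ (a <= p%:E)%E, (b <= q%:E)%E, (c <= r%:E)%E & (e <= t%:E)%E].
Proof.
case: a => [a| |] //; case: b => [b| |] //; case: c => [c| |] //; case: e => [e| |] //.
by rewrite -!EFinD !lee_fin => *; split; lra.
Qed.

Section Theorem2.
Context {R : realType} (T : R) (d : nat).
Hypothesis T0 : 0 < T.
Variables (mu : {measure set R -> \bar R}) (h : R -> 'rV[R]_d -> \bar R).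
Hypothesis hmu : good_measure T mu.
Hypothesis hh : normal_integrand T h.
Hypothesis hint_dom : forall x, inX T x -> in_int_Linf_dom T mu h x -> (Ih T mu h x < +oo)%E.
Hypothesis hdom_cl : forall x, inX T x -> (Ih T mu h x < +oo)%E ->
  forall t, (I0T T) t -> closure (edom (h t)) (x t).
Hypothesis hproper : forall x, inX T x -> Ih T mu h x != -oo%E.
Hypothesis hisc : left_isc T (fun t => edom (h t)).
Hypothesis hint_ne : exists2 x, inX T x & in_int_Linf_dom T mu h x.
Variables k0 kT : 'rV[R]_d -> \bar R.
Hypothesis hk0 : closed_proper_convex k0.
Hypothesis hkT : closed_proper_convex kT.
Implicit Types (x z : R -> 'rV[R]_d) (v : Vtype R d).
Let mI : measurable (I0T T). Proof. exact: measurable_itv. Qed.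
Let mu0 : mu [set 0] = 0%E. Proof. by case: hmu => _ [_ []]. Qed.
Let f := ffun T mu h k0 kT.

Lemma steps_ends (a b : 'rV[R]_d) z c (p : nat -> R) n t : (forall k, I0T T (p k)) ->
  set_ends T a b (fun t => z t + steps c p n t) t = set_ends T a b z t + steps c p n t.
Proof.
move=> Ip; have pT k : 0 <= p k <= T by have := Ip k; rewrite /I0T/= in_itv.
rewrite /set_ends; case: (leP t 0) => t0.
  rewrite [steps _ _ _ _]big1 ?addr0// => k _.
  by rewrite !ltNge !(le_trans t0 _) ?scale0r ?subrr//; [case/andP: (pT k.+1)|case/andP: (pT k)].
case: ltP => // Tt; rewrite [steps _ _ _ _]big1 ?addr0// => k _.
by rewrite !(le_lt_trans _ Tt) ?subrr//; [case/andP: (pT k.+1)|case/andP: (pT k)].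
Qed.

(** The perturbation is a sum of pulses of height [e / 2] per coordinate with signs opposite to the
    increments of [v]. The pairing gains at least [e / 2] times the variation along the subdivision,
    while the perturbed function takes at each [t] one of finitely many values, independent of the
    subdivision, so that [Ih] stays bounded. *)
Lemma fconj_notBV v : inV T v -> ~ inVBV T v -> fconj T f v = +oo%E.
Proof.
move=> Vv nBV; have [xb [Xb [e e0 He]]] := unif_int_ex hh hint_dom hdom_cl hint_ne.
have e2 : 0 < e / 2 by lra.
have [_ [_ [u0 D0]]] := hk0; have [_ [_ [uT DT]]] := hkT.
have F0 := edom_fin hk0.1 D0; have FT := edom_fin hkT.1 DT.
pose sgv (sg : 'I_d -> bool) : 'rV[R]_d := \row_i ((-1) ^+ sg i * (e / 2)).
have Zb : unif_int T h xb by split => //; exists e.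
have sgm (u w : 'rV[R]_d) : (forall i, `|u ord0 i| <= e / 2) -> forall t, I0T T t -> cube (xb t + u) (e / 2) w -> edom (h t) w.
  move=> ue t It wu; apply: (He t It) => i; have := wu i; have := ue i; rewrite mxE ler_norml !ltr_norml; lra.
have sgn sg i : `|sgv sg ord0 i| <= e / 2.
  by rewrite mxE normrM normrX normrN1 expr1n mul1r gtr0_norm.
have Zv sg : unif_int T h (fun t => xb t + sgv sg).
  split; first by apply: inXD => //; exact: inX_cst.
  by exists (e / 2) => // t It w; apply: sgm.
have [Ib _] := unif_int_integrable T0 hh hint_dom hproper Zb.
have IZ sg := (unif_int_integrable T0 hh hint_dom hproper (Zv sg)).1.
(* An integrable bound for [h t] at all values that any perturbed function can take at [t]. *)
pose B t := `|fine (h t (xb t))| + \sum_(sg : {ffun 'I_d -> bool}) `|fine (h t (xb t + sgv sg))|.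
have IB : mu.-integrable (I0T T) (EFin \o B).
  have Is := integrable_sum mI (index_enum {ffun 'I_d -> bool}) (P := xpredT)
    (fun sg _ => integrable_abse (IZ sg)).
  apply: eq_integrable (integrableD mI (integrable_abse Ib) Is) => // t _.
  by rewrite /= EFinD -sumEFin.
pose xs := set_ends T u0 uT xb.
have Xs : inX T xs by exact: inX_ends.
apply/eqyP => A A0.
(* Chosen so that [e / 2 * M] compensates the fixed part of [<v,x> - f x] and reaches the arbitrary
   level [A]. *)
pose M := (A + (\int[mu]_(t in I0T T) B t)%R + fine (k0 u0) + fine (kT uT) - pairing T v xs) / (e / 2).
have [n [p [p1 Ip lt]]] : exists n (p : nat -> R), [/\ forall k, p k <= p k.+1, forall k, I0T T (p k) &
    M < \sum_(k < n) enorm (v.2 (p k.+1) - v.2 (p k))].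
  apply: contrapT => H; apply: nBV; split => //; exists M => n p p1 Ip; rewrite leNgt; apply/negP => lt.
  by apply: H; exists n, p.
(* The pairing with a pulse involves [v.2 (p k) - v.2 (p k.+1)], so a coordinate where [v] increases
   gets a negative sign. *)
pose c k := sgv [ffun i => v.2 (p k) ord0 i < v.2 (p k.+1) ord0 i].
pose y t := xb t + steps c p n t.
have Xst : inX T (steps c p n) by exact: steps_inX.
have yv t : y t = xb t \/ exists sg : {ffun 'I_d -> bool}, y t = xb t + sgv sg.
  have [E|[k E]] := steps_val c n t p1; [left|right]; rewrite /y E ?addr0//.
  by eexists.
have Zy : unif_int T h y.
  split; first exact: inXD.
  exists (e / 2) => // t It w; case: (yv t) => [->|[sg ->]]; last exact: sgm.
  by rewrite -[xb t]addr0; apply: sgm => // i; rewrite mxE normr0 ltW.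
have [Iy Ey] := unif_int_integrable T0 hh hint_dom hproper Zy.
have yB : (\int[mu]_(t in I0T T) fine (h t (y t)))%R <= (\int[mu]_(t in I0T T) B t)%R.
  apply: le_Rintegral => // t It; rewrite /B; apply: le_trans (ler_norm _) _.
  case: (yv t) => [->|[sg ->]]; first by rewrite lerDl sumr_ge0.
  by rewrite (bigD1 sg)//= addrCA lerDl addr_ge0// sumr_ge0.
pose x := set_ends T u0 uT y.
have Xx : inX T x by apply: inX_ends => //; exact: Zy.1.
have xE : x = (fun t => xs t + steps c p n t) by apply/funext => t; exact: steps_ends.
apply: (@le_trans _ _ ((pairing T v x)%:E - f x)%E); last by apply: ereal_sup_ubound; exists x.
rewrite /f /ffun /xTplus /x set_ends0 (set_endsT T0) -/x.
rewrite (_ : Ih T mu h x = Ih T mu h y); last first.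
  by apply: (eint_ends T0 mu0) => t t0 tT; rewrite /x set_endsE.
rewrite Ey -F0 -FT -!EFinD lee_fin xE (pairingD T0 Vv Xs Xst) (pairing_steps T0 _ _ Vv Ip).
have : e / 2 * M <= \sum_(k < n) dotv (c k) (v.2 (p k) - v.2 (p k.+1)).
  apply: le_trans (_ : e / 2 * \sum_(k < n) enorm (v.2 (p k.+1) - v.2 (p k)) <= _).
    by rewrite ler_pM2l// ltW.
  rewrite mulr_sumr; apply: ler_sum => k _.
  apply: le_trans (_ : e / 2 * \sum_i `|(v.2 (p k.+1) - v.2 (p k)) ord0 i| <= _).
    by rewrite ler_pM2l//; exact: enorm_le_sum.
  rewrite mulr_sumr; apply: ler_sum => i _; rewrite !mxE ffunE.
  case: ltP => h1; rewrite ?expr1 ?expr0 ?mul1r ?mulN1r.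
    by rewrite gtr0_norm ?subr_gt0// mulNr -mulrN opprB.
  by rewrite ler0_norm ?subr_le0// opprB.
rewrite mulrC /M divfK ?gt_eqF//; lra.
Qed.

(** The four subgradient inequalities are summed at a competitor [y] with [f y] finite, without
    going through the conjugate. The singular one contributes a term at most 0 because [y t] lies in
    the closure of the domain for every [t]; finiteness at [x] follows from finiteness at [y]. *)
Lemma subdiff_suff x v a s sig : inX T x -> inV T v -> DvDec T mu v a s sig ->
  (\forall t \ae mu, I0T T t -> subdiff (h t) (x t) (- a t)) ->
  (\forall t \ae sig, I0T T t -> subdiff_s (h t) (x t) (- s t)) ->
  subdiff k0 (x 0) (v.1 - v.2 0) -> subdiff kT (xTplus T x) (v.2 T) -> fsubdiff T f x v.
Proof.
move=> Xx Vv dec Sa Ss S0 ST y Xy; have [fy|] := ltP (f y) +oo%E; last first.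
  by rewrite leye_eq => /eqP ->; exact: leey.
have [fI f0 fT] := ffun_fin hproper hk0 hkT Xy fy.
have fIy : (Ih T mu h y < +oo)%E by move: fI; rewrite fin_numE => /andP[_]; rewrite ltey.
have Xyx : inX T (fun t => y t - x t) by exact: inXB.
have [I1 I2] := DvDec_integrable T0 dec Xyx.
have Iy := Ih_integrable T0 hh hproper Xy fIy.
have Ia : (Ih T mu h x <= Ih T mu h y - (\int[mu]_(t in I0T T) dotv (y t - x t) (- a t))%R%:E)%E.
  rewrite EFin_Rintegral// /Ih [X in (_ <= X - _)%E]eint_integrable// -integralB//.
  apply: eint_le_ae => //; [exact: (inX_integrand T0)|exact: integrableB|].
  move: Sa; apply: filterS => t H It; rewrite leeBrDr// dotvC; exact: H.
have Is : (\int[sig]_(t in I0T T) dotv (y t - x t) (- s t))%R <= 0.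
  rewrite -lee_fin EFin_Rintegral// -(eint_integrable mI I2).
  rewrite -[leRHS](integral0 sig (I0T T)); apply: eint_le_ae => //; [exact: measurable_int I2|exact: integrable0|].
  move: Ss; apply: filterS => t H It; have := H It (y t); rewrite /Defs.indic dotvC.
  rewrite (asboolT (hdom_cl Xy fIy It)); case: asboolP => _; first by rewrite add0e.
  by rewrite addye.
have {}S0 := S0 (y 0); have {}ST := ST (xTplus T y).
rewrite (pairing_dec T0 hmu Vv dec Xyx) /f /ffun /xTplus; rewrite /xTplus in ST fT.
have F0 : k0 (x 0) \is a fin_num by move: S0; rewrite -(fineK f0); case: (k0 (x 0)) (hk0.1.1 (x 0)).
have FT : kT (x (T + 1)) \is a fin_num.
  by move: ST; rewrite -(fineK fT); case: (kT (x (T + 1))) (hkT.1.1 (x (T + 1))).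
have FI : Ih T mu h x \is a fin_num.
  by move: Ia; rewrite -(fineK fI); case: (Ih T mu h x) (hproper Xx).
move: Ia S0 ST; rewrite -(fineK fI) -(fineK f0) -(fineK fT) -(fineK FI) -(fineK F0) -(fineK FT).
rewrite (dotvC (v.1 - v.2 0)) (dotvC (v.2 T)) -!EFinB -!EFinD !lee_fin; move: Is.
by move: (Rintegral sig _ _) (Rintegral mu _ _) (dotv _ _) (dotv _ _) => *; lra.
Qed.

Lemma subdiff_nec x v : inX T x -> inV T v -> fsubdiff T f x v ->
  inVBV T v /\ exists a s sig, DvDec T mu v a s sig /\
    (\forall t \ae mu, I0T T t -> subdiff (h t) (x t) (- a t)) /\
    (\forall t \ae sig, I0T T t -> subdiff_s (h t) (x t) (- s t)) /\
    subdiff k0 (x 0) (v.1 - v.2 0) /\ subdiff kT (xTplus T x) (v.2 T).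
Proof.
move=> Xx Vv S; have [xb Zb] := unif_int_ex hh hint_dom hdom_cl hint_ne.
have [_ [_ [u0 D0]]] := hk0; have [_ [_ [uT DT]]] := hkT.
have fx : (f x < +oo)%E.
  pose y := set_ends T u0 uT xb; have Xy : inX T y by apply: inX_ends => //; exact: Zb.1.
  have : (f y < +oo)%E.
    rewrite /f /ffun /xTplus /y set_ends0 (set_endsT T0) -/y.
    rewrite (_ : Ih T mu h y = Ih T mu h xb); last first.
      by apply: (eint_ends T0 mu0) => t t0 tT; rewrite /y set_endsE.
    have [_ ->] := unif_int_integrable T0 hh hint_dom hproper Zb.
    by rewrite -(edom_fin hk0.1 D0) -(edom_fin hkT.1 DT) -!EFinD ltry.
  move=> fy; have := le_lt_trans (S y Xy) fy.
  by rewrite !ltey; case: (f x).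
have [fI f0 fT] := ffun_fin hproper hk0 hkT Xx fx.
have fIx : (Ih T mu h x < +oo)%E by move: fI; rewrite fin_numE => /andP[_]; rewrite ltey.
have fE : f x = (fine (Ih T mu h x) + fine (k0 (x 0)) + fine (kT (xTplus T x)))%:E.
  by rewrite /f /ffun !EFinD !fineK.
have conj_le : (fconj T f v <= (pairing T v x)%:E - f x)%E.
  apply: ge_ereal_sup => _ [y Xy <-]; have := S y Xy.
  rewrite (pairingB T0 Vv Xy Xx (inXB Xy Xx)) fE.
  by case: (f y) => [r| |]; rewrite ?addeNy ?leNye// -?EFinB -?EFinD ?lee_fin //; lra.
have BVv : inVBV T v.
  apply: contrapT => /(fconj_notBV Vv) E; by move: conj_le; rewrite E fE -EFinB leye_eq.
split => //; have muT : (mu setT < +oo)%E by case: hmu => muC [muI _]; exact: (concentrated_fin muC muI).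
have [a [s [sig dec]]] := DvDec_ex T0 muT BVv; exists a, s, sig; split => //.
have [I1 I2] := DvDec_integrable T0 dec Xx.
have mF1 := measurable_F1 hh hint_dom hdom_cl hint_ne dec.
have mF2 := measurable_F2 hh hint_dom hdom_cl hint_ne dec.
have L1 := fenchel_mu T0 hh hint_dom hdom_cl hproper hint_ne dec Xx fIx.
have L2 := fenchel_sig T0 hh hint_dom hdom_cl hint_ne dec Xx fIx.
have L3 := conjv_ge k0 (x 0) (v.1 - v.2 0); have L4 := conjv_ge kT (xTplus T x) (v.2 T).
(* The formula for the conjugate and [conj_le] leave no gap in the sum of the four Fenchel
   inequalities, so each one is an equality. *)
have [E1 E2 E3 E4] :
   [/\ (eint mu (I0T T) (fun t => conjv (h t) (- a t)) <=
      (\int[mu]_(t in I0T T) dotv (x t) (- a t))%R%:E - Ih T mu h x)%E,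
    (eint sig (I0T T) (fun t => support (edom (h t)) (- s t)) <=
      (\int[sig]_(t in I0T T) dotv (x t) (- s t))%R%:E)%E,
    (conjv k0 (v.1 - v.2 0)%R <= (dotv (x 0%R) (v.1 - v.2 0)%R)%:E - k0 (x 0%R))%E &
    (conjv kT (v.2 T) <= (dotv (xTplus T x) (v.2 T))%:E - kT (xTplus T x))%E].
  move: conj_le L1 L2 L3 L4.
  rewrite (fconj_dec T0 hmu hh hint_dom hdom_cl hproper hisc hint_ne Vv dec hk0 hkT).
  rewrite (Jfun_support hh hint_dom hdom_cl hint_ne) (pairing_dec T0 hmu Vv dec Xx).
  rewrite fE -(fineK fI) -(fineK f0) -(fineK fT) -!EFinB => le L1 L2 L3 L4.
  apply: (sum4_tight L1 L2 L3 L4); apply: le_trans le _; rewrite lee_fin /=.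
  by move: (Rintegral sig _ _) (Rintegral mu _ _) (dotv _ _) (dotv _ _) (fine _) (fine _) (fine _) => *; lra.
have [If EI] := fenchel_integrable T0 hh hproper dec Xx fIx.
have dom_ne t : I0T T t -> edom (h t) !=set0 by move=> It; exists (xb t); exact: (unif_int_dom Zb It).
split.
  rewrite -EI in E1; have := eint_eq_ae mI mF1 If (fun t _ => conjv_ge _ _ _) E1.
  apply: filterS => t H It; apply: subdiff_conjv; [exact: hh.1|exact: dom_ne|].
  by rewrite H.
split.
  rewrite EFin_Rintegral// in E2.
  have := eint_eq_ae mI mF2 I2 (fun t It => dotv_support hdom_cl s Xx fIx It) E2.
  apply: filterS => t H It u; rewrite /Defs.indic.
  rewrite (asboolT (hdom_cl Xx fIx It)) add0e; case: asboolP => cu; last exact: leey.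
  rewrite lee_fin dotvBr !(dotvC (- s t)) subr_le0.
  by apply: (support_closure cu); rewrite H.
split; apply: subdiff_conjv => //.
- exact: hk0.1.
- by exists u0.
- exact: hkT.1.
- by exists uT.
Qed.

End Theorem2.

(** * Integrable affine minorants *)

Section Candidates.
Context {R : realType} {d : nat}.
Variables (g : 'rV[R]_d -> \bar R) (x : 'rV[R]_d) (e : R).
Hypothesis cg : convex_fun g.
Hypothesis clg : closed (epi g).
Hypothesis e0 : 0 < e.
Hypothesis xe : cube x e `<=` edom g.
Implicit Types (p c : 'rV[R]_d * R).

(* The point of [epi g] above [qvec q] which is nearest to [p]. *)
Definition cand (g : 'rV[R]_d -> \bar R) p (q : 'rV[rat]_d) : 'rV[R]_d * R :=
  (qvec q, Num.max (fine (g (qvec q))) p.2).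

Lemma cand_epi p q : edom g (qvec q) -> epi g (cand g p q).
Proof. by move=> gq; rewrite /epi /= -[g _](edom_fin cg gq) lee_fin le_max lexx. Qed.

(** A point of the epigraph is compared with the candidate over a nearby rational [q], where [g]
    exceeds the height of that point by at most [eta]. Taking the larger of [g] and [p.2] as height
    ensures that the vertical distance to [p] does not grow by more than [eta] either. *)
Lemma cand_dense p (m : R) : (forall q, edom g (qvec q) -> m <= sqd p (cand g p q)) ->
  forall c, epi g c -> m <= sqd p c.
Proof.
(* [C] comes from $(A + \eta)^2 \le A^2 + \eta (2A + 1)$ for $\eta \le 1$, summed over
   coordinates. *)
move=> H c gc; pose C := \sum_o (2 * `|crd p o - crd c o| + 1).
have C0 : 0 <= C by apply: sumr_ge0 => o _; rewrite addr_ge0// mulr_ge0.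
have gd : edom g c.1 by apply: le_lt_trans gc _; exact: ltry.
apply/ler_addgt0Pr => eps eps0.
pose eta := Num.min 1 (eps / (C + 1)).
have eta0 : 0 < eta by rewrite lt_min ltr01 divr_gt0// ltr_wpDl.
have eta1 : eta <= 1 by rewrite ge_min lexx.
have etaC : eta * C <= eps.
  apply: le_trans (_ : eta * (C + 1) <= _); first by rewrite mulrDr mulr1 lerDl ltW.
  by rewrite -ler_pdivlMr ?ltr_wpDl// ge_min lexx orbT.
have [q [qc qg [r r0 rq]]] := dom_dense e0 eta0 cg xe gd.
have gq : edom g (qvec q) by apply: rq => i; rewrite subrr normr0.
apply: le_trans (H q gq) _; apply: le_trans (_ : sqd p c + eta * C <= _); last by rewrite lerD2l.
rewrite /sqd /C mulr_sumr -big_split /=; apply: ler_sum => o _.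
have B : `|crd p o - crd (cand g p q) o| <= `|crd p o - crd c o| + eta.
  case: o => [i|] /=.
    have := qc i; rewrite -(subrKA (c.1 ord0 i) (p.1 ord0 i)) => h.
    by apply: le_trans (ler_normD _ _) _; rewrite lerD2l distrC ltW.
  have : fine (g (qvec q)) <= c.2 + eta.
    rewrite -lee_fin (edom_fin cg gq); apply: le_trans qg _; rewrite EFinD; exact: leeD2r.
  have := ler_norm (p.2 - c.2); have := lerNnormlW (lexx `|p.2 - c.2|).
  case: (leP (fine (g (qvec q))) p.2) => h; first by rewrite subrr normr0 addr_ge0// ltW.
  have -> : `|p.2 - fine (g (qvec q))| = fine (g (qvec q)) - p.2 by rewrite ltr0_norm ?opprB// subr_lt0.
  lra.
have := normr_ge0 (crd p o - crd (cand g p q) o); have := normr_ge0 (crd p o - crd c o).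
move: B; rewrite -(real_normK (num_real (crd p o - crd (cand g p q) o))) -(real_normK (num_real (crd p o - crd c o))).
by move: (`|_|) (`|_|) => A B; nra.
Qed.

Let S p := [set s | exists2 q, edom g (qvec q) & s = sqd p (cand g p q)].

Let sqd_ge0 p c : 0 <= sqd p c. Proof. by apply: sumr_ge0 => o _; exact: sqr_ge0. Qed.

Let S_inf p : has_inf (S p).
Proof.
split; last by exists 0 => _ [q _ ->].
by have [q xq] := qvec_dense x e0; exists (sqd p (cand g p q)), q => //; exact: xe.
Qed.

Lemma cand_ex p n : exists q, edom g (qvec q) /\
  forall q', edom g (qvec q') -> sqd p (cand g p q) <= sqd p (cand g p q') + n.+1%:R^-1.
Proof.
have n0 : 0 < n.+1%:R^-1 :> R by rewrite invr_gt0.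
have [_ [q gq ->] lt] := inf_adherent n0 (S_inf p); exists q; split => // q' gq'.
apply: le_trans (ltW lt) _; rewrite lerD2r; apply: ge_inf; first by case: (S_inf p).
by exists q'.
Qed.

(** Candidates that are nearly optimal among rational ones are nearly optimal in the whole epigraph,
    by [cand_dense], so they converge to the projection. *)
Lemma cand_proj p (q_ : nat -> 'rV[rat]_d) :
  (forall n, edom g (qvec (q_ n)) /\ forall q, edom g (qvec q) ->
    sqd p (cand g p (q_ n)) <= sqd p (cand g p q) + n.+1%:R^-1) ->
  exists2 P, is_proj (epi g) p P & forall o, crd (cand g p (q_ n)) o @[n --> \oo] --> crd P o.
Proof.
move=> H; apply: (@proj_near_min _ _ _ _ (inf (S p))) => //; first exact: cvx_epi.
- apply: cand_dense => q gq; apply: ge_inf; first by case: (S_inf p).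
  by exists q.
- by move=> n; apply: cand_epi; case: (H n).
- move=> n; rewrite -lerBlDr; apply: lb_le_inf; first by case: (S_inf p).
  by move=> _ [q gq ->]; rewrite lerBlDr; case: (H n) => _; exact.
Qed.

End Candidates.

Section ProjMinor.
Context {R : realType} {d : nat}.
Implicit Types (x y u : 'rV[R]_d) (P : 'rV[R]_d * R) (b r : R).

(** The two cases of the projection argument, with the smallest weight allowed by [proj_minor_flat].
    An explicit formula, rather than mere existence, makes slope and offset measurable functions of
    [t]. *)
Definition pslope y b x r P : 'rV[R]_d :=
  if 0 < P.2 - r then (P.2 - r)^-1 *: (x - P.1)
  else y + ((`|r| + `|dotv y x - b|) / dotv (x - P.1) (x - P.1)) *: (x - P.1).

Definition poffset y b x r P : R :=
  if 0 < P.2 - r then dotv ((P.2 - r)^-1 *: (x - P.1)) P.1 - P.2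
  else b + ((`|r| + `|dotv y x - b|) / dotv (x - P.1) (x - P.1)) * dotv (x - P.1) P.1.

Lemma proj_minor (g : 'rV[R]_d -> \bar R) y b x r P : convex_fun g -> (r%:E < g x)%E ->
  is_proj (epi g) (x, r) P -> minorizes g y b ->
  minorizes g (pslope y b x r P) (poffset y b x r P) /\
  r <= dotv (pslope y b x r P) x - poffset y b x r P.
Proof.
move=> cg rg pP mg; rewrite /pslope /poffset; case: ltP => c0.
  by have [? /ltW] := proj_minor_pos cg pP c0.
by apply: (proj_minor_flat cg rg pP) => //; apply/le_anti; rewrite c0 (proj_epi_ge pP).
Qed.

End ProjMinor.

(** * Measurable choice of the projection *)

Section Selection.
Context {R : realType} (D : set R).
Hypothesis mD : measurable D.

Lemma measurable_ifP (P : R -> Prop) (f g : R -> R) : measurable (D `&` [set t | P t]) ->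
  measurable_fun D f -> measurable_fun D g ->
  measurable_fun D (fun t => if `[< P t >] then f t else g t).
Proof.
move=> mP mf mg; apply: measurable_fun_if => //.
- apply: (measurable_fun_bool true) => //.
  by move: mP; congr (measurable (_ `&` _)); apply/seteqP; split => t /= /asboolP.
- by apply: measurable_funS mf => // t [].
- by apply: measurable_funS mg => // t [].
Qed.

Lemma measurable_first (K : nat -> R -> Prop) (F : nat -> R -> R) (k : R -> nat) :
  (forall j, measurable (D `&` [set t | K j t])) -> (forall j, measurable_fun D (F j)) ->
  (forall t, D t -> K (k t) t /\ forall j, (j < k t)%N -> ~ K j t) ->
  measurable_fun D (fun t => F (k t) t).
Proof.
move=> mK mF Hk; apply/measurable_EFinP; apply: measurable_gt => // c.
have : measurable (D `&` [set t | exists j, (K j t /\ forall i : 'I_j, ~ K i t) /\ (c%:E < (F j t)%:E)%E]).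
  apply: meas_ex => j; apply: meas_and; last by apply: meas_gt => //; exact/measurable_EFinP.
  by apply: meas_and => //; apply: meas_all => // i; exact: meas_not.
congr measurable; apply/seteqP; split => t [Dt] /= H; split => //; have [Kk lk] := Hk t Dt.
  case: H => j [[Kj lj] lt]; suff -> : k t = j by [].
  apply/eqP; rewrite eqn_leq; apply/andP; split; rewrite leqNgt; apply/negP => h.
    exact: lk h Kj.
  by apply: (lj (Ordinal h)).
by exists (k t); split => //; split => // -[i /= ik]; exact: lk.
Qed.

Lemma measurable_inv_ge0 (f : R -> R) : measurable_fun D f -> (forall t, D t -> 0 <= f t) ->
  measurable_fun D (fun t => (f t)^-1).
Proof.
move=> mf f0; apply: (eq_measurable_fun (fun t => f t `^ (-1))).
  by move=> t; rewrite inE => /f0 Dt; rewrite powR_inv1.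
exact: (measurableT_comp (measurable_powR _)).
Qed.

End Selection.

Section ProjSelection.
Context {R : realType} (T : R) (d : nat).
Variable h : R -> 'rV[R]_d -> \bar R.
Hypothesis hh : normal_integrand T h.
Hypothesis solid : forall t, I0T T t -> exists u e, 0 < e /\ cube u e `<=` edom (h t).
Let D := I0T T.
Let mD : measurable D. Proof. exact: measurable_itv. Qed.
Variables (x : R -> 'rV[R]_d) (r : R -> R).
Hypothesis mx : forall i, measurable_fun D (fun t => x t ord0 i).
Hypothesis mr : measurable_fun D r.

(** For each [n], the first rational candidate that is optimal up to [1 / (n + 1)] depends
    measurably on [t]; the projection is the pointwise limit of these candidates. *)
Lemma proj_select : exists P : R -> 'rV[R]_d * R,
  (forall o, measurable_fun D (fun t => crd (P t) o)) /\
  forall t, D t -> is_proj (epi (h t)) (x t, r t) (P t).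
Proof.
pose q_ j : 'rV[rat]_d := odflt 0 (unpickle j).
have q_s q : exists j, q_ j = q by exists (pickle q); rewrite /q_ pickleK.
pose c_ j t := cand (h t) (x t, r t) (q_ j).
have mc j o : measurable_fun D (fun t => crd (c_ j t) o).
  case: o => [i|] /=; first exact: measurable_cst.
  apply: measurable_maxr => //; apply: measurableT_comp; first exact: fine_measurable.
  exact: measurable_integrand_cst.
have mp o : measurable_fun D (fun t => crd (x t, r t) o) by case: o.
pose sq j t := sqd (x t, r t) (c_ j t).
have msq j : measurable_fun D (sq j).
  by apply: measurable_sum => o; apply: measurable_funX; exact: measurable_funB.
pose dm j t := (h t (qvec (q_ j)) < +oo)%E.
have mdm j : measurable (D `&` [set t | dm j t]).
  by apply: meas_lty => //; exact: measurable_integrand_cst.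
pose K n j t := dm j t /\ forall i, dm i t -> ~ sq i t + n.+1%:R^-1 < sq j t.
have mK n j : measurable (D `&` [set t | K n j t]).
  apply: meas_and => //; apply: meas_all => // i; apply: meas_imply => //; apply: meas_not => //.
  by apply: meas_lt => //; exact: measurable_funD.
have /choice [k Hk] (nt : nat * R) : exists m, D nt.2 ->
    K nt.1 m nt.2 /\ forall j, (j < m)%N -> ~ K nt.1 j nt.2.
  case: nt => n t /=; have [Dt|nD] := pselect (D t); last by exists 0%N.
  have [u [e [e0 ue]]] := solid Dt.
  have [q [gq Hq]] := cand_ex e0 ue (x t, r t) n; have [j jq] := q_s q.
  have EX : exists j, `[< K n j t >].
    exists j; apply/asboolP; split; first by rewrite /dm jq.
    by move=> i di; apply/negP; rewrite -leNgt /sq /c_ jq; exact: Hq.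
  exists (ex_minn EX) => _; case: ex_minnP => m /asboolP Km Hm; split => // i im Ki.
  by move: im; rewrite ltnNge Hm//; exact/asboolP.
have /choice [P HP] (t : R) : exists P : 'rV[R]_d * R, D t -> is_proj (epi (h t)) (x t, r t) P /\
    forall o, crd (c_ (k (n, t)) t) o @[n --> \oo] --> crd P o.
  have [Dt|nD] := pselect (D t); last by exists (0, 0).
  have [u [e [e0 ue]]] := solid Dt.
  have [|P pP cP] := cand_proj (hh.1 _ Dt) (hh.2.1 _ Dt) e0 ue (p := (x t, r t)) (q_ := fun n => q_ (k (n, t))).
    move=> n; have [[dk Hn] _] := Hk (n, t) Dt; split => // q gq; have [i iq] := q_s q.
    by have := Hn i; rewrite /dm /sq /c_ /= iq => /(_ gq) /negP; rewrite -leNgt.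
  by exists P.
exists P; split; last by move=> t Dt; case: (HP t Dt).
move=> o.
apply: (measurable_fun_cvg (h := fun n t => crd (c_ (k (n, t)) t) o)); last first.
  by move=> t Dt; case: (HP t Dt).
move=> n; apply: (measurable_first mD (K := K n) (F := fun j t => crd (c_ j t) o) (k := fun t => k (n, t))) => //.
by move=> t Dt; exact: (Hk (n, t)).
Qed.

Lemma measurable_pminor (y : R -> 'rV[R]_d) (b : R -> R) (P : R -> 'rV[R]_d * R) :
  (forall i, measurable_fun D (fun t => y t ord0 i)) -> measurable_fun D b ->
  (forall o, measurable_fun D (fun t => crd (P t) o)) -> 
  (forall i, measurable_fun D (fun t => pslope (y t) (b t) (x t) (r t) (P t) ord0 i)) /\
  measurable_fun D (fun t => poffset (y t) (b t) (x t) (r t) (P t)).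
Proof.
move=> my mb mP; have mP1 i : measurable_fun D (fun t => (P t).1 ord0 i) := mP (Some i).
have mP2 : measurable_fun D (fun t => (P t).2) := mP None.
pose n t := x t - (P t).1.
have mn i : measurable_fun D (fun t => n t ord0 i).
  rewrite (_ : (fun t => n t ord0 i) = (fun t => x t ord0 i - (P t).1 ord0 i)); last by apply/funext => t; rewrite !mxE.
  exact: measurable_funB.
pose c t := (P t).2 - r t; have mc : measurable_fun D c by exact: measurable_funB.
have mpos : measurable (D `&` [set t | 0 < c t]) by apply: meas_lt.
pose l t := (`|r t| + `|dotv (y t) (x t) - b t|) / dotv (n t) (n t).
have ml : measurable_fun D l.
  apply: measurable_funM.
    apply: measurable_funD; apply: measurableT_comp => //; apply: measurable_funB => //.
    exact: measurable_dotv.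
  by apply: measurable_inv_ge0 => //; [exact: measurable_dotv|move=> t _; exact: dotv_ge0].
pose ci t := Num.max (c t) 0; have mci : measurable_fun D (fun t => (ci t)^-1).
  apply: measurable_inv_ge0 => //; first exact: measurable_maxr.
  by move=> t _; rewrite le_max lexx orbT.
have ciE t : 0 < c t -> ci t = c t by move=> c0; rewrite /ci max_l// ltW.
have ma i : measurable_fun D (fun t => (ci t)^-1 * n t ord0 i) by exact: measurable_funM.
split => [i|].
  rewrite (_ : (fun t => _) = (fun t => if `[< 0 < c t >] then (ci t)^-1 * n t ord0 i
      else y t ord0 i + l t * n t ord0 i)).
    by apply: measurable_ifP => //; apply: measurable_funD => //; exact: measurable_funM.
  apply/funext => t; rewrite /pslope asboolb -/(c t); case: ifP => [c0|_].
    by rewrite [LHS]mxE ciE.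
  by rewrite mxE [X in _ + X]mxE.
rewrite (_ : (fun t => _) = (fun t => if `[< 0 < c t >] then (ci t)^-1 * dotv (n t) (P t).1 - (P t).2
    else b t + l t * dotv (n t) (P t).1)).
  by apply: measurable_ifP => //; [apply: measurable_funB => //|apply: measurable_funD => //];
    apply: measurable_funM => //; exact: measurable_dotv.
apply/funext => t; rewrite /poffset asboolb -/(c t) -/(n t) -/(l t); case: ifP => [c0|_] //.
by rewrite dotvZl ciE.
Qed.

End ProjSelection.

Section Domination.
Context {R : realType} (m : {measure set R -> \bar R}) (D : set R).
Hypothesis mD : measurable D.

Lemma integrable_dom (f g : R -> R) : m.-integrable D (EFin \o g) -> measurable_fun D f ->
  (forall t, D t -> `|f t| <= g t) -> m.-integrable D (EFin \o f).
Proof.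
move=> Ig mf fg; apply: le_integrable Ig => //; first exact/measurable_EFinP.
by move=> t Dt /=; rewrite lee_fin; apply: le_trans (fg t Dt) (ler_norm _).
Qed.

Lemma integrable_cst_fin (c : R) : (m D < +oo)%E -> m.-integrable D (EFin \o cst c).
Proof.
move=> mf; apply/integrableP; split; first by apply/measurable_EFinP; exact: measurable_cst.
have := @integral_cst _ _ _ m D mD `|c%:E|; rewrite /cst /= => ->.
by rewrite lte_mul_pinfty// lee_fin.
Qed.

Lemma integrable_normD (f g : R -> R) : m.-integrable D (EFin \o f) -> m.-integrable D (EFin \o g) ->
  m.-integrable D (EFin \o (fun t => `|f t| + `|g t|)).
Proof. by move=> If Ig; exact: (integrableD mD (integrable_abse If) (integrable_abse Ig)). Qed.

Lemma integrable_if (P : R -> Prop) (f g : R -> R) : measurable (D `&` [set t | P t]) ->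
  m.-integrable D (EFin \o f) -> m.-integrable D (EFin \o g) ->
  m.-integrable D (EFin \o (fun t => if `[< P t >] then f t else g t)).
Proof.
move=> mP If Ig; apply: integrable_dom (integrable_normD If Ig) _ _.
  by apply: measurable_ifP => //; apply/measurable_EFinP; [exact: measurable_int If|exact: measurable_int Ig].
by move=> t _; case: ifP => _; rewrite ?lerDl ?lerDr.
Qed.

End Domination.

Section Minorants.
Context {R : realType} (T : R) (d : nat).
Hypothesis T0 : 0 < T.
Variables (mu : {measure set R -> \bar R}) (h : R -> 'rV[R]_d -> \bar R).
Hypothesis hmu : good_measure T mu.
Hypothesis hh : normal_integrand T h.
Hypothesis hint_dom : forall x, inX T x -> in_int_Linf_dom T mu h x -> (Ih T mu h x < +oo)%E.
Hypothesis hdom_cl : forall x, inX T x -> (Ih T mu h x < +oo)%E ->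
  forall t, (I0T T) t -> closure (edom (h t)) (x t).
Hypothesis hproper : forall x, inX T x -> Ih T mu h x != -oo%E.
Hypothesis hint_ne : exists2 x, inX T x & in_int_Linf_dom T mu h x.
Implicit Types (x z : R -> 'rV[R]_d) (v : Vtype R d).
Let D := I0T T.
Let mD : measurable D. Proof. exact: measurable_itv. Qed.
Let muD : (mu D < +oo)%E. Proof. by case: hmu => _ []. Qed.
Let solid t : I0T T t -> exists u e, 0 < e /\ cube u e `<=` edom (h t).
Proof. exact: (dom_solid hh hint_dom hdom_cl hint_ne). Qed.

Definition int_minorant (a : R -> 'rV[R]_d) (b : R -> R) : Prop :=
  [/\ forall i, mu.-integrable D (EFin \o (fun t => a t ord0 i)), mu.-integrable D (EFin \o b) &
      forall t, D t -> minorizes (h t) (a t) (b t)].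

Lemma int_minorant_integrable a b x : inX T x -> int_minorant a b ->
  mu.-integrable D (EFin \o (fun t => dotv (x t) (a t) - b t)).
Proof. by move=> Xx [Ia Ib _]; exact: (integrableB mD (inX_dotv T0 Xx Ia) Ib). Qed.

(** Projecting the point one unit below the graph at [xb t] gives a minorant [a], [b]. Its
    integrability comes from testing it at [xb t] plus or minus [e / 2] in each coordinate
    direction, where [h] is integrable: this bounds [e / 2 * |a_i|]. *)
Lemma base_minorant : exists a b, int_minorant a b.
Proof.
have [xb Zb] := unif_int_ex hh hint_dom hdom_cl hint_ne; have [Xb [e e0 He]] := Zb.
have mxb i := inX_measurable T0 i Xb.
have [IH _] := unif_int_integrable T0 hh hint_dom hproper Zb.
pose H t := fine (h t (xb t)); pose r t := H t - 1.
have mH : measurable_fun D H by apply/measurable_EFinP; exact: measurable_int IH.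
have mr : measurable_fun D r by apply: measurable_funB => //; exact: measurable_cst.
have [P [mP pP]] := proj_select hh solid mxb mr.
(* The zero arguments are placeholders: [xb t] lies in the domain, so the hyperplane is never
   vertical and the first branch is taken. *)
pose a t := pslope 0 0 (xb t) (r t) (P t); pose b t := poffset 0 0 (xb t) (r t) (P t).
have [ma mb] : (forall i, measurable_fun D (fun t => a t ord0 i)) /\ measurable_fun D b.
  by apply: (measurable_pminor mxb mr (y := cst 0) (b := cst 0)) => // i; exact: measurable_cst.
have key t : D t -> minorizes (h t) (a t) (b t) /\ r t < dotv (a t) (xb t) - b t.
  move=> Dt; have cg := hh.1 _ Dt; have gx := unif_int_dom Zb Dt.
  have rg : ((r t)%:E < h t (xb t))%E.
    by rewrite -(unif_int_fine hh Zb Dt) lte_fin /r -/(H t); lra.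
  have c0 := proj_epi_gt0 cg rg (pP t Dt) gx.
  by rewrite /a /b /pslope /poffset c0; exact: (proj_minor_pos cg (pP t Dt) c0).
have min t Dt := (key t Dt).1.
pose w (s : R) i : 'rV[R]_d := \row_j (if j == i then s else 0).
have Zw s i : `|s| = e / 2 -> unif_int T h (fun t => xb t + w s i).
  move=> se; split; first by apply: inXD => //; exact: inX_cst.
  exists (e / 2); first lra.
  move=> t Dt u uw; apply: (He t Dt) => j; have := uw j; rewrite !mxE.
  move: se; case: (j == i); last by rewrite addr0 => _ h1; apply: lt_trans h1 _; lra.
  by move=> h1; have := ler_norm s; have := lerNnormlW (lexx `|s|); rewrite h1 !ltr_norml; lra.
have e2 : `|e / 2| = e / 2 by rewrite gtr0_norm//; lra.
have e2' : `|- (e / 2)| = e / 2 by rewrite normrN.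
pose G s i t := fine (h t (xb t + w s i)).
have IG s i : `|s| = e / 2 -> mu.-integrable D (EFin \o G s i).
  by move=> se; case: (unif_int_integrable T0 hh hint_dom hproper (Zw s i se)).
have aG s i t : `|s| = e / 2 -> D t -> s * a t ord0 i <= `|G s i t| + `|H t| + 1.
  move=> se Dt; have [mt rt] := key t Dt; have := mt (xb t + w s i).
  rewrite -(unif_int_fine hh (Zw s i se) Dt) lee_fin -/(G s i t) dotvDr.
  have -> : dotv (a t) (w s i) = s * a t ord0 i.
    rewrite /dotv (bigD1 i)//= big1 ?addr0; first by rewrite mxE eqxx mulrC.
    by move=> j /negPf ji; rewrite mxE ji mulr0.
  by have := ler_norm (G s i t); have := lerNnormlW (lexx `|H t|); move: rt; rewrite /r; lra.
have I1 : mu.-integrable D (EFin \o cst 1) by exact: integrable_cst_fin.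
have Ia i : mu.-integrable D (EFin \o (fun t => a t ord0 i)).
  pose B t := 2 / e * ((`|G (e / 2) i t| + `|G (- (e / 2)) i t|) + (`|H t| + `|1|)).
  apply: (@integrable_dom _ _ _ mD _ B) => //.
    have I2 := integrableD mD (integrable_normD mD (IG _ i e2) (IG _ i e2')) (integrable_normD mD IH I1).
    by apply: eq_integrable (integrableZl mD (2 / e) I2) => // t _.
  move=> t Dt; have h1 := aG _ i t e2 Dt; have h2 := aG _ i t e2' Dt.
  rewrite /B normr1 mulrAC ler_pdivlMr// mulrC -ler_pdivrMl// mulrA [2^-1 * e]mulrC.
  rewrite -e2 -normrM ler_norml e2.
  move: h1 h2 (normr_ge0 (G (e / 2) i t)) (normr_ge0 (G (- (e / 2)) i t)); rewrite mulNr.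
  by move: (e / 2 * a t ord0 i) => z; lra.
exists a, b; split => //.
have Iax := inX_dotv T0 Xb Ia.
apply: (@integrable_dom _ _ _ mD _ (fun t => (`|dotv (xb t) (a t)| + `|H t|) + `|1|)) => //.
  by have := integrableD mD (integrable_normD mD Iax IH) (integrable_abse I1); apply: eq_integrable.
move=> t Dt; have [mt rt] := key t Dt; have := mt (xb t).
rewrite -(unif_int_fine hh Zb Dt) lee_fin -/(H t) normr1 dotvC => le; move: rt; rewrite dotvC /r.
have := ler_norm (H t); have := lerNnormlW (lexx `|H t|).
have := ler_norm (dotv (xb t) (a t)); have := lerNnormlW (lexx `|dotv (xb t) (a t)|).
by rewrite ler_norml; move: le; move: (dotv _ _) => z; lra.
Qed.

(** Minorants, unlike functions of [X], may be selected pointwise along any measurable set, so no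
    approximation by intervals intervenes. *)
Lemma minorant_max a1 b1 a2 b2 x : (forall i, measurable_fun D (fun t => x t ord0 i)) ->
  int_minorant a1 b1 -> int_minorant a2 b2 -> exists a b, int_minorant a b /\
  forall t, dotv (x t) (a t) - b t = Num.max (dotv (x t) (a1 t) - b1 t) (dotv (x t) (a2 t) - b2 t).
Proof.
move=> mx [Ia1 Ib1 m1] [Ia2 Ib2 m2].
pose P t := dotv (x t) (a1 t) - b1 t < dotv (x t) (a2 t) - b2 t.
have meas (a : R -> 'rV[R]_d) (b : R -> R) : (forall i, mu.-integrable D (EFin \o (fun t => a t ord0 i))) ->
    mu.-integrable D (EFin \o b) -> measurable_fun D (fun t => dotv (x t) (a t) - b t).
  move=> Ia Ib; apply: measurable_funB; last by apply/measurable_EFinP; exact: measurable_int Ib.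
  by apply: measurable_dotv => // i; apply/measurable_EFinP; exact: measurable_int (Ia i).
have mP : measurable (D `&` [set t | P t]) by apply: meas_lt => //; exact: meas.
exists (fun t => if `[< P t >] then a2 t else a1 t), (fun t => if `[< P t >] then b2 t else b1 t).
split; first split.
- move=> i; rewrite (_ : (fun t => _) = (fun t => if `[< P t >] then a2 t ord0 i else a1 t ord0 i)).
    exact: integrable_if.
  by apply/funext => t; case: ifP.
- exact: integrable_if.
- by move=> t Dt; case: ifP => _; [exact: m2|exact: m1].
by move=> t; rewrite asboolb /P; case: ltP.
Qed.

Lemma minorant_runmax (a : nat -> R -> 'rV[R]_d) (b : nat -> R -> R) x n :
  (forall i, measurable_fun D (fun t => x t ord0 i)) -> (forall k, int_minorant (a k) (b k)) ->
  exists a' b', int_minorant a' b' /\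
  forall t, dotv (x t) (a' t) - b' t = runmax (fun k t => dotv (x t) (a k t) - b k t) n t.
Proof.
move=> mx Hab; elim: n => [|n [a' [b' [m' E]]]]; first by exists (a 0%N), (b 0%N).
have [a2 [b2 [m2 E2]]] := minorant_max mx m' (Hab n.+1); exists a2, b2; split => // t.
by rewrite E2 E.
Qed.

(* The minorants at [x t] obtained by projecting points below the graph are truncated, where they
   are large, to a fixed integrable minorant. *)
Lemma minorant_approx x (A : R) : inX T x -> (A%:E < Ih T mu h x)%E ->
  exists a b, int_minorant a b /\ A < (\int[mu]_(t in D) (dotv (x t) (a t) - b t))%R.
Proof.
move=> Xx lt; have mx i := inX_measurable T0 i Xx.
have [y0 [b0 [Iy Ib m0]]] := base_minorant.
have my i : measurable_fun D (fun t => y0 t ord0 i) by apply/measurable_EFinP; exact: measurable_int (Iy i).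
have mb : measurable_fun D b0 by apply/measurable_EFinP; exact: measurable_int Ib.
have mF := inX_integrand T0 hh Xx.
pose fin t := (h t (x t) < +oo)%E.
(* Real levels strictly below [h t (x t)] that approach it as [n] grows, also where it is
   infinite. *)
pose r n t : R := if `[< fin t >] then fine (h t (x t)) - n.+1%:R^-1 else n%:R.
have mr n : measurable_fun D (r n).
  apply: measurable_ifP => //; first exact: meas_lty.
  by apply: measurable_funB => //; apply: measurableT_comp mF; exact: fine_measurable.
have rh n t : D t -> ((r n t)%:E < h t (x t))%E.
  move=> Dt; rewrite /r asboolb; case: ifP => [ft|].
    by rewrite -[ltRHS](edom_fin (hh.1 _ Dt) ft) lte_fin ltrBlDr ltrDl invr_gt0.
  by move=> /negbT; rewrite -leNgt leye_eq => /eqP ->; exact: ltry.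
have /choice [P HP] n := proj_select hh solid mx (mr n).
pose s n t := pslope (y0 t) (b0 t) (x t) (r n t) (P n t).
pose o n t := poffset (y0 t) (b0 t) (x t) (r n t) (P n t).
have mso n := measurable_pminor mx (mr n) my mb (HP n).1.
have Hso n t (Dt : D t) := proj_minor (hh.1 _ Dt) (rh n t Dt) ((HP n).2 t Dt) (m0 t Dt).
(* On this set slope and offset are bounded by [k], hence integrable; as [k] grows every [t] is
   eventually included. *)
pose E n k t := (forall i, `|s n t ord0 i| < k%:R) /\ `|o n t| < k%:R.
have mE n k : measurable (D `&` [set t | E n k t]).
  have [ms mo] := mso n; apply: meas_and.
    by apply: meas_all => // i; apply: meas_lt => //; exact: measurableT_comp.
  by apply: meas_lt => //; exact: measurableT_comp.
pose ai n k t := if `[< E n k t >] then s n t else y0 t.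
pose bi n k t := if `[< E n k t >] then o n t else b0 t.
have minor n k : int_minorant (ai n k) (bi n k).
  have [ms mo] := mso n; have Ik := integrable_cst_fin mD k%:R muD.
  split.
  - move=> i; rewrite (_ : (fun t => _) = (fun t => if `[< E n k t >] then s n t ord0 i else y0 t ord0 i)).
      apply: (integrable_dom mD (integrable_normD mD Ik (Iy i))); first exact: measurable_ifP.
      move=> t Dt; case: asboolP => [[H _]|_]; last by rewrite lerDr.
      by apply: le_trans (ltW (H i)) _; rewrite /= ger0_norm// lerDl.
    by apply/funext => t; rewrite /ai; case: ifP.
  - apply: (integrable_dom mD (integrable_normD mD Ik Ib)); first exact: measurable_ifP.
    move=> t Dt; rewrite /bi; case: asboolP => [[_ H]|_]; last by rewrite lerDr.
    by apply: le_trans (ltW H) _; rewrite /= ger0_norm// lerDl.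
  - by move=> t Dt; rewrite /ai /bi; case: ifP => _; [exact: (Hso n t Dt).1|exact: m0].
pose a j := if unpickle j is Some nk then ai nk.1 nk.2 else y0.
pose b j := if unpickle j is Some nk then bi nk.1 nk.2 else b0.
have mab j : int_minorant (a j) (b j) by rewrite /a /b; case: unpickle.
have [n Hn] : exists n, A < (\int[mu]_(t in D) runmax (fun j t => dotv (x t) (a j t) - b j t) n t)%R.
  apply: eint_runmax lt => //.
  - by move=> j; exact: int_minorant_integrable.
  - by move=> t Dt; rewrite dotvC; case: (mab 0%N) => _ _ /(_ t Dt); apply.
  apply: aeW => t Dt c Hc; rewrite leNgt; apply/negP => lc.
  have [n' [c' cE cr]] : exists n, exists2 c' : R, c = c'%:E & c' < r n t.
    case: c Hc lc => [c| |] Hc lc; [|by rewrite ltNge leey in lc|by have := Hc 0%N].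
    case fE : (fin t).
      move: lc; rewrite -[h t _](edom_fin (hh.1 _ Dt) fE) lte_fin -subr_gt0 => c0.
      have [n _ Hn] := near_infty_natSinv_lt (PosNum c0).
      exists n, c => //; rewrite /r asboolb fE; have := Hn n (leqnn n); rewrite /=.
      by set z := n.+1%:R^-1; lra.
    have [n cn] : exists n : nat, c < n%:R.
      by exists (Num.bound `|c|); apply: le_lt_trans (ler_norm _) (archi_boundP _).
    by exists n, c => //; rewrite /r asboolb fE.
  have [k [Hs Ho]] : exists k, E n' k t.
    pose B := \sum_i `|s n' t ord0 i| + `|o n' t|.
    have B0 : 0 <= B by rewrite addr_ge0// sumr_ge0.
    exists (Num.bound B); have HB := archi_boundP B0; split => [i|]; apply: le_lt_trans HB.
      by rewrite /B (bigD1 i)//= -addrA lerDl addr_ge0// sumr_ge0.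
    by rewrite /B lerDr sumr_ge0.
  have := Hc (pickle (n', k)); rewrite cE /a /b pickleK /= /ai /bi asboolT//.
  rewrite lee_fin; apply/negP; rewrite -ltNge; apply: lt_le_trans cr _.
  by rewrite dotvC; exact: (Hso n' t Dt).2.
have [a' [b' [m' E']]] := minorant_runmax n mx mab; exists a', b'; split => //.
by under eq_Rintegral do rewrite E'.
Qed.

End Minorants.

(** * Lower semicontinuity *)

Lemma lte_split (R : realType) (x y : \bar R) (a : R) : (a%:E < x + y)%E ->
  exists b c : R, [/\ (b%:E < x)%E, (c%:E < y)%E & a < b + c].
Proof.
move=> lt; have [b bx lb] : exists2 b : R, (b%:E < x)%E & (a%:E < b%:E + y)%E.
  apply: contrapT => H; move: lt; apply/negP; rewrite -leNgt; apply: lee_add_approx => b bx.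
  by rewrite leNgt; apply/negP => lb; apply: H; exists b.
have [c cy lc] : exists2 c : R, (c%:E < y)%E & (a%:E < c%:E + b%:E)%E.
  apply: contrapT => H; move: lb; apply/negP; rewrite -leNgt addeC; apply: lee_add_approx => c cy.
  by rewrite leNgt; apply/negP => lc; apply: H; exists c.
by exists b, c; split => //; rewrite -lte_fin addrC EFinD.
Qed.

Section Closedness.
Context {R : realType} (T : R) (d : nat).
Hypothesis T0 : 0 < T.
Variables (mu : {measure set R -> \bar R}) (h : R -> 'rV[R]_d -> \bar R).
Hypothesis hmu : good_measure T mu.
Hypothesis hh : normal_integrand T h.
Hypothesis hint_dom : forall x, inX T x -> in_int_Linf_dom T mu h x -> (Ih T mu h x < +oo)%E.
Hypothesis hdom_cl : forall x, inX T x -> (Ih T mu h x < +oo)%E ->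
  forall t, (I0T T) t -> closure (edom (h t)) (x t).
Hypothesis hproper : forall x, inX T x -> Ih T mu h x != -oo%E.
Hypothesis hint_ne : exists2 x, inX T x & in_int_Linf_dom T mu h x.
Variables k0 kT : 'rV[R]_d -> \bar R.
Hypothesis hk0 : closed_proper_convex k0.
Hypothesis hkT : closed_proper_convex kT.
Implicit Types (x z : R -> 'rV[R]_d).
Let mI : measurable (I0T T). Proof. exact: measurable_itv. Qed.
Let mu0 t : mu [set t] = 0%E. Proof. by case: hmu => _ [_ []]. Qed.

(* [v] with [Dv = - a mu], [v.2 T = yT] and [v.1 - v.2 0 = y0]. *)
Lemma primitive_ex (a : R -> 'rV[R]_d) (y0 yT : 'rV[R]_d) :
  (forall i, mu.-integrable (I0T T) (EFin \o (fun t => a t ord0 i))) ->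
  exists v, inV T v /\ forall x, inX T x -> pairing T v x =
    dotv (x 0) y0 + dotv (xTplus T x) yT + (\int[mu]_(t in I0T T) dotv (x t) (a t))%R.
Proof.
move=> Ia; pose W t : 'rV[R]_d := \row_i (\int[mu]_(r in Icc0 t) a r ord0 i)%R.
pose v2 t := yT + W T - W t; pose v : Vtype R d := (v2 0 + y0, v2).
have Vv : inV T v.
  rewrite /inV /=; have cW i : {within I0T T, continuous (fun t => v2 t ord0 i)}.
    rewrite (_ : (fun t => v2 t ord0 i) =
        (fun t => (yT + W T) ord0 i - (\int[mu]_(r in Icc0 t) a r ord0 i)%R)).
      move=> t; apply: cvgB; first exact: cvg_cst.
      have := Rint_continuous (Ia i) mu0; rewrite /from_subspace; exact.
    by apply/funext => t; rewrite /v2 !mxE.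
  by apply/subspace_continuousP => t It; apply/cvg_coordP => i; move/subspace_continuousP : (cW i); exact.
exists v; split => // x Xx.
have Icc00 : Icc0 0 = [set 0 : R] by rewrite /Icc0 set_itv1.
have Ina i : mu.-integrable (I0T T) (EFin \o (fun t => (- a t) ord0 i)).
  by apply: eq_integrable (integrableN (Ia i)) => // t _; rewrite /= mxE.
have I0 i : mu.-integrable (I0T T) (EFin \o (fun t => (0 : 'rV[R]_d) ord0 i)).
  by apply: eq_integrable (integrable0 mu (I0T T)) => // t _; rewrite /= mxE.
have E t (i : 'I_d) : I0T T t -> ((v.2 t ord0 i - v.2 0 ord0 i)%:E =
    \int[mu]_(r in Icc0 t) ((- a r) ord0 i)%:E + \int[mu]_(r in Icc0 t) ((0 : 'rV[R]_d) ord0 i)%:E)%E.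
  move=> It; have sub : Icc0 t `<=` I0T T.
    move: It; rewrite /Icc0 /I0T/= !in_itv/= => /andP[_ tT] r /=.
    by rewrite !in_itv/= => /andP[-> /le_trans]; apply.
  have mt : measurable (Icc0 t) by exact: measurable_itv.
  have It' := integrableS mI mt sub (Ia i).
  under [X in (_ = _ + X)%E]eq_integral do rewrite mxE.
  rewrite integral0 adde0; under eq_integral do rewrite mxE EFinN.
  rewrite integralN; last by apply: integrable_add_def.
  rewrite -EFin_Rintegral// -EFinN; congr EFin.
  rewrite /v /v2 /= !mxE Icc00 Rint_set1 mu0 /= mulr0; ring.
rewrite (pairing_parts T0 Vv Xx (mu0 0) (mu0 0) Ina I0 E).
have -> : v.1 - v.2 0 = y0 by rewrite /v /= addrAC subrr add0r.
have -> : v.2 T = yT by rewrite /v /v2 /= addrK.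
rewrite (dotvC y0) (dotvC yT) /xTplus.
have -> : (\int[mu]_(t in I0T T) dotv (x t) (0 : 'rV[R]_d))%R = 0.
  have d0 t : dotv (x t) (0 : 'rV[R]_d) = 0 by rewrite /dotv big1// => i _; rewrite mxE mulr0.
  rewrite /Rintegral; under eq_integral do rewrite d0.
  by rewrite integral0.
have -> : (\int[mu]_(t in I0T T) dotv (x t) (- a t))%R = - (\int[mu]_(t in I0T T) dotv (x t) (a t))%R.
  rewrite -[RHS]mulN1r -RintegralZl//; last exact: inX_dotv.
  by apply: eq_Rintegral => t _; rewrite dotvNr mulN1r.
by rewrite addrC; ring.
Qed.

(** A single [v] suffices: the minorants of [h], [k0] and [kT] add up to [<v,y>] minus a constant,
    an affine weakly continuous minorant of the function whose value [S] at [x] exceeds [al]. The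
    gap [S - al] is the radius of the neighbourhood. *)
Lemma ffun_lsc : weak_lsc T (ffun T mu h k0 kT).
Proof.
move=> x Xx al; rewrite /ffun => /lte_split[b [c [/lte_split[A [b' [lA lb']]] bb lc cc]]].
have [ck0 [cl0 D0]] := hk0; have [ckT [clT DT]] := hkT.
have [a [be [[Ia Ib mab] lAI]]] := minorant_approx T0 hmu hh hint_dom hdom_cl hproper hint_ne Xx lA.
have [y0 [b0 [m0 l0]]] := minor_sup ck0 cl0 D0 lb'; have [yT [bT [mT lT]]] := minor_sup ckT clT DT lc.
have [v [Vv Pv]] := primitive_ex y0 yT Ia.
pose S := (\int[mu]_(t in I0T T) dotv (x t) (a t))%R - (\int[mu]_(t in I0T T) be t)%R +
  (dotv y0 (x 0) - b0) + (dotv yT (xTplus T x) - bT).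
exists 1%N, (fun=> v), (S - al); split => //.
have Ix := inX_dotv T0 Xx Ia.
split.
  move: lAI; rewrite RintegralB// /S => lAI; move: lAI l0 lT bb cc.
  by move: (Rintegral mu _ _) (Rintegral mu _ _) (dotv _ _) (dotv _ _) => *; lra.
move=> y Xy /(_ ord0); rewrite (pairingB T0 Vv Xy Xx (inXB Xy Xx)) !Pv// ltr_norml => /andP[lo _].
have Iy := inX_dotv T0 Xy Ia.
have IyB : mu.-integrable (I0T T) (fun t => (dotv (y t) (a t) - be t)%:E) by exact: (integrableB mI Iy Ib).
have hy : ((\int[mu]_(t in I0T T) dotv (y t) (a t) - \int[mu]_(t in I0T T) be t)%R%:E <= Ih T mu h y)%E.
  rewrite -RintegralB// EFin_Rintegral//; apply: eint_ge => //; first exact: (inX_integrand T0).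
  by move=> t It; rewrite dotvC; exact: mab.
apply: lt_le_trans (leeD (leeD hy (m0 (y 0))) (mT (xTplus T y))).
move: lo; rewrite -!EFinD lte_fin /S !(dotvC y0) !(dotvC yT) => lo.
by move: lo; move: (dotv _ _) (dotv _ _) (dotv _ _) (dotv _ _) (Rintegral mu _ _) (Rintegral mu _ _) (Rintegral mu _ _) => *; lra.
Qed.

End Closedness.

Theorem theorem2 (R : realType) (T : R) (d : nat)
  (hT : 0 < T) (hd : (0 < d)%N)
  (mu : {measure set R -> \bar R}) (hmu : good_measure T mu)
  (k0 kT : 'rV[R]_d -> \bar R)
  (hk0 : closed_proper_convex k0) (hkT : closed_proper_convex kT)
  (h : R -> 'rV[R]_d -> \bar R) (hh : normal_integrand T h)
  (hisc : left_isc T (fun t => edom (h t)))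
  (hint_dom : forall x, inX T x -> in_int_Linf_dom T mu h x ->
                (Ih T mu h x < +oo)%E)
  (hdom_cl : forall x, inX T x -> (Ih T mu h x < +oo)%E ->
                forall t, (I0T T) t -> closure (edom (h t)) (x t))
  (hproper : (exists2 x, inX T x & (Ih T mu h x < +oo)%E) /\
             (forall x, inX T x -> Ih T mu h x != -oo%E))
  (hint_ne : exists2 x, inX T x & in_int_Linf_dom T mu h x) :
  let f := ffun T mu h k0 kT in
  let hs := fun t => conjv (h t) in
  weak_lsc T f /\
  (forall v, inV T v ->
     (inVBV T v ->
        (exists a s sig, DvDec T mu v a s sig) /\
        (forall a s sig, DvDec T mu v a s sig ->
           fconj T f v =
             (Jfun T mu hs (fun t => - a t)%R (fun t => - s t)%R sig
              + conjv k0 (v.1 - v.2 0)%R + conjv kT (v.2 T))%E)) /\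
     (~ inVBV T v -> fconj T f v = +oo%E)) /\
  (forall x v, inX T x -> inV T v ->
     (fsubdiff T f x v <->
        inVBV T v /\
        exists a s sig, DvDec T mu v a s sig /\
          (\forall t \ae mu, (I0T T) t -> subdiff (h t) (x t) (- a t)) /\
          (\forall t \ae sig, (I0T T) t -> subdiff_s (h t) (x t) (- s t)) /\
          subdiff k0 (x 0) (v.1 - v.2 0) /\
          subdiff kT (xTplus T x) (v.2 T))).
Proof.
have [_ hNy] := hproper; have [muC [muI _]] := hmu.
move=> f hs; split.
  exact: (ffun_lsc hT hmu hh hint_dom hdom_cl hNy hint_ne hk0 hkT).
split.
  move=> v Vv; split; last first.
    exact: (fconj_notBV hT hmu hh hint_dom hdom_cl hNy hint_ne hk0 hkT Vv).
  move=> BVv; split; first by apply: (DvDec_ex hT) => //; exact: (concentrated_fin muC muI).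
  by move=> a s sig dec; exact: (fconj_dec hT hmu hh hint_dom hdom_cl hNy hisc hint_ne Vv dec hk0 hkT).
move=> x v Xx Vv; split.
  exact: (subdiff_nec hT hmu hh hint_dom hdom_cl hNy hisc hint_ne hk0 hkT Xx Vv).
move=> [_ [a [s [sig [dec [Sa [Ss [S0 ST]]]]]]]].
exact: (subdiff_suff hT hmu hh hdom_cl hNy hk0 hkT Xx Vv dec Sa Ss S0 ST).
Qed.
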